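(* Let $F(\mathbf{u}_0,\ldots,\mathbf{u}_d)$ be the $\Delta$-Chow form of an irreducible $\Delta$-variety $V\subseteq\mathbb{A}^n$ over $\mathcal{F}$ of Kolchin polynomial $\omega_V(t)=(d+1)\binom{t+m}{m}-\binom{t+m-s}{m}$. Fix an orderly ranking on $\mathbf{u}_0,\ldots,\mathbf{u}_d$ with $u_{00}$ greater than any other $u_{ij}$, and suppose $\mathrm{ld}(F)=\theta(u_{00})$ and $g=\deg(F,\theta(u_{00}))$. Then for each $l=1,\ldots,g$ there exist $\xi_{l1},\ldots,\xi_{ln}$ in the differential extension field $(\mathcal{F}_l,\{\delta_{l,1},\ldots,\delta_{l,m}\})$ of $(\mathcal{F}_{\mathbf{u}},\Delta)$ such that $$F(\mathbf{u}_0,\mathbf{u}_1,\ldots,\mathbf{u}_d)=A(\mathbf{u}_0,\mathbf{u}_1,\ldots,\mathbf{u}_d)\prod_{l=1}^g\theta\Big(u_{00}+\sum_{\rho=1}^nu_{0\rho}\xi_{l\rho}\Big),$$ where $A(\mathbf{u}_0,\ldots,\mathbf{u}_d)\in\mathcal{F}\{\mathbf{u}_0,\ldots,\mathbf{u}_d\}$, and where the factors are understood in the sense $$\theta\Big(u_{00}+\sum_{\rho=1}^nu_{0\rho}\xi_{l\rho}\Big):=\theta(u_{00})+\theta_l\Big(\sum_{\rho=1}^nu_{0\rho}\xi_{l\rho}\Big).$$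
   Context: Setting: $m\ge 2$; $\mathcal{F}$ is a field of characteristic $0$ with commuting derivations $\Delta=\{\delta_1,\ldots,\delta_m\}$, $\mathcal{E}$ a universal $\Delta$-extension field of $\mathcal{F}$, $d,s\in\mathbb{N}$. $\Theta$ is the free commutative monoid generated by $\Delta$, $\mathrm{ord}(\prod\delta_i^{e_i})=\sum e_i$; $\tau|\tau'$ is divisibility in $\Theta$. A $\Delta$-variety over $\mathcal{F}$ is the zero set in $\mathbb{A}^n=\mathcal{E}^n$ of a subset of the $\Delta$-polynomial ring $\mathcal{F}\{\mathbb{Y}\}$, $\mathbb{Y}=\{y_1,\ldots,y_n\}$; it is irreducible iff its vanishing $\Delta$-ideal $\mathbb{I}(V)$ is prime; $\omega_V(t)$ is the numerical polynomial equal for large $t$ to $\dim(\mathbb{I}(V)\cap\mathcal{F}[\theta(y_j):\mathrm{ord}(\theta)\le t])$. A ranking is a total order on derivatives with $\delta_ku>u$ and $u>v\Rightarrow\delta_ku>\delta_kv$; it is orderly if derivatives of higher order are greater. The leader $\mathrm{ld}(F)$ is the greatest derivative appearing in $F$; the separant $S_F$ is the partial derivative of $F$ with respect to its leader; the initial $I_F$ is the coefficient of the highest power of the leader. $\Delta$-Chow form: let $\mathbb{L}_i=u_{i0}+\sum_{j=1}^nu_{ij}y_j$ ($0\le i\le d$), $\mathbf{u}_i=(u_{i0},\ldots,u_{in})$ independent $\Delta$-indeterminates. The $\Delta$-Chow form of $V$ is the irreducible $F\in\mathcal{F}\{\mathbf{u}_0,\ldots,\mathbf{u}_d\}$ (it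 exists for $V$ with the given Kolchin polynomial, and has order $s$) such that $[\mathbb{I}(V),\mathbb{L}_0,\ldots,\mathbb{L}_d]\cap\mathcal{F}\{\mathbf{u}_0,\ldots,\mathbf{u}_d\}=\mathrm{sat}(F):=[F]:(I_FS_F)^\infty$. The fields $\mathcal{F}_l$: let $\mathcal{F}_{\mathbf{u}}=\mathcal{F}\langle\mathbf{u}_1,\ldots,\mathbf{u}_d,u_{01},\ldots,u_{0n}\rangle$ (the generated $\Delta$-field) and $\mathcal{F}_0=\mathcal{F}_{\mathbf{u}}(\tau(u_{00}):\tau\in\Theta,\theta\nmid\tau)$. View $F$ as a univariate polynomial $f(\theta(u_{00}))\in\mathcal{F}_0[\theta(u_{00})]$; it is irreducible over $\mathcal{F}_0$ of degree $g$; let $\gamma_1,\ldots,\gamma_g$ be its roots in an algebraic closure of $\mathcal{F}_0$ and $\mathcal{F}_l=\mathcal{F}_0(\gamma_l)$. $\mathcal{F}_l$ is made a differential field with derivations $\delta_{l,1},\ldots,\delta_{l,m}$ as follows, writing $\tau_l=\prod\delta_{l,k}^{d_k}$ for $\tau=\prod\delta_k^{d_k}$: $\tau_l(a)=\tau(a)$ for $a\in\mathcal{F}_{\mathbf{u}}$; $\tau_l(u_{00})=\tau(u_{00})$ if $\theta\nmid\tau$; $\theta_l(u_{00})=\gamma_l$; and for $\tau=\pi\theta$ with $\pi\in\Theta\setminus\{1\}$, inductively along the ranking, writing $\pi(F)=S_F\cdot\tau(u_{00})+T_\tau$ where $T_\tau$ involves only derivatives of $u_{00}$ smaller than $\tau(u_{00})$,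 $\tau_l(u_{00})=-T_\tau/S_F$ evaluated after replacing each derivative $\sigma(u_{00})$ by $\sigma_l(u_{00})$. This makes $(\mathcal{F}_l,\{\delta_{l,k}\})$ a differential extension field of $(\mathcal{F}_{\mathbf{u}},\Delta)$. The product formula is an identity of polynomials in $\theta(u_{00})$ over an algebraic closure of $\mathcal{F}_0$ containing all $\mathcal{F}_l$. *)

(* Defs.v *)
From HB Require Import structures.
From mathcomp Require Import all_boot all_order all_algebra fraction.
From mathcomp Require Import finmap ring.
From mathcomp Require Import xfinmap monalg.

Set Implicit Arguments.
Unset Strict Implicit.
Unset Printing Implicit Defensive.

Import GRing.Theory.
Local Open Scope fset_scope.
Local Open Scope ring_scope.

(* Polynomials over K in an arbitrary, possibly infinite, choiceType X of
   variables. *)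
Notation cpoly K X := {malg K[{cmonom X}]}.

Definition cvar (K : nzRingType) (X : choiceType) (v : X) : cpoly K X := << ucm v >>.

(* cpoly F X is an integral domain: on given polynomials, a Kronecker
   substitution v_i := 'X^(B ^ i), with B large, is injective. *)
Section Kronecker.
Variables (F : fieldType) (X : choiceType).
Implicit Types (M N : {cmonom X}) (p q : cpoly F X).

Fixpoint kenc (B : nat) (s : seq X) M : nat :=
  if s is v :: s' then (M v + kenc B s' M * B)%N else 0%N.

Lemma kenc1 B s : kenc B s mone = 0%N.
Proof. by elim: s => //= v s ->; rewrite cm1 mul0n. Qed.

Lemma kencM B s M N : kenc B s (mmul M N) = (kenc B s M + kenc B s N)%N.
Proof. by elim: s => //= v s ->; rewrite cmM mulnDl addnACA. Qed.

Lemma kenc_inj B (s : seq X) M N :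
  {in s, forall v, (M v < B)%N} -> {in s, forall v, (N v < B)%N} ->
  kenc B s M = kenc B s N -> {in s, forall v, M v = N v}.
Proof.
elim: s => [|v s IHs] //= ltM ltN eqMN.
have Mv := ltM v (mem_head v s); have Nv := ltN v (mem_head v s).
have B0 : (0 < B)%N by apply: leq_ltn_trans Mv.
have ev : M v = N v.
  by have := congr1 (modn^~ B) eqMN; rewrite /= ![(_ + _ * B)%N]addnC !modnMDl !modn_small.
have es : kenc B s M = kenc B s N.
  by move/eqP: eqMN; rewrite ev eqn_add2l eqn_pmul2r // => /eqP.
move=> w; rewrite inE => /orP[/eqP->//|ws]; apply: (IHs _ _ es w ws) => u us.
- by apply: ltM; rewrite inE us orbT.
- by apply: ltN; rewrite inE us orbT.
Qed.

Definition kmon (B : nat) (s : seq X) M : {poly F} := 'X^(kenc B s M).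

Lemma kmon_mmorphism B s : mmorphism (kmon B s).
Proof.
by split=> [M N|]; rewrite /kmon ?kencM ?exprD // kenc1 expr0.
Qed.

HB.instance Definition _ B s :=
  isMultiplicative.Build {cmonom X} {poly F} (kmon B s) (kmon_mmorphism B s).

Definition kron B s p : {poly F} := mmap polyC (kmon B s) p.
HB.instance Definition _ B s := GRing.RMorphism.copy (kron B s) (mmap polyC (kmon B s)).

Definition kgood B (s : seq X) p :=
  forall M, M \in msupp p ->
    (forall v, v \in finsupp M -> v \in s) /\ (forall v, (M v < B)%N).

Lemma kgood_inj B s M N :
  (forall v, v \in finsupp M -> v \in s) /\ (forall v, (M v < B)%N) ->
  (forall v, v \in finsupp N -> v \in s) /\ (forall v, (N v < B)%N) ->
  kenc B s M = kenc B s N -> M = N.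
Proof.
move=> [sM bM] [sN bN] e; apply/eqP/cmP => v.
have [vs|vs] := boolP (v \in s).
  by apply: (kenc_inj _ _ e vs) => w _.
have Mv : v \notin finsupp M by apply: contra vs; apply: sM.
have Nv : v \notin finsupp N by apply: contra vs; apply: sN.
by move: Mv Nv; rewrite -!cmE_eq0 => /eqP-> /eqP->.
Qed.

Lemma coef_kron B s p M : kgood B s p -> M \in msupp p ->
  (kron B s p)`_(kenc B s M) = p@_M.
Proof.
move=> gp Mp; rewrite /kron mmapE coef_sum (big_fsetD1 M) //=.
rewrite coefCM coefXn eqxx mulr1 big_seq big1 ?addr0 // => N.
rewrite in_fsetD1 => /andP[NM Np]; rewrite coefCM coefXn.
case: eqP => [e|_]; last by rewrite mulr0.
by rewrite (kgood_inj (gp _ Np) (gp _ Mp) (esym e)) eqxx in NM.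
Qed.

Lemma kron_eq0 B s p : kgood B s p -> kron B s p = 0 -> p = 0.
Proof.
move=> gp p0; apply/eqP; rewrite -msupp_eq0; apply/fset0Pn => -[M Mp].
by move: (Mp); rewrite -mcoeff_neq0 -(coef_kron gp Mp) p0 coef0 eqxx.
Qed.

Lemma kgood_exists p q : exists B s,
  [/\ kgood B s p, kgood B s q & (0 < B)%N].
Proof.
exists (msize p + msize q).+1.
exists (flatten [seq (finsupp M : seq X) | M : {cmonom X} <- (msupp p `|` msupp q : seq _)]).
have gen M : M \in msupp p `|` msupp q ->
  (forall v, v \in finsupp M -> v \in flatten
    [seq (finsupp M : seq X) | M : {cmonom X} <- (msupp p `|` msupp q : seq _)]) /\
  (forall v, (M v < (msize p + msize q).+1)%N).
  move=> MU; split=> v; first by move=> vM; apply/flatten_mapP; exists M.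
  have leM : (M v <= mdeg M)%N.
    case: (mdomP M v) => // vM; rewrite mdegE (big_fsetD1 v) //=.
    exact: leq_addr.
  rewrite ltnS (leq_trans leM) //.
  move: MU; rewrite in_fsetU => /orP[] /msize_mdeg_lt /ltnW lt_.
    by rewrite (leq_trans lt_) ?leq_addr.
  by rewrite (leq_trans lt_) ?leq_addl.
by split=> // M MU; apply: gen; rewrite in_fsetU MU ?orbT.
Qed.

Lemma cpoly_mul_eq0 p q : p * q = 0 -> (p == 0) || (q == 0).
Proof.
have [B [s [gp gq _]]] := kgood_exists p q => pq0.
have := rmorphM (kron B s) p q; rewrite pq0 rmorph0 => /esym/eqP.
by rewrite mulf_eq0 => /orP[] /eqP k0; rewrite (kron_eq0 _ k0) ?eqxx ?orbT.
Qed.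

Lemma cpoly_unit_const p q : q * p = 1 -> p = (p@_mone)%:MP.
Proof.
have [B [s [gp gq B0]]] := kgood_exists p q => pq1.
have kpq : kron B s q * kron B s p = 1 by rewrite -rmorphM pq1 rmorph1.
have sp : size (kron B s p) = 1%N.
  have : kron B s p \is a GRing.unit by apply/unitrPr; exists (kron B s q); rewrite mulrC.
  by rewrite poly_unitE => /andP[/eqP].
apply/malgP => M; rewrite mcoeffC.
have [->|M1] := eqVneq M mone; first by rewrite mulr1n.
rewrite mulr0n; apply: mcoeff_outdom; apply/negP => Mp.
have nz : p@_M != 0 by rewrite mcoeff_neq0.
have e0 : kenc B s M = kenc B s mone.
  rewrite kenc1; apply/eqP; rewrite -leqn0 -ltnS -sp.
  by rewrite ltnNge; apply: contra nz => le_; rewrite -(coef_kron gp Mp) nth_default.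
case/eqP: M1; apply: kgood_inj e0; first exact: gp.
by split=> v; [rewrite -cmE_neq0 cm1 | rewrite cm1].
Qed.

Definition cpoly_unit : pred (cpoly F X) :=
  [pred p | (p == (p@_mone)%:MP) && (p@_mone != 0)].
Definition cpoly_inv p : cpoly F X :=
  if cpoly_unit p then ((p@_mone)^-1)%:MP else p.

Lemma cpoly_mulVp : {in cpoly_unit, left_inverse 1 cpoly_inv *%R}.
Proof.
move=> p; rewrite /cpoly_inv -topredE /= => up; rewrite up.
case/andP: up => /eqP -> nz; rewrite malgCK -rmorphM /= mulVf ?rmorph1 //.
by rewrite malgCK in nz.
Qed.

Lemma cpoly_intro_unit p q : q * p = 1 -> cpoly_unit p.
Proof.
move=> qp; rewrite /cpoly_unit /= -(cpoly_unit_const qp) eqxx /=.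
apply/eqP => p0; move: (qp); rewrite (cpoly_unit_const qp) p0 raddf0 mulr0.
by move/eqP; rewrite eq_sym oner_eq0.
Qed.

Lemma cpoly_inv_out : {in [predC cpoly_unit], cpoly_inv =1 id}.
Proof. by move=> p; rewrite inE /= /cpoly_inv => /negPf; rewrite -topredE /= => ->. Qed.

HB.instance Definition _ := GRing.ComNzRing_hasMulInverse.Build (cpoly F X)
  cpoly_mulVp cpoly_intro_unit cpoly_inv_out.
HB.instance Definition _ := GRing.ComUnitRing_isIntegral.Build (cpoly F X)
  cpoly_mul_eq0.
End Kronecker.
Definition derivation (A : nzRingType) (D : A -> A) : Prop :=
  (forall x y, D (x + y) = D x + D y) /\
  (forall x y, D (x * y) = D x * y + x * D y).

Section DerivationTheory.
Variables (A : comNzRingType) (D : A -> A).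
Hypothesis dD : derivation D.
Lemma der0 : D 0 = 0.
Proof. by apply: (addrI (D 0)); rewrite -dD.1 !addr0. Qed.
Lemma derN x : D (- x) = - D x.
Proof. by apply: (addrI (D x)); rewrite -dD.1 !subrr der0. Qed.
Lemma der1 : D 1 = 0.
Proof. by apply: (addrI (D 1)); rewrite addr0 -{3}(mulr1 1) dD.2 mulr1 mul1r. Qed.
Lemma der_sum (I : Type) (r : seq I) (P : pred I) (f : I -> A) :
  D (\sum_(i <- r | P i) f i) = \sum_(i <- r | P i) D (f i).
Proof. exact: (big_morph D dD.1 der0). Qed.
Lemma derMn x k : D (x *+ k) = D x *+ k.
Proof. by elim: k => [|k IHk]; rewrite ?mulr0n ?der0 // !mulrS dD.1 IHk. Qed.
End DerivationTheory.

Section DerivationCommutation.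
Variables (A : comNzRingType) (D1 D2 : A -> A).
Hypotheses (d1 : derivation D1) (d2 : derivation D2).
Lemma der_commD x y : D1 (D2 x) = D2 (D1 x) -> D1 (D2 y) = D2 (D1 y) ->
  D1 (D2 (x + y)) = D2 (D1 (x + y)).
Proof. by rewrite d2.1 !d1.1 d2.1 => -> ->. Qed.
Lemma der_commM x y : D1 (D2 x) = D2 (D1 x) -> D1 (D2 y) = D2 (D1 y) ->
  D1 (D2 (x * y)) = D2 (D1 (x * y)).
Proof.
by rewrite d2.2 d1.2 d1.1 d2.1 !d1.2 !d2.2 => -> ->; ring.
Qed.
End DerivationCommutation.

Section Leibniz.
Variables (A : comNzRingType) (D : A -> A).
Hypothesis addD : forall x y, D (x + y) = D x + D y.
Definition leibniz_at x y := D (x * y) = D x * y + x * D y.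
Lemma leibniz_at_sumr x (r : seq A) :
  (forall y, y \in r -> leibniz_at x y) -> leibniz_at x (\sum_(y <- r) y).
Proof.
have D0 : D 0 = 0 by apply: (addrI (D 0)); rewrite -addD !addr0.
move=> Hr; rewrite big_seq /leibniz_at; elim/big_rec: _ => [|y z yr IH].
  by rewrite mulr0 D0 !mulr0 addr0.
by rewrite mulrDr !addD IH (Hr y yr) mulrDr [in RHS]mulrDr addrACA.
Qed.
Lemma leibniz_atC x y : leibniz_at x y -> leibniz_at y x.
Proof.
by rewrite /leibniz_at (mulrC y) => ->; rewrite addrC [x * _]mulrC [_ * y]mulrC.
Qed.
End Leibniz.

(* [cder D y] is the derivation of cpoly K X that extends the derivation D of K
   and sends each variable v to y v (lemmas cder_derivation, cderC, cder_var). *)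
Section ExtendedDerivation.
Variables (K : comNzRingType) (X : choiceType).
Variables (D : K -> K) (y : X -> cpoly K X).
Implicit Types (M N : {cmonom X}) (p q : cpoly K X).

Definition mon_der M : cpoly K X :=
  \sum_(v <- finsupp M) << divcm M (ucm v) >> * y v *+ M v.

Definition cder p : cpoly K X :=
  \sum_(M <- msupp p) (<< D p@_M *g M >> + p@_M *: mon_der M).

Hypothesis dD : derivation D.

Lemma cderEw (d : {fset {cmonom X}}) p : msupp p `<=` d ->
  cder p = \sum_(M <- d) (<< D p@_M *g M >> + p@_M *: mon_der M).
Proof.
move=> le; rewrite [LHS](big_fset_incl _ le) //= => M Md /mcoeff_outdom ->.
by rewrite der0 // scale0r addr0 monalgU0.
Qed.

Lemma cderU c M : cder << c *g M >> = << D c *g M >> + c *: mon_der M.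
Proof. by rewrite (cderEw msuppU_le) big_seq_fset1 mcoeffUU. Qed.

Lemma cderD p q : cder (p + q) = cder p + cder q.
Proof.
rewrite (cderEw (msuppD_le p q)) (cderEw (fsubsetUl _ (msupp q))).
rewrite (cderEw (fsubsetUr (msupp p) _)) -big_split /=.
apply: eq_bigr => M _; rewrite mcoeffD dD.1 monalgUD scalerDl.
by rewrite addrACA.
Qed.

Lemma cder0 : cder 0 = 0.
Proof. by apply: (addrI (cder 0)); rewrite -cderD !addr0. Qed.

Lemma mon_derEw (d : {fset X}) M : finsupp M `<=` d ->
  mon_der M = \sum_(v <- d) << divcm M (ucm v) >> * y v *+ M v.
Proof.
move=> le; rewrite [LHS](big_fset_incl _ le) //= => v vd.
by rewrite -cmE_eq0 => /eqP ->; rewrite mulr0n.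
Qed.

Lemma mon_derM M N :
  mon_der (mmul M N) = mon_der M * << N >> + << M >> * mon_der N.
Proof.
have MN : finsupp (mmul M N) `<=` finsupp M `|` finsupp N by rewrite mdomD.
rewrite (mon_derEw MN) (mon_derEw (fsubsetUl (finsupp M) (finsupp N))).
rewrite (mon_derEw (fsubsetUr (finsupp M) (finsupp N))).
rewrite mulr_suml [X in _ + X]mulr_sumr -big_split /=.
have mm (a b : {cmonom X}) : << mmul a b >> = << a >> * << b >> :> cpoly K X.
  by rewrite malgM_def fgmulUU mulr1.
have h1 (B : comNzRingType) (a b c : B) k : a * b *+ k * c = a * c * b *+ k.
  by rewrite mulrnAl mulrAC.
have h2 (B : comNzRingType) (a b c : B) k : c * (a * b *+ k) = c * a * b *+ k.
  by rewrite mulrnAr mulrA.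
apply: eq_bigr => v _.
have e1 : << divcm (mmul M N) (ucm v) >> * y v *+ M v =
          << divcm M (ucm v) >> * y v *+ M v * << N >>.
  have [Mv|Mv] := posnP (M v).
    by rewrite Mv [LHS]mulr0n [X in X * _]mulr0n [RHS]mul0r.
  have -> : divcm (mmul M N) (ucm v) = mmul (divcm M (ucm v)) N.
    apply/eqP/cmP => w.
    by rewrite !(divcmE, cmM, cmU); case: eqP => [<-|_]; rewrite ?subn0 // addnBAC.
  by rewrite mm; apply/esym/h1.
have e2 : << divcm (mmul M N) (ucm v) >> * y v *+ N v =
          << M >> * (<< divcm N (ucm v) >> * y v *+ N v).
  have [Nv|Nv] := posnP (N v).
    by rewrite Nv [LHS]mulr0n [X in _ * X]mulr0n [RHS]mulr0.
  have -> : divcm (mmul M N) (ucm v) = mmul M (divcm N (ucm v)).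
    apply/eqP/cmP => w.
    by rewrite !(divcmE, cmM, cmU); case: eqP => [<-|_]; rewrite ?subn0 // addnBA.
  by rewrite mm; apply/esym/h2.
apply: (etrans _ (congr2 +%R e1 e2)).
rewrite cmM.
exact: mulrnDr.
Qed.

Lemma cderM p q : cder (p * q) = cder p * q + p * cder q.
Proof.
have Z (c : K) (L : {cmonom X}) : << c *g L >> = c%:MP * << L >> :> cpoly K X.
  by rewrite malgM_def fgmulUU mulr1 mul1m.
have mm (a b : {cmonom X}) : << mmul a b >> = << a >> * << b >> :> cpoly K X.
  by rewrite malgM_def fgmulUU mulr1.
have cU c M : cder << c *g M >> = (D c)%:MP * << M >> + c%:MP * mon_der M.
  by rewrite cderU (Z (D c) M) -(mul_malgC c).
have rg (B : comNzRingType) (a b da db u v u' v' c1 c2 w w' : B) :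
    w = u * v -> c1 = da * b + a * db -> w' = u' * v + u * v' -> c2 = a * b ->
  c1 * w + c2 * w' =
  (da * u + a * u') * (b * v) + a * u * (db * v + b * v').
  by move=> -> -> -> ->; ring.
have sub (B : comNzRingType) (p1 q1 r1 p2 q2 dp dq dp2 dq2 : B) : p1 = p2 -> q1 = q2 ->
  dp = dp2 -> dq = dq2 -> r1 = dp2 * q2 + p2 * dq2 -> r1 = dp * q1 + p1 * dq.
  by move=> -> -> -> ->.
have UU a b M N : leibniz_at cder << a *g M >> << b *g N >>.
  rewrite /leibniz_at [X in cder X = _](_ : _ = << a * b *g mmul M N >>); last first.
    by rewrite malgM_def fgmulUU.
  apply: (sub _ _ _ _ _ _ _ _ _ _ (Z a M) (Z b N) (cU a M) (cU b N)).
  apply: (etrans (cU (a * b) (mmul M N))).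
  refine (rg _ _ _ _ _ _ _ _ _ _ _ _ _ (mm M N) _ (mon_derM M N) (@mpolyCM _ _ a b)).
  rewrite dD.2; apply: etrans (rmorphD _ _ _) _.
  exact: (congr2 +%R (@mpolyCM _ _ _ _) (@mpolyCM _ _ _ _)).
have Uq a M r : leibniz_at cder << a *g M >> r.
  rewrite [r]monalgE -(big_map (fun N => << r@_N *g N >>) xpredT id).
  apply: leibniz_at_sumr; first exact: cderD.
  by move=> _ /mapP[N _ ->]; apply: UU.
apply: leibniz_atC; rewrite [p]monalgE -(big_map (fun M => << p@_M *g M >>) xpredT id).
apply: leibniz_at_sumr; first exact: cderD.
by move=> _ /mapP[M _ ->]; apply: leibniz_atC; apply: Uq.
Qed.

Lemma cder_derivation : derivation cder.
Proof. by split; [exact: cderD | exact: cderM]. Qed.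

Lemma cderC c : cder c%:MP = (D c)%:MP.
Proof. by rewrite cderU /mon_der mdom1 big_seq_fset0 scaler0 addr0. Qed.

Lemma cder_var v : cder (cvar K v) = y v.
Proof.
rewrite /cvar cderU der1 // monalgU0 add0r scale1r.
rewrite /mon_der mdomU big_seq_fset1 cmUU mulr1n.
have -> : divcm (ucm v) (ucm v) = mone by apply/eqP/cmP => w; rewrite divcmE subnn cm1.
by rewrite mul1r.
Qed.
End ExtendedDerivation.

Lemma cpoly_ind (K : comNzRingType) (X : choiceType) (P : cpoly K X -> Prop) :
  (forall c, P c%:MP) -> (forall v, P (cvar K v)) ->
  (forall p q, P p -> P q -> P (p + q)) ->
  (forall p q, P p -> P q -> P (p * q)) -> forall p, P p.
Proof.
move=> PC PV PD PM.
have P0 : P 0 by have := PC 0; rewrite raddf0.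
have mm (a b : {cmonom X}) : << mmul a b >> = << a >> * << b >> :> cpoly K X.
  by rewrite malgM_def fgmulUU mulr1.
have Pmon k : forall M : {cmonom X}, mdeg M = k -> P << M >>.
  elim: k => [|k IHk] M dM; first by rewrite (mdeg_eq0I dM); apply: PC.
  have [v vM] : exists v, v \in finsupp M.
    apply/fset0Pn; apply/eqP => M0; move: dM.
    by rewrite mdegE M0 big_seq_fset0.
  have eM : M = mmul (ucm v) (divcm M (ucm v)).
    apply/eqP/cmP => w; rewrite cmM divcmE cmU.
    case: eqP => [<-|_]; last by rewrite subn0.
    by rewrite subnKC // lt0n cmE_neq0.
  rewrite eM mm; apply: PM; first exact: PV.
  by apply: IHk; move/eqP: dM; rewrite {1}eM mdegM mdegU add1n eqSS => /eqP.
move=> p; rewrite [p]monalgE; elim/big_rec: _ => [//|M r _ Pr].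
apply: PD => //; have -> : << p@_M *g M >> = (p@_M)%:MP * << M >> :> cpoly K X.
  by rewrite malgM_def fgmulUU mulr1 mul1m.
by apply: PM; [exact: PC | exact: Pmon].
Qed.

Section FractionDerivation.
Variables (R : idomainType) (D : R -> R).
Local Notation "x %:F" := (@FracField.tofrac R x).

Definition frac_der (x : {fraction R}) : {fraction R} :=
  let: (n, d) := frac (generic_quotient.repr x) in
  (D n * d - n * D d)%:F / d%:F ^+ 2.

Hypothesis dD : derivation D.

Lemma frac_reprE (x : {fraction R}) :
  let r : ratio R := generic_quotient.repr x in x = (frac r).1%:F / (frac r).2%:F.
Proof.
move=> r; rewrite -[LHS]generic_quotient.reprK -/r.
unlock FracField.tofrac.
rewrite -[X in _ * X]FracField.pi_inv -[RHS]FracField.pi_mul.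
rewrite /FracField.mulf /FracField.invf /= !numden_Ratio ?oner_neq0 ?denom_ratioP //.
by rewrite mulr1 mul1r Ratio_numden.
Qed.

Lemma frac_derE n d : d != 0 ->
  frac_der (n%:F / d%:F) = (D n * d - n * D d)%:F / d%:F ^+ 2.
Proof.
move=> d0; rewrite /frac_der; have := frac_reprE (n%:F / d%:F).
case: (generic_quotient.repr _) => -[a b] /= b0 /eqP.
rewrite eqr_div ?tofrac_eq0 // -!tofracM tofrac_eq => /eqP e.
have eD : D n * b + n * D b = D a * d + a * D d by rewrite -!dD.2 e.
apply/eqP; rewrite eqr_div ?expf_neq0 ?tofrac_eq0 // -!tofracXn -!tofracM tofrac_eq.
have e1 : D a * d = D n * b + n * D b - a * D d by rewrite eD addrK.
apply/eqP; rewrite !mulrBl.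
have -> : D a * b * d ^+ 2 = (D a * d) * (b * d) by ring.
have -> : n * D d * b ^+ 2 = (n * b) * (D d * b) by ring.
by rewrite e1 e; ring: e.
Qed.

Lemma frac_ind (P : {fraction R} -> Prop) :
  (forall n d, d != 0 -> P (n%:F / d%:F)) -> forall x, P x.
Proof. by move=> H x; rewrite (frac_reprE x); apply: H; apply: denom_ratioP. Qed.

Lemma frac_der_derivation : derivation frac_der.
Proof.
split; elim/frac_ind=> a b b0; elim/frac_ind=> c d d0.
  rewrite addf_div ?tofrac_eq0 // -!tofracM -tofracD.
  rewrite !frac_derE ?mulf_neq0 // addf_div ?expf_neq0 ?tofrac_eq0 //.
  rewrite -!tofracXn -!tofracM -!tofracD.
  apply/eqP; rewrite eqr_div ?tofrac_eq0 ?expf_neq0 ?mulf_neq0 ?expf_neq0 //.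
  by rewrite -!tofracM tofrac_eq !(dD.1, dD.2); apply/eqP; ring.
rewrite mulf_div -!tofracM !frac_derE ?mulf_neq0 // !mulf_div.
rewrite addf_div ?mulf_neq0 ?expf_neq0 ?tofrac_eq0 //.
rewrite -!tofracXn -!tofracM -!tofracD.
apply/eqP; rewrite eqr_div ?tofrac_eq0 ?expf_neq0 ?mulf_neq0 ?expf_neq0 //.
by rewrite -!tofracM tofrac_eq !dD.2; apply/eqP; ring.
Qed.

Lemma frac_der_tofrac x : frac_der x%:F = (D x)%:F.
Proof.
rewrite -[x%:F]divr1 -tofrac1 frac_derE ?oner_neq0 //.
by rewrite (der1 dD) mulr0 subr0 mulr1 tofrac1 expr1n divr1.
Qed.

End FractionDerivation.

Lemma frac_der_comm (R : idomainType) (D1 D2 : R -> R) :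
  derivation D1 -> derivation D2 -> (forall x, D1 (D2 x) = D2 (D1 x)) ->
  forall x, frac_der D1 (frac_der D2 x) = frac_der D2 (frac_der D1 x).
Proof.
move=> d1 d2 C; elim/frac_ind=> n d d0.
have e2 : d ^+ 2 != 0 by rewrite expf_neq0.
rewrite !frac_derE // -!tofracXn !frac_derE // !expr2.
congr (FracField.tofrac _ / _).
rewrite !(d1.1, d2.1, derN d1, derN d2, d1.2, d2.2) !C; ring.
Qed.

Section CommutingDerivations.
Variable m : nat.
Local Notation Theta := {cmonom 'I_m}.

Definition commuting_derivations (A : nzRingType) (D : 'I_m -> A -> A) : Prop :=
  (forall k, derivation (D k)) /\ (forall k l x, D k (D l x) = D l (D k x)).

Definition dop (A : Type) (D : 'I_m -> A -> A) (tau : Theta) (x : A) : A :=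
  foldr (fun k y => iter (tau k) (D k) y) x (enum 'I_m).

Definition tdvd (theta tau : Theta) : bool := [forall k, (theta k <= tau k)%N].

Lemma tdvdP theta tau : reflect (exists pi : Theta, tau = mmul pi theta) (tdvd theta tau).
Proof.
apply: (iffP forallP) => [le_|[pi ->] k]; last by rewrite cmM leq_addl.
by exists (divcm tau theta); apply/eqP/cmP => k; rewrite cmM divcmE subnK.
Qed.

Record dfield := DField {
  dfsort :> fieldType;
  dder : 'I_m -> dfsort -> dfsort;
  dder_commuting : commuting_derivations dder
}.

Record dhom (K L : dfield) := DHom {
  dhom_fun :> {rmorphism K -> L};
  dhom_der : forall k x, dhom_fun (dder k x) = dder k (dhom_fun x)
}.

Definition is_subfield (K : fieldType) (Q : K -> Prop) : Prop :=
  [/\ Q 1, (forall x y, Q x -> Q y -> Q (x - y)) &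
      (forall x y, Q x -> Q y -> Q (x / y))].

(* L is finitely generated as a Delta-field over K. *)
Definition dfg_extension (K L : dfield) (i : dhom K L) : Prop :=
  exists s : seq L, forall x : L, forall Q : L -> Prop,
    is_subfield Q -> (forall k y, Q y -> Q (dder k y)) ->
    (forall a, Q (i a)) -> {in s, forall y, Q y} -> Q x.

(* Kolchin: E is universal over F if, for every finitely generated
   Delta-extension K of F inside E, every finitely generated Delta-extension
   of K embeds into E over K. *)
Definition universal_extension (F E : dfield) (i : dhom F E) : Prop :=
  forall (K : dfield) (iK : dhom F K) (e : dhom K E),
    dfg_extension iK -> (forall a, e (iK a) = i a) ->
  forall (L : dfield) (iL : dhom K L), dfg_extension iL ->
  exists h : dhom L E, forall a, h (iL a) = e a.

End CommutingDerivations.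

(* The Delta-indeterminates are indexed by I; the variable (tau, i) of the
   polynomial ring stands for the derivative tau(y_i). *)
Definition derivative (m : nat) (I : choiceType) : choiceType := ({cmonom 'I_m} * I)%type.

Definition dshift (m : nat) (I : choiceType) (k : 'I_m) (v : derivative m I) : derivative m I :=
  (mmul (ucm k) v.1, v.2).

Notation dpoly K I := (cpoly K (derivative _ I)).

Definition dvar (m : nat) (K : nzRingType) (I : choiceType) (tau : {cmonom 'I_m}) (i : I) :
  cpoly K (derivative m I) := cvar K ((tau, i) : derivative m I).

Section DifferentialPolynomials.
Variables (m : nat) (K : dfield m) (I : choiceType).

Definition dpder (k : 'I_m) : dpoly K I -> dpoly K I :=
  cder (dder k) (fun v => cvar K (dshift k v)).

Lemma dpder_commuting : commuting_derivations dpder.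
Proof.
have [dK cK] := dder_commuting K.
have dD k : derivation (dpder k) by apply: cder_derivation.
split; first exact: dD.
move=> k l; apply: cpoly_ind => [c|v|p q|p q]; last 2 first.
- exact: der_commD.
- exact: der_commM.
- have C k' c' : dpder k' c'%:MP = (dder k' c')%:MP by apply: cderC.
  apply: etrans (congr1 (dpder k) (C l c)) (etrans (C k _) _).
  apply: esym; apply: etrans (congr1 (dpder l) (C k c)) (etrans (C l _) _).
  by rewrite cK.
have V k' v' : dpder k' (cvar K v') = cvar K (dshift k' v') by apply: cder_var.
apply: etrans (congr1 (dpder k) (V l v)) (etrans (V k _) _).
apply: esym; apply: etrans (congr1 (dpder l) (V k v)) (etrans (V l _) _).
by rewrite /dshift /= !mulmA (mulmC (ucm k)).
Qed.

Lemma dfrac_commuting :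
  @commuting_derivations m {fraction dpoly K I} (fun k => frac_der (dpder k)).
Proof.
have [dD cD] := dpder_commuting; split=> [k|k l].
  exact: frac_der_derivation.
exact: frac_der_comm.
Qed.

(* The Delta-field K<u_i : i in I> generated over K by the Delta-indeterminates. *)
Definition dfrac : dfield m := DField dfrac_commuting.

End DifferentialPolynomials.

Section Evaluation.
Variables (K S : comNzRingType) (X : choiceType).

Definition peval (f : K -> S) (x : X -> S) (p : cpoly K X) : S :=
  mmap f (fun M : {cmonom X} => \prod_(v <- finsupp M) x v ^+ M v) p.

End Evaluation.

(* Evaluation of a Delta-polynomial at a point of a ring with derivations D. *)
Definition deval (m : nat) (K S : comNzRingType) (I : choiceType) (f : K -> S)
    (D : 'I_m -> S -> S) (a : I -> S) (p : cpoly K (derivative m I)) : S :=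
  peval f (fun v => dop D v.1 (a v.2)) p.

Definition drename (m : nat) (K : comNzRingType) (I J : choiceType) (h : I -> J)
    (p : cpoly K (derivative m I)) : cpoly K (derivative m J) :=
  peval (fun c => c%:MP) (fun v => dvar K v.1 (h v.2)) p.

Section Occurrences.
Variables (K : comNzRingType) (X : choiceType).
Implicit Types (v : X) (p : cpoly K X).

Definition occurs v p : Prop := exists2 M, M \in msupp p & v \in finsupp M.

Definition degv v p : nat := \max_(M <- msupp p) M v.

Definition coefv v (e : nat) p : cpoly K X :=
  \sum_(M <- msupp p | M v == e) << p@_M *g divcm M (expcmn (ucm v) e) >>.

Definition initial v p : cpoly K X := coefv v (degv v p) p.

Definition separant v p : cpoly K X :=
  cder (fun _ => 0) (fun w => (w == v)%:R) p.

Definition is_leader (lt : rel X) v p : Prop :=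
  occurs v p /\ forall w, occurs w p -> w != v -> lt w v.

End Occurrences.

Section Ranking.
Variables (m : nat) (I : choiceType) (lt : rel (derivative m I)).

Definition is_ranking : Prop :=
  [/\ irreflexive lt, transitive lt, (forall u v, u != v -> lt u v || lt v u),
      (forall k u, lt u (dshift k u)) &
      (forall k u v, lt v u -> lt (dshift k v) (dshift k u))].

Definition orderly_ranking : Prop :=
  is_ranking /\ forall u v : derivative m I, (mdeg u.1 < mdeg v.1)%N -> lt u v.

End Ranking.

Section Ideals.
Variable A : comNzRingType.
Implicit Types S P J : A -> Prop.

(* P is a prime ideal of the subring S of A. *)
Definition prime_ideal_of S P : Prop :=
  [/\ (forall a, P a -> S a), P 0, (forall a b, P a -> P b -> P (a + b)),
      (forall a b, S a -> P b -> P (a * b)) &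
      ~ P 1 /\ forall a b, S a -> S b -> P (a * b) -> P a \/ P b].

Definition prime_chain S J (r : nat) (c : nat -> A -> Prop) : Prop :=
  (forall i, (i <= r)%N -> prime_ideal_of S (c i) /\ forall a, J a -> c i a) /\
  (forall i, (i < r)%N ->
     (forall a, c i a -> c i.+1 a) /\ exists2 a, c i.+1 a & ~ c i a).

(* r is the Krull dimension of the ideal J of the subring S. *)
Definition krull_dim S J (r : nat) : Prop :=
  (exists c, prime_chain S J r c) /\
  forall r' c, prime_chain S J r' c -> (r' <= r)%N.

Definition is_invertible (a : A) : Prop := exists b, a * b = 1.

Definition irreducible_elt (a : A) : Prop :=
  [/\ a <> 0, ~ is_invertible a &
      forall b c, a = b * c -> is_invertible b \/ is_invertible c].

Variables (m : nat) (D : 'I_m -> A -> A).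

Definition is_dideal J : Prop :=
  [/\ J 0, (forall a b, J a -> J b -> J (a + b)), (forall a b, J b -> J (a * b)) &
      (forall k a, J a -> J (D k a))].

(* The Delta-ideal [S] generated by S. *)
Definition dideal_gen S (a : A) : Prop :=
  forall J, is_dideal J -> (forall b, S b -> J b) -> J a.

End Ideals.

(* sat(G) = [G] : (I_G S_G)^oo, with respect to the ranking lt. *)
Definition sat (m : nat) (K : dfield m) (I : choiceType) (lt : rel (derivative m I))
    (G p : dpoly K I) : Prop :=
  exists2 v, is_leader lt v G &
  exists k, dideal_gen (@dpder m K I) (fun q => q = G)
              ((initial v G * separant v G) ^+ k * p).

Section Varieties.
Variables (m n : nat) (F E : dfield m) (i : dhom F E).
Local Notation FY := (cpoly F (derivative m 'I_n)).
Implicit Types V : ('I_n -> E) -> Prop.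

Definition dzero (a : 'I_n -> E) (p : FY) : Prop := deval i (@dder m E) a p = 0.

Definition is_dvariety V : Prop :=
  exists Sigma : FY -> Prop, forall a, V a <-> forall p, Sigma p -> dzero a p.

Definition vanishing V (p : FY) : Prop := forall a, V a -> dzero a p.

Definition irreducible_dvariety V : Prop :=
  is_dvariety V /\ prime_ideal_of (fun _ => True) (vanishing V).

(* F[theta(y_j) : ord theta <= t] *)
Definition order_le (t : nat) (p : FY) : Prop :=
  forall v, occurs v p -> (mdeg v.1 <= t)%N.

Definition is_kolchin_poly V (w : {poly rat}) : Prop :=
  exists t0, forall t, (t0 <= t)%N ->
  exists2 r : nat, w.[t%:R] = r%:R &
    krull_dim (order_le t) (fun p => vanishing V p /\ order_le t p) r.

End Varieties.

(* The polynomial binom(q, k) = q (q - 1) ... (q - k + 1) / k!. *)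
Definition binom_poly (q : {poly rat}) (k : nat) : {poly rat} :=
  (k`!%:R)^-1 *: \prod_(i < k) (q - i%:R).

Section ChowForm.
Variables (m n d : nat) (F E : dfield m) (i : dhom F E).

(* u_ij is indexed by (i, j), and y_(j+1) by j : 'I_n. *)
Definition uidx : choiceType := ('I_d.+1 * 'I_n.+1)%type.
Definition u00 : uidx := (ord0, ord0).
Local Notation Fu := (cpoly F (derivative m uidx)).
Local Notation yuidx := ('I_n + uidx)%type.
Local Notation Fyu := (cpoly F (derivative m yuidx)).

Definition chow_linear (l : 'I_d.+1) : Fyu :=
  dvar F mone (inr (l, ord0)) +
  \sum_(j < n) dvar F mone (inr (l, lift ord0 j)) * dvar F mone (inl j).

(* [I(V), L_0, ..., L_d] *)
Definition chow_ideal (V : ('I_n -> E) -> Prop) : Fyu -> Prop :=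
  dideal_gen (@dpder m F yuidx) (fun q =>
    (exists2 p, vanishing i V p & q = drename inl p) \/
    (exists l, q = chow_linear l)).

Definition is_chow_form (lt : rel (derivative m uidx)) (V : ('I_n -> E) -> Prop)
    (G : Fu) : Prop :=
  irreducible_elt G /\
  forall p : Fu, chow_ideal V (drename inr p) <-> sat lt G p.

End ChowForm.

Arguments u00 {n d}.

Section RootFields.
Variables (m n d : nat) (F : dfield m) (theta : {cmonom 'I_m}).
Local Notation uidx := (uidx n d).

(* F_u = F<u_ij : (i, j) <> (0, 0)> *)
Definition field_u : dfield m := dfrac F {w : uidx | w != u00}.

(* F_0 = F_u(tau(u_00) : theta does not divide tau) *)
Definition field_0 : fieldType :=
  {fraction cpoly field_u {tau : {cmonom 'I_m} | ~~ tdvd theta tau}}.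

Definition u_to_0 (a : field_u) : field_0 :=
  FracField.tofrac (a%:MP : cpoly field_u _).

Definition F_to_u (c : F) : field_u := FracField.tofrac (c%:MP : dpoly F _).

(* The derivative v of some u_ij as an element of F_0; the value 0 is a junk
   value, reached only if v = tau(u_00) with theta | tau. *)
Definition deriv_0 (v : derivative m uidx) : field_0 :=
  match insub v.2, insub v.1 with
  | Some w, _ => u_to_0 (FracField.tofrac (dvar F v.1 w))
  | None, Some tau => FracField.tofrac (cvar field_u tau)
  | None, None => 0
  end.

(* A Delta-polynomial without proper derivatives of theta(u_00), as a
   univariate polynomial in theta(u_00) over F_0. *)
Definition univariate (p : cpoly F (derivative m uidx)) : {poly field_0} :=
  peval (fun c => (u_to_0 (F_to_u c))%:P)
    (fun v => if v == (theta, u00) then 'X else (deriv_0 v)%:P) p.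

Variables (Omega : fieldType) (j : {rmorphism field_0 -> Omega}).

(* F_0(gamma) *)
Definition adjoin_root (gamma x : Omega) : Prop :=
  forall Q : Omega -> Prop, is_subfield Q ->
    (forall a, Q (j a)) -> Q gamma -> Q x.

(* The image in F_0(gamma) of u_00 itself. *)
Definition u00_at (gamma : Omega) : Omega :=
  if theta == mone then gamma else j (deriv_0 (mone, u00)).

(* Substitution of tau_l(u_ij) for tau(u_ij), where tau_l is taken with
   respect to D. *)
Definition eval_at (gamma : Omega) (D : 'I_m -> Omega -> Omega)
    (p : cpoly F (derivative m uidx)) : Omega :=
  deval (fun c => j (u_to_0 (F_to_u c))) D
    (fun w => if w == u00 then u00_at gamma else j (deriv_0 (mone, w))) p.

(* D is the family of derivations delta_(l, 1), ..., delta_(l, m) of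
   F_l = F_0(gamma) attached to the Delta-polynomial G with leader theta(u_00);
   outside F_l the functions D k are irrelevant. The conditions determine D on
   F_l. In the last one T is T_tau, with tau = pi theta. *)
Record root_derivations (G : cpoly F (derivative m uidx)) (gamma : Omega)
    (D : 'I_m -> Omega -> Omega) : Prop := {
  rd_stable : forall k x, adjoin_root gamma x -> adjoin_root gamma (D k x);
  rd_add : forall k x y, adjoin_root gamma x -> adjoin_root gamma y ->
    D k (x + y) = D k x + D k y;
  rd_mul : forall k x y, adjoin_root gamma x -> adjoin_root gamma y ->
    D k (x * y) = D k x * y + x * D k y;
  rd_comm : forall k l x, adjoin_root gamma x -> D k (D l x) = D l (D k x);
  rd_base : forall tau (a : field_u),
    dop D tau (j (u_to_0 a)) = j (u_to_0 (dop (@dder m field_u) tau a));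
  rd_free : forall tau, ~~ tdvd theta tau ->
    dop D tau (u00_at gamma) = j (deriv_0 (tau, u00));
  rd_leader : dop D theta (u00_at gamma) = gamma;
  rd_above : forall pi, pi != mone ->
    let T := dop (@dpder m F uidx) pi G
             - separant (theta, u00) G * dvar F (mmul pi theta) u00 in
    dop D (mmul pi theta) (u00_at gamma) =
      - eval_at gamma D T / eval_at gamma D (separant (theta, u00) G)
}.

Definition is_algebraic_extension : Prop := forall x : Omega, algebraicOver j x.

End RootFields.

Arguments deriv_0 {m n d F theta} v.

(* Main.v *)
Require Import Defs.
From HB Require Import structures.
From mathcomp Require Import all_boot all_order all_algebra fraction.
From mathcomp Require Import finmap ring.
From mathcomp Require Import xfinmap monalg.
From Stdlib Require Import Classical ClassicalEpsilon.

(** Write [S] for the separant of [G] and [v0] for its leader [theta(u_00)]. The coordinates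
    [xi_rho] are the quotients of [dG/dtheta(u_0rho)] by [S], evaluated in [F_l].

    The reason is that the Chow ideal contains [dG/dtheta(u_0rho) - y_rho S]. Indeed, eliminating
    the [u_l0] by [u_l0 = - sum_j u_lj y_j] turns [G] into a polynomial whose coefficients, as a
    polynomial in the remaining [u_lj], vanish on [V], and this stays so after differentiation
    with respect to [theta(u_0rho)]. As the ranking is orderly, [G] has order at most
    [ord theta], so only [theta(u_0rho)] and [theta(u_00)] contribute to that derivative
    ([chain_rule]). Multiplying by [u_0rho], adding up and using the linear form [L_0], one finds
    that [S u_00 + sum_rho u_0rho dG/dtheta(u_0rho)] lies in the Chow ideal, hence in [sat(G)]
    ([chow_relation]). Evaluation in [F_l] commutes with the derivations, kills [G], and does not
    kill the initial or the separant, so it kills [sat(G)]; therefore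
    [sum_rho u_0rho xi_rho = - u_00] in [F_l], and [theta_l] turns this into
    [theta_l(sum_rho u_0rho xi_rho) = - gamma_l] ([root_coordinates]). The product is thus the
    factorization of [G] over its roots, and [A] is the initial of [G].

    The existence of the derivations rests on the irreducibility of [G]. Polynomial rings over a
    field are factorial, so [G] is prime ([irreducible_cpoly_prime]); clearing denominators, a
    polynomial without proper derivatives of [v0] that vanishes at a root of [G] becomes a
    multiple of [G] after multiplication by some element free of [v0] ([common_root_multiple]),
    and in characteristic 0 the separant does not vanish there ([derivative_not_root]). The values
    of the proper derivatives of [v0] are then forced by the equations [pi(G) = 0], one after the
    other along the ranking ([root_assignment_exists]). The kernel of the resulting evaluation is
    a Delta-ideal: a power of [S] times any polynomial is congruent modulo [[G]] to a polynomial
    without proper derivatives of [v0] ([partial_reduction]), to which the previous divisibility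
    applies ([kernel_stable]). Hence the derivations pass to the field of fractions of the image,
    which is [F_l] ([quotient_derivations], [root_derivations_exist]); they commute because those
    of the polynomial ring do. *)

Set Implicit Arguments.
Unset Strict Implicit.
Unset Printing Implicit Defensive.

Import GRing.Theory.
Local Open Scope ring_scope.

(** * Variables of a polynomial and evaluation homs *)

Definition supp_in (K : comNzRingType) (X : choiceType) (W : X -> Prop) (p : cpoly K X) :=
  forall v, occurs v p -> W v.

Section Support.
Variables (K : comNzRingType) (X : choiceType).
Implicit Types (W : X -> Prop) (p q : cpoly K X) (M N : {cmonom X}).

Lemma mkmalgUM (c c' : K) M N :
  << c *g M >> * << c' *g N >> = << c * c' *g mmul M N >> :> cpoly K X.
Proof. by rewrite malgM_def fgmulUU. Qed.

Lemma mkmalgUE (c : K) M : << c *g M >> = c%:MP * << M >> :> cpoly K X.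
Proof. by rewrite mkmalgUM mulr1 mul1m. Qed.

Lemma supp_inW W W' p : (forall v, W v -> W' v) -> supp_in W p -> supp_in W' p.
Proof. by move=> s h v /h/s. Qed.

Lemma supp_inU W (c : K) M : (forall v, v \in finsupp M -> W v) ->
  supp_in W (<< c *g M >> : cpoly K X).
Proof.
move=> h v [N /(fsubsetP msuppU_le)]; rewrite in_fset1 => /eqP -> vM.
exact: h.
Qed.

Lemma supp_inC W (c : K) : supp_in W (c%:MP : cpoly K X).
Proof. by apply: supp_inU => v; rewrite mdom1 in_fset0. Qed.

Lemma supp_in_var W v : W v -> supp_in W (cvar K v).
Proof. by move=> Wv; apply: supp_inU => w; rewrite mdomU in_fset1 => /eqP ->. Qed.

Lemma supp_inD W p q : supp_in W p -> supp_in W q -> supp_in W (p + q).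
Proof.
move=> hp hq v [M /(fsubsetP (msuppD_le _ _))]; rewrite in_fsetU => /orP[] Mp vM.
  by apply: hp; exists M.
by apply: hq; exists M.
Qed.

Lemma supp_inM W p q : supp_in W p -> supp_in W q -> supp_in W (p * q).
Proof.
move=> hp hq v [M Mpq vM].
have [N [N' [Np N'q e]]] := msuppM_le Mpq.
move: vM; rewrite e mdomD in_fsetU => /orP[] vM.
  by apply: hp; exists N.
by apply: hq; exists N'.
Qed.

Lemma supp_in0 W : supp_in W (0 : cpoly K X).
Proof. by rewrite -malgC0E; apply: supp_inC. Qed.

Lemma supp_in1 W : supp_in W (1 : cpoly K X).
Proof. exact: supp_inC. Qed.

Lemma supp_inN W p : supp_in W p -> supp_in W (- p).
Proof. by move=> hp v [M]; rewrite msuppN => Mp vM; apply: hp; exists M. Qed.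

Lemma supp_in_sum W (I : Type) (r : seq I) (P : pred I) (f : I -> cpoly K X) :
  (forall i, P i -> supp_in W (f i)) -> supp_in W (\sum_(i <- r | P i) f i).
Proof.
by move=> h; apply: (big_ind (supp_in W)) => //; [exact: supp_in0 | exact: supp_inD].
Qed.

(** Induction that only visits variables known to occur, for properties that depend on which
    ones do. *)
Lemma cpoly_ind_on W (P : cpoly K X -> Prop) :
  (forall c, P c%:MP) -> (forall v, W v -> P (cvar K v)) ->
  (forall p q, P p -> P q -> P (p + q)) ->
  (forall p q, P p -> P q -> P (p * q)) -> forall p, supp_in W p -> P p.
Proof.
move=> PC PV PD PM.
have Pmon k M : mdeg M = k -> (forall v, v \in finsupp M -> W v) -> P << M >>.
  elim: k M => [|k IHk] M dM WM; first by rewrite (mdeg_eq0I dM); apply: PC.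
  have [v vM] : exists v, v \in finsupp M.
    apply/fset0Pn; apply/eqP => M0; move: dM.
    by rewrite mdegE M0 big_seq_fset0.
  have eM : M = mmul (ucm v) (divcm M (ucm v)).
    apply/eqP/cmP => w; rewrite cmM divcmE cmU.
    case: eqP => [<-|_]; last by rewrite subn0.
    by rewrite subnKC // lt0n cmE_neq0.
  have -> : << M >> = cvar K v * << divcm M (ucm v) >>.
    by rewrite mkmalgUM mulr1 -eM.
  apply: PM; first exact: (PV v (WM v vM)).
  apply: IHk => [|w].
    by move/eqP: dM; rewrite {1}eM mdegM mdegU add1n eqSS => /eqP.
  rewrite -cmE_neq0 divcmE -lt0n subn_gt0 => h; apply: WM.
  by rewrite -cmE_neq0 -lt0n (leq_trans _ h).
move=> p sp; rewrite [p]monalgE big_seq; elim/big_rec: _ => [|M r Mp Pr].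
  by rewrite -malgC0E; apply: PC.
apply: PD => //; rewrite mkmalgUE.
by apply: PM; [exact: PC | apply: (Pmon _ _ erefl) => v vM; apply: sp; exists M].
Qed.

Lemma rmorph_cpoly_eq (S : pzRingType) (h1 h2 : {rmorphism cpoly K X -> S}) p :
  (forall c, h1 c%:MP = h2 c%:MP) ->
  (forall v, occurs v p -> h1 (cvar K v) = h2 (cvar K v)) -> h1 p = h2 p.
Proof.
move=> hC hV; refine (@cpoly_ind_on (fun v => occurs v p) (fun q => h1 q = h2 q) _ _ _ _ p _) => //.
- by move=> a b ea eb; rewrite !rmorphD ea eb.
- by move=> a b ea eb; rewrite !rmorphM ea eb.
Qed.

End Support.

Section Peval.
Variables (K S : comNzRingType) (X : choiceType) (f : {rmorphism K -> S}) (x : X -> S).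
Implicit Types (p q : cpoly K X) (M N : {cmonom X}).

Let h M := \prod_(v <- finsupp M) x v ^+ M v.

Let hEw M (d : {fset X}) : (finsupp M `<=` d)%fset -> h M = \prod_(v <- d) x v ^+ M v.
Proof.
move=> le; rewrite [LHS](big_fset_incl _ le) //= => v vd.
by rewrite -cmE_eq0 => /eqP ->; rewrite expr0.
Qed.

Fact peval_mmorphism : mmorphism h.
Proof.
split=> [M N|]; last by rewrite /h mdom1 big_seq_fset0.
rewrite (hEw (fsubsetUl (finsupp M) (finsupp N))).
rewrite (hEw (fsubsetUr (finsupp M) (finsupp N))).
rewrite (@hEw _ (finsupp M `|` finsupp N)%fset) ?mdomD // -big_split /=.
by apply: eq_bigr => v _; rewrite cmM exprD.
Qed.

HB.instance Definition _ := isMultiplicative.Build {cmonom X} S h peval_mmorphism.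
HB.instance Definition _ := GRing.RMorphism.copy (peval f x) (mmap f h).

Lemma pevalC c : peval f x c%:MP = f c.
Proof. by rewrite -[peval f x]/(mmap f h) mmapC. Qed.

Lemma peval_var v : peval f x (cvar K v) = x v.
Proof.
rewrite -[peval f x]/(mmap f h) /cvar mmapU.
change (f 1 * h (ucm v) = x v); rewrite rmorph1 mul1r /h.
by rewrite mdomU big_seq_fset1 cmUU expr1.
Qed.
End Peval.

(** Nothing but these values is ever used of an evaluation hom. *)
Lemma cpoly_hom (K S : comNzRingType) (X : choiceType) (f : {rmorphism K -> S}) (x : X -> S) :
  exists h : {rmorphism cpoly K X -> S},
    (forall c, h c%:MP = f c) /\ (forall v, h (cvar K v) = x v).
Proof. by exists (peval f x); split; [exact: pevalC | exact: peval_var]. Qed.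

Lemma cpoly_retract (K S : comNzRingType) (X : choiceType) (W : X -> Prop)
    (h : {rmorphism cpoly K X -> S}) (h' : {rmorphism S -> cpoly K X}) :
  (forall c, h' (h c%:MP) = c%:MP) -> (forall v, W v -> h' (h (cvar K v)) = cvar K v) ->
  forall p, supp_in W p -> h' (h p) = p.
Proof.
move=> hC hV p sp; pose hh : {rmorphism cpoly K X -> cpoly K X} := h' \o h.
by apply: (@rmorph_cpoly_eq K X _ hh idfun) => // v /sp; apply: hV.
Qed.

(** * Polynomial rings over a field are factorial *)

Definition divides (A : comNzRingType) (p a : A) : Prop := exists q, a = p * q.

Definition prime_elt (A : comNzRingType) (p : A) : Prop :=
  [/\ p <> 0, ~ is_invertible p &
      forall a b, divides p (a * b) -> divides p a \/ divides p b].

(** Unique factorization in the form in which it passes to polynomial rings: strict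
    divisibility is well founded, and irreducible elements are prime. *)
Definition factorial (A : idomainType) : Prop :=
  (exists mu : A -> nat, forall a b, a * b != 0 ->
     (mu a <= mu (a * b)%R)%N /\ (~ is_invertible b -> (mu a < mu (a * b)%R)%N)) /\
  forall p : A, irreducible_elt p -> prime_elt p.

Lemma field_factorial (F : fieldType) : factorial F.
Proof.
have inv (a : F) : a != 0 -> is_invertible a by exists a^-1; rewrite mulfV.
split=> [|p [p0 + _]]; last by case; apply: inv; apply/eqP.
exists (fun _ => 0%N) => a b ab0; split=> // -[]; apply: inv.
by apply: contraNneq ab0 => ->; rewrite mulr0.
Qed.

Section Factorial.
Variables (A : idomainType) (fA : factorial A).
Implicit Types (a b c : A) (p q : {poly A}).

Lemma irreducible_factor a : a != 0 -> ~ is_invertible a ->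
  exists c b, irreducible_elt c /\ a = c * b.
Proof.
have [[mu muP] _] := fA.
have [k] := ubnP (mu a); elim: k a => // k IHk a /ltnSE le_k a0 na.
have [irr|nirr] := classic (irreducible_elt a); first by exists a, 1; rewrite mulr1.
have [b [c [e nb nc]]] : exists b c,
    [/\ a = b * c, ~ is_invertible b & ~ is_invertible c].
  apply: NNPP => h; apply: nirr; split=> //; first exact/eqP.
  move=> b c e; apply: NNPP => h'; apply: h; exists b, c.
  by split=> // hi; apply: h'; [left | right].
have [_ /(_ nc)] := muP b c ltac:(by rewrite -e); rewrite -e => lt_.
have b0 : b != 0 by apply: contraNneq a0 => b0; rewrite e b0 mul0r.
have [p [b' [pirr eb]]] := IHk b (leq_trans lt_ le_k) b0 nb.
by exists p, (b' * c); rewrite mulrA -eb.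
Qed.

Lemma invertible_size1 p : is_invertible p -> size p = 1%N.
Proof.
move=> [q e]; apply/eqP; have := size_mul_eq1 p q.
by rewrite e size_poly1 eqxx => /esym/andP[].
Qed.

(** If the constant divides a product, it divides the leading coefficient of one of the
    factors, and removing that leading term makes the factor smaller. *)
Lemma prime_polyC c : prime_elt c -> prime_elt c%:P.
Proof.
move=> [c0 nc prc]; split.
- by move/eqP; rewrite polyC_eq0 => /eqP.
- by move=> [q e]; apply: nc; exists q`_0; rewrite -coefCM e coef1.
move=> p q; have [k] := ubnP (size p + size q)%N.
elim: k p q => // k IHk p q /ltnSE le_k [r e].
have d0 (s : {poly A}) : divides c%:P (0 : {poly A}) by exists 0; rewrite mulr0.
have [p0|p0] := eqVneq p 0; first by left; rewrite p0; apply: d0.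
have [q0|q0] := eqVneq q 0; first by right; rewrite q0; apply: d0.
have red (s t : {poly A}) : s != 0 -> divides c (lead_coef s) -> (forall s' : {poly A},
    (size s' < size s)%N -> divides c%:P (s' * t) -> divides c%:P s' \/ divides c%:P t) ->
    divides c%:P (s * t) -> divides c%:P s \/ divides c%:P t.
  move=> s0 [l el] H [u eu]; pose w := l *: 'X^((size s).-1).
  (* [w] is chosen so that [c%:P * w] is the leading term of [s]. *)
  have sw : lead_coef s *: 'X^((size s).-1) = c%:P * w by rewrite /w el mul_polyC scalerA.
  case: (H (s - c%:P * w)) => [|||dt]; last by right.
  - rewrite -sw (polySpred s0) ltnS; apply/leq_sizeP => i le_i.
    rewrite coefB coefZ coefXn; have [->|ne] := eqVneq i (size s).-1.
      by rewrite mulr1 subrr.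
    rewrite mulr0 subr0 nth_default // (polySpred s0).
    by rewrite ltn_neqAle eq_sym ne.
  - by exists (u - w * t); rewrite mulrBl eu mulrBr mulrA.
  by move=> [v ev]; left; exists (v + w); rewrite mulrDr -ev subrK.
have [] := prc (lead_coef p) (lead_coef q).
- by exists (lead_coef r); rewrite -lead_coefM e lead_coefM lead_coefC.
- move=> dp; apply: red p0 dp _ _; last by exists r.
  by move=> s' lt_s'; apply: IHk; apply: leq_trans le_k; rewrite ltn_add2r.
move=> dq; suff : divides c%:P q \/ divides c%:P p by tauto.
apply: red q0 dq _ _; last by exists r; rewrite mulrC.
move=> s' lt_s' h; suff : divides c%:P p \/ divides c%:P s' by tauto.
apply: IHk; last by rewrite mulrC.
by apply: leq_trans le_k; rewrite ltn_add2l.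
Qed.

Lemma irreducible_not_const c p : irreducible_elt p -> (1 < size p)%N ->
  prime_elt c -> ~ divides c%:P p.
Proof.
move=> [_ _ irr] sp [c0 nc _] [q e].
have [[d /esym cd]|/invertible_size1 q1] := irr _ _ e.
  by apply: nc; exists d`_0; rewrite -coefCM -cd coef1.
move: sp; rewrite e mul_polyC size_scale ?q1 //; exact/eqP.
Qed.

(** The prime factors of the constant are cancelled one by one; none of them can be absorbed by
    a factor without constant prime divisors, which therefore stays the same. *)
Lemma scale_cancel c p q r : c != 0 -> c *: p = q * r ->
  exists q' r', [/\ p = q' * r', size q' = size q, size r' = size r &
    (forall c', prime_elt c' -> ~ divides c'%:P r) -> r' = r].
Proof.
have [[mu muP] pr] := fA; have [k] := ubnP (mu c).
elim: k c q r => // k IHk c q r /ltnSE le_k c0 e.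
have [[d cd]|nc] := classic (is_invertible c).
  have d0 : d != 0 by apply/eqP => d0; move/eqP: cd; rewrite d0 mulr0 eq_sym oner_eq0.
  exists (d *: q), r; split=> //; last by rewrite size_scale.
  by rewrite -scalerAl -e scalerA mulrC cd scale1r.
have [b [c' [birr ec]]] := irreducible_factor c0 nc.
have prb := pr _ birr; have pb0 : b%:P != 0 by have [+ _ _] := prime_polyC prb; move/eqP.
have c'0 : c' != 0 by apply: contraNneq c0 => c'0; rewrite ec c'0 mulr0.
have lt_c' : (mu c' < k)%N.
  apply: leq_trans le_k; rewrite ec mulrC; apply: (muP c' b _).2; last by case: birr.
  by rewrite mulrC -ec.
have dqr : divides b%:P (q * r) by exists (c' *: p); rewrite -e ec mul_polyC scalerA.
have eS (s : {poly A}) : b%:P * s = b *: s by rewrite mul_polyC.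
have b0 : b != 0 by rewrite polyC_eq0 in pb0.
have [_ _ /(_ _ _ dqr)] := prime_polyC prb.
case=> -[t et].
  have e' : c' *: p = t * r.
    by apply: (mulfI pb0); rewrite mulrA -et -e ec eS scalerA.
  have [q' [r' [-> sq sr er]]] := IHk _ _ _ lt_c' c'0 e'.
  by exists q', r'; split=> //; rewrite sq et eS size_scale.
have e' : c' *: p = q * t.
  by apply: (mulfI pb0); rewrite mulrCA -et -e ec eS scalerA.
have [q' [r' [-> sq sr er]]] := IHk _ _ _ lt_c' c'0 e'.
exists q', r'; split=> //; first by rewrite sr et eS size_scale.
by move=> /(_ b prb)[]; exists t.
Qed.

(** An irreducible polynomial of positive degree is prime over the fraction field, by
    pseudo-division and gcds; [scale_cancel] brings the divisibility back to [A]. *)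
Lemma poly_factorial : factorial {poly A}.
Proof.
have [[mu muP] pr] := fA; split.
  exists (fun p => mu (lead_coef p) + size p)%N => p q pq0.
  have /andP[p0 q0] : (p != 0) && (q != 0) by rewrite -negb_or -mulf_eq0.
  have l0 : lead_coef p * lead_coef q != 0 by rewrite mulf_neq0 ?lead_coef_eq0.
  have [le_mu lt_mu] := muP _ _ l0; rewrite lead_coefM size_mul //.
  have sq : size q = (size q).-1.+1 by rewrite -polySpred.
  have le_s : (size p <= (size p + size q).-1)%N by rewrite sq addnS leq_addr.
  split=> [|nq]; first exact: leq_add.
  have [s1|s1] := eqVneq (size q) 1%N; last first.
    rewrite -addnS leq_add // sq addnS -[X in (X < _)%N]addn0 ltn_add2l.
    by move: s1; rewrite sq; case: (size q).-1.
  rewrite -addSn leq_add //; apply: lt_mu => -[b eb]; apply: nq.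
  exists b%:P; have /size_poly1P[c _ ec] : size q == 1%N by rewrite s1.
  by rewrite ec -polyCM; rewrite ec lead_coefC in eb; rewrite eb.
move=> p irr; have [p0 np irrp] := irr.
have [s1|s1] := leqP (size p) 1.
  have [c ec] : exists c, p = c%:P by exists p`_0; apply: size1_polyC.
  rewrite ec; apply: prime_polyC; apply: pr; split.
  - by move=> c0; apply: p0; rewrite ec c0.
  - by move=> [b cb]; apply: np; exists b%:P; rewrite ec -polyCM cb.
  move=> b c' e; have := irrp b%:P c'%:P; rewrite ec e polyCM => /(_ erefl).
  have H (x : A) : is_invertible x%:P -> is_invertible x.
    by move=> [y xy]; exists y`_0; rewrite -coefCM xy coef1.
  by case=> /H; [left | right].
have Kdvd (a : {poly A}) : p %| a -> divides p a.
  move=> /Pdiv.Idomain.dvdpP[[c q] /= c0 e].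
  have [q' [r' [-> _ _ ->]]] := scale_cancel c0 e.
    by exists q'; rewrite mulrC.
  by move=> c' prc; apply: irreducible_not_const.
split=> // a b [q e]; have p0' : p != 0 by apply/eqP.
have [cop|] := boolP (coprimep p a).
  right; apply: Kdvd; rewrite -(Pdiv.Idomain.Gauss_dvdpr _ cop) e.
  by apply: Pdiv.Idomain.dvdp_mulr; apply: Pdiv.Idomain.dvdpp.
rewrite Pdiv.Idomain.coprimep_def => d1; left; apply: Kdvd.
have dp := Pdiv.Idomain.dvdp_gcdl p a.
have /Pdiv.Idomain.dvdpP[[c t] /= c0 et] := dp.
have [t' [d' [ep st sd _]]] := scale_cancel c0 et.
have [/invertible_size1 t1|/invertible_size1 e1] := irrp _ _ ep; last first.
  by rewrite -sd e1 in d1.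
have /eqP : size (gcdp p a) = size p.
  have /size_poly1P[w w0 ew] : size t' == 1%N by rewrite t1.
  by rewrite -sd ep ew mul_polyC size_scale.
rewrite Pdiv.Idomain.dvdp_size_eqp // => pd.
by rewrite -(Pdiv.Idomain.eqp_dvdl _ pd) Pdiv.Idomain.dvdp_gcdr.
Qed.
End Factorial.

Section CpolyFactorial.
Variables (F : fieldType) (X : choiceType).
Implicit Types (p q : cpoly F X).

(** The polynomials in the variables of [s], up to isomorphism: [A] will be an iterated
    univariate polynomial ring. *)
Record poly_model (s : seq X) (A : idomainType) := PolyModel {
  to_model : {rmorphism cpoly F X -> A};
  of_model : {rmorphism A -> cpoly F X};
  of_modelK : cancel of_model to_model;
  to_modelK : forall p, supp_in [in s] p -> of_model (to_model p) = p;
  supp_of_model : forall a, supp_in [in s] (of_model a)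
}.

Lemma poly_model_exists (s : seq X) : uniq s ->
  exists A : idomainType, factorial A /\ inhabited (poly_model s A).
Proof.
pose cst : {rmorphism F -> cpoly F X} := @malgC {cmonom X} F.
elim: s => [_|x s IHs /= /andP[xs /IHs [A [fA [[P Q QK PK sQ]]]]]].
  exists F; split; first exact: field_factorial.
  have [P [PC _]] := cpoly_hom (idfun : {rmorphism F -> F}) (fun _ : X => 0).
  constructor; exists P cst => [c||a]; first exact: PC.
  - refine (@cpoly_retract F F X _ P cst _ _) => [c|v]; last by rewrite in_nil => /notF[].
    exact: (congr1 cst (PC c)).
  - exact: supp_inC.
exists {poly A}; split; first exact: poly_factorial.
have [P' [P'C P'V]] := cpoly_hom (polyC \o P \o cst : {rmorphism F -> {poly A}})
  (fun v : X => if v == x then 'X else (P (cvar F v))%:P).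
have [Q' [Q'C Q'X]] : exists Q' : {rmorphism {poly A} -> cpoly F X},
    (forall a, Q' a%:P = Q a) /\ Q' 'X = cvar F x.
  exists (horner_eval (cvar F x) \o map_poly Q); split=> [a|] /=.
    by rewrite map_polyC /horner_eval hornerC.
  by rewrite map_polyX /horner_eval hornerX.
have P'Q (a : A) : P' (Q a) = a%:P.
  rewrite -[in RHS](QK a); pose h : {rmorphism cpoly F X -> {poly A}} := polyC \o P.
  apply: (@rmorph_cpoly_eq F X _ P' h) => [c|v /sQ vs]; first exact: P'C.
  rewrite P'V; case: eqP => // vx; rewrite -vx in xs.
  by case/negP: xs.
constructor; exists P' Q' => [a||a].
- elim/poly_ind: a => [|a c IHa]; first by rewrite !rmorph0.
  by rewrite !(rmorphD, rmorphM) IHa Q'C P'Q Q'X P'V eqxx.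
- apply: cpoly_retract => [c|v].
    rewrite P'C Q'C; apply: PK; exact: supp_inC.
  rewrite P'V; case: eqP => [-> _|vx]; first exact: Q'X.
  rewrite inE => /orP[/eqP/vx[]|vs]; rewrite Q'C; apply: PK.
  exact: supp_in_var.
- elim/poly_ind: a => [|a c IHa]; first by rewrite rmorph0; apply: supp_in0.
  rewrite rmorphD rmorphM Q'X Q'C; apply: supp_inD.
    by apply: supp_inM => //; apply: supp_in_var; rewrite inE eqxx.
  by apply: supp_inW (sQ c) => v /= vs; rewrite inE vs orbT.
Qed.

(** Only finitely many variables are involved in a divisibility. *)
Lemma irreducible_cpoly_prime p : irreducible_elt p -> prime_elt p.
Proof.
move=> [p0 np irr]; split=> // a b [q e].
have [s us ss] : exists2 s : seq X, uniq s &
    forall r, r \in [:: p; q; a; b] -> supp_in [in s] r.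
  pose vars (r : cpoly F X) := flatten [seq (finsupp M : seq X) | M : {cmonom X} <- msupp r].
  exists (undup (flatten [seq vars r | r : cpoly F X <- [:: p; q; a; b]])).
    exact: undup_uniq.
  move=> r rs v [M Mr vM]; have vr : v \in vars r by apply/flatten_mapP; exists M.
  suff : v \in undup (flatten [seq vars r | r : cpoly F X <- [:: p; q; a; b]]) by [].
  by rewrite mem_undup; apply/flatten_mapP; exists r.
have [A [[_ prA] [[P Q QK PK sQ]]]] := poly_model_exists us.
have sp : supp_in [in s] p by apply: ss; rewrite inE eqxx.
have div r : supp_in [in s] r -> divides (P p) (P r) -> divides p r.
  move=> sr [t et]; exists (Q t); have := congr1 Q et.
  by rewrite (PK r sr) rmorphM (PK p sp).
have [] : prime_elt (P p).
  apply: prA; split.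
  - by move=> P0; apply: p0; rewrite -(PK p sp) P0 rmorph0.
  - by move=> [t et]; apply: np; exists (Q t); rewrite -(PK p sp) -rmorphM et rmorph1.
  move=> t u etu; have := irr (Q t) (Q u); rewrite -rmorphM -etu (PK p sp) => /(_ erefl).
  have inv w : is_invertible (Q w) -> is_invertible w.
    by move=> [z ez]; exists (P z); rewrite -(QK w) -rmorphM ez rmorph1.
  by case=> /inv; [left | right].
move=> _ _ /(_ (P a) (P b)); case.
- by exists (P q); rewrite -!rmorphM e.
- by move/div => da; left; apply: da; apply: ss; rewrite !inE eqxx !orbT.
- by move/div => da; right; apply: da; apply: ss; rewrite !inE eqxx !orbT.
Qed.
End CpolyFactorial.

(** * Iterated derivations and the ideals they generate *)

Lemma cmonom_ind (I : choiceType) (P : {cmonom I} -> Prop) :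
  P mone -> (forall k tau, P tau -> P (mmul (ucm k) tau)) -> forall tau, P tau.
Proof.
move=> P1 PS tau; have [n] := ubnP (mdeg tau); elim: n tau => // n IHn tau /ltnSE le_n.
have [->|tau1] := eqVneq tau mone; first exact: P1.
have [k kt] : exists k, k \in finsupp tau.
  apply/fset0Pn; apply: contraNneq tau1 => t0.
  by rewrite -mdeg_eq0 mdegE t0 big_seq_fset0.
have e : tau = mmul (ucm k) (divcm tau (ucm k)).
  apply/eqP/cmP => l; rewrite cmM divcmE cmU.
  case: eqP => [<-|_]; last by rewrite subn0.
  by rewrite subnKC // lt0n cmE_neq0.
rewrite e; apply: PS; apply: IHn; apply: leq_trans le_n.
by rewrite [in X in (_ < X)%N]e mdegM mdegU.
Qed.

Section Dop.
Variables (m : nat) (A : Type) (D : 'I_m -> A -> A) (Q : A -> Prop).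
Hypothesis QD : forall k x, Q x -> Q (D k x).
Implicit Types tau : {cmonom 'I_m}.

Lemma dop1 x : dop D mone x = x.
Proof. by rewrite /dop; elim: (enum _) => //= k s ->; rewrite cm1. Qed.

Lemma dop_stable tau x : Q x -> Q (dop D tau x).
Proof.
by rewrite /dop => Qx; elim: (enum _) => //= k s IHs; elim: (tau k) => //= j; apply: QD.
Qed.

(** The factors of [tau] are applied in the order of the index type, so adding one at the front
    needs commutation. *)
Lemma dopS k tau x : (forall k l x, Q x -> D k (D l x) = D l (D k x)) -> Q x ->
  dop D (mmul (ucm k) tau) x = D k (dop D tau x).
Proof.
move=> DC Qx; rewrite /dop; have : uniq (enum 'I_m) by exact: enum_uniq.
have : k \in enum 'I_m by rewrite mem_enum.
pose f (sigma : {cmonom 'I_m}) s := foldr (fun k y => iter (sigma k) (D k) y) x s.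
have Qf sigma s : Q (f sigma s).
  by elim: s => //= l s IHs; elim: (sigma l) => //= j; apply: QD.
have ft s : k \notin s -> f (mmul (ucm k) tau) s = f tau s.
  elim: s => //= l s IHs; rewrite inE negb_or => /andP[kl ks].
  by rewrite -IHs // cmM cmU (negPf kl).
rewrite -/(f _ _) -/(f tau _); elim: (enum _) => //= l s IHs.
rewrite inE cmM cmU; have [<-|kl] /= := eqVneq k l => [_|ks] /andP[ls us].
  by rewrite ft.
rewrite add0n IHs //; elim: (tau l) => //= j ->; apply: DC.
by elim: j => //= j; apply: QD.
Qed.
End Dop.

Lemma dop_morph m A B (D : 'I_m -> A -> A) (D' : 'I_m -> B -> B) (Q : A -> Prop) (h : A -> B)
    (tau : {cmonom 'I_m}) x :
  (forall k x, Q x -> Q (D k x)) -> (forall k x, Q x -> h (D k x) = D' k (h x)) ->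
  Q x -> h (dop D tau x) = dop D' tau (h x).
Proof.
move=> QD hD Qx; rewrite /dop.
have [] // : Q (dop D tau x) /\ h (dop D tau x) = dop D' tau (h x).
rewrite /dop; elim: (enum _) => //= k s [Qs <-].
by elim: (tau k) => //= j [Qj <-]; split; [apply: QD | apply: hD].
Qed.

Section Commuting.
Variables (m : nat) (A : comNzRingType) (D : 'I_m -> A -> A).
Hypothesis cD : commuting_derivations D.

Lemma dop_mulS k tau x : dop D (mmul (ucm k) tau) x = D k (dop D tau x).
Proof. by apply: (@dopS _ _ _ (fun _ => True)) => // l l' y _; apply: cD.2. Qed.

Lemma dopD tau x y : dop D tau (x + y) = dop D tau x + dop D tau y.
Proof.
elim/cmonom_ind: tau => [|k tau IH]; first by rewrite !dop1.
by rewrite !dop_mulS IH (cD.1 k).1.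
Qed.

Lemma dopN tau x : dop D tau (- x) = - dop D tau x.
Proof.
elim/cmonom_ind: tau => [|k tau IH]; first by rewrite !dop1.
by rewrite !dop_mulS IH (derN (cD.1 k)).
Qed.
Lemma dop_sum tau (J : Type) (r : seq J) (f : J -> A) :
  dop D tau (\sum_(i <- r) f i) = \sum_(i <- r) dop D tau (f i).
Proof.
apply: (big_morph _ (dopD tau)).
by apply: (addrI (dop D tau 0)); rewrite -dopD !addr0.
Qed.
End Commuting.

Inductive ideal_span (A : comNzRingType) (S : A -> Prop) : A -> Prop :=
| ideal_span0 : ideal_span S 0
| ideal_span_add a s p : S s -> ideal_span S p -> ideal_span S (a * s + p).

Section Span.
Variables (A : comNzRingType) (S : A -> Prop).

Lemma ideal_span_gen s : S s -> ideal_span S s.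
Proof.
by move=> Ss; rewrite -[s]mul1r -[1 * s]addr0; apply: ideal_span_add => //; constructor.
Qed.

Lemma ideal_spanD p q : ideal_span S p -> ideal_span S q -> ideal_span S (p + q).
Proof.
move=> + Sq; elim=> [|a s r Ss _ IH]; first by rewrite add0r.
by rewrite -addrA; constructor.
Qed.

Lemma ideal_spanM a p : ideal_span S p -> ideal_span S (a * p).
Proof.
elim=> [|b s r Ss _ IH]; first by rewrite mulr0; constructor.
by rewrite mulrDr mulrA; constructor.
Qed.

Lemma ideal_span_der (D : A -> A) : derivation D ->
  (forall s, S s -> ideal_span S (D s)) -> forall p, ideal_span S p -> ideal_span S (D p).
Proof.
move=> dD DS p; elim=> [|a s r Ss _ IH]; first by rewrite der0 //; constructor.
rewrite dD.1 dD.2; apply: ideal_spanD => //; apply: ideal_spanD; apply: ideal_spanM.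
  exact: ideal_span_gen.
exact: DS.
Qed.

Lemma ideal_span_kernel (B : comNzRingType) (h : {rmorphism A -> B}) :
  (forall s, S s -> h s = 0) -> forall p, ideal_span S p -> h p = 0.
Proof.
move=> hS p; elim=> [|a s r Ss _ IH]; first by rewrite rmorph0.
by rewrite rmorphD rmorphM IH (hS s Ss) mulr0 addr0.
Qed.
End Span.

Section DidealGen.
Variables (A : comNzRingType) (m : nat) (D : 'I_m -> A -> A) (S : A -> Prop).
Local Notation J := (dideal_gen D S).

Lemma dideal_gen_gen s : S s -> J s. Proof. by move=> Ss I _; apply. Qed.
Lemma dideal_gen0 : J 0. Proof. by move=> I [I0 _ _ _] _. Qed.
Lemma dideal_genD p q : J p -> J q -> J (p + q).
Proof. by move=> Jp Jq I dI SI; case: (dI) => _ h _ _; apply: h; [apply: Jp | apply: Jq]. Qed.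
Lemma dideal_genM a p : J p -> J (a * p).
Proof. by move=> Jp I dI SI; case: (dI) => _ _ h _; apply: h; apply: Jp. Qed.
Lemma dideal_gen_der k p : J p -> J (D k p).
Proof. by move=> Jp I dI SI; case: (dI) => _ _ _ h; apply: h; apply: Jp. Qed.
Lemma dideal_gen_dop tau p : J p -> J (dop D tau p).
Proof. by apply: dop_stable; apply: dideal_gen_der. Qed.

Hypothesis cD : commuting_derivations D.

(** By the product rule, the span of all derivatives of the generators is already stable. *)
Lemma dideal_gen_span p : J p -> ideal_span (fun q => exists tau s, S s /\ q = dop D tau s) p.
Proof.
apply; last by move=> s Ss; apply: ideal_span_gen; exists mone, s; rewrite dop1.
split=> [|a b|a b|k a]; [by constructor | exact: ideal_spanD | exact: ideal_spanM |].
apply: ideal_span_der; first exact: cD.1.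
move=> _ [tau [s [Ss ->]]]; apply: ideal_span_gen.
by exists (mmul (ucm k) tau), s; rewrite dop_mulS.
Qed.
End DidealGen.

(** * Derivations of polynomial rings *)

Definition der_along (A S : comNzRingType) (h : A -> S) (D : A -> S) : Prop :=
  (forall p q, D (p + q) = D p + D q) /\
  (forall p q, D (p * q) = D p * h q + h p * D q).

Lemma der_along_ext (K S : comNzRingType) (X : choiceType) (W : X -> Prop)
    (h : cpoly K X -> S) (D1 D2 : cpoly K X -> S) :
  der_along h D1 -> der_along h D2 ->
  (forall c, D1 c%:MP = D2 c%:MP) -> (forall v, W v -> D1 (cvar K v) = D2 (cvar K v)) ->
  forall p, supp_in W p -> D1 p = D2 p.
Proof.
move=> [D1D D1M] [D2D D2M] eC eV p sp.
refine (@cpoly_ind_on K X W (fun q => D1 q = D2 q) eC eV _ _ p sp) => q r eq er.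
  by rewrite D1D D2D eq er.
by rewrite D1M D2M eq er.
Qed.

Section Separant.
Variables (K : comNzRingType) (X : choiceType).
Implicit Types (W : X -> Prop) (v w : X) (p q : cpoly K X).

Lemma separant_derivation w : derivation (@separant K X w).
Proof. by apply: cder_derivation; split=> x y; rewrite ?mulr0 ?mul0r ?addr0. Qed.

Let d0 : derivation (fun _ : K => 0 : K).
Proof. by split=> x y; rewrite ?mulr0 ?mul0r ?addr0. Qed.

Lemma separantC w c : separant w c%:MP = 0 :> cpoly K X.
Proof. by rewrite /separant cderC // malgC0E. Qed.

Lemma separant_var w v : separant w (cvar K v) = (v == w)%:R.
Proof. by rewrite /separant cder_var. Qed.

Lemma separantD w p q : separant w (p + q) = separant w p + separant w q.
Proof. exact: (separant_derivation w).1. Qed.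

Lemma separantM w p q : separant w (p * q) = separant w p * q + p * separant w q.
Proof. exact: (separant_derivation w).2. Qed.

Lemma supp_in_separant W w p : supp_in W p -> supp_in W (separant w p).
Proof.
move=> sp; suff [] : supp_in W (separant w p) /\ supp_in W p by [].
refine (@cpoly_ind_on K X W (fun q => supp_in W (separant w q) /\ supp_in W q)
  _ _ _ _ p sp) => [c|v Wv|q r [sq Wq] [sr Wr]|q r [sq Wq] [sr Wr]].
- by rewrite separantC; split; [apply: supp_in0 | apply: supp_inC].
- rewrite separant_var; split; last exact: supp_in_var.
  by case: eqP => _; [apply: supp_in1 | apply: supp_in0].
- by rewrite separantD; split; apply: supp_inD.
- by rewrite separantM; split; [apply: supp_inD|]; apply: supp_inM.
Qed.

Lemma separant_notin w p : ~ occurs w p -> separant w p = 0.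
Proof.
move=> nw; apply: (@der_along_ext K _ X (fun v => v <> w) id (separant w) (fun _ => 0)).
- exact: separant_derivation.
- by split=> q r; rewrite ?mulr0 ?mul0r addr0.
- by move=> c; rewrite separantC.
- by move=> v /eqP/negPf vw; rewrite separant_var vw.
- by move=> v ov vw; apply: nw; rewrite -vw.
Qed.
End Separant.

Section DiffPoly.
Variables (m : nat) (K : dfield m) (I : choiceType).
Local Notation X := (derivative m I).
Local Notation dp := (cpoly K X).
Local Notation dpder := (@dpder m K I).
Implicit Types (p q : dp) (v w : X).

Lemma dpder_derivation k : derivation (dpder k).
Proof. exact: (dpder_commuting K I).1. Qed.

Lemma dpderD k p q : dpder k (p + q) = dpder k p + dpder k q.
Proof. exact: (dpder_derivation k).1. Qed.

Lemma dpderM k p q : dpder k (p * q) = dpder k p * q + p * dpder k q.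
Proof. exact: (dpder_derivation k).2. Qed.

Lemma dpderB k p q : dpder k (p - q) = dpder k p - dpder k q.
Proof. by rewrite dpderD; congr (_ + _); exact: (derN (dpder_derivation k) q). Qed.

Lemma dpderC k (c : K) : dpder k c%:MP = (dder k c)%:MP.
Proof. by apply: cderC; apply: (dder_commuting K).1. Qed.

Lemma dpder_var k v : dpder k (cvar K v) = cvar K (dshift k v).
Proof. by apply: cder_var; apply: (dder_commuting K).1. Qed.

Lemma dop_dpder_dvar tau (i : I) : dop dpder tau (dvar K mone i) = dvar K tau i.
Proof.
elim/cmonom_ind: tau => [|k tau IH]; first by rewrite dop1.
rewrite (dop_mulS (dpder_commuting K I)) IH /dvar dpder_var.
exact: erefl.
Qed.

Lemma supp_in_dpder (W W' : X -> Prop) k p : (forall v, W v -> W' v /\ W' (dshift k v)) ->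
  supp_in W p -> supp_in W' (dpder k p).
Proof.
move=> h sp; suff [] : supp_in W' (dpder k p) /\ supp_in W' p by [].
refine (@cpoly_ind_on K X W (fun q => supp_in W' (dpder k q) /\ supp_in W' q)
  _ _ _ _ p sp) => [c|v /h[Wv Wk]|q r [sq Wq] [sr Wr]|q r [sq Wq] [sr Wr]].
- by rewrite dpderC; split; apply: supp_inC.
- by rewrite dpder_var; split; apply: supp_in_var.
- by rewrite dpderD; split; apply: supp_inD.
- by rewrite dpderM; split; [apply: supp_inD|]; apply: supp_inM.
Qed.

(** By the product rule, only differentiating [w] itself produces its derivative. *)
Lemma supp_in_dpder_tail (lt : rel X) k w p :
  is_ranking lt -> supp_in (fun v => v = w \/ lt v w) p ->
  supp_in (lt^~ (dshift k w)) (dpder k p - separant w p * cvar K (dshift k w)).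
Proof.
move=> [irr tr tot sh mono] sp; pose T (q : dp) := dpder k q - separant w q * cvar K (dshift k w).
have TD (B : comNzRingType) (x a b y c d e : B) :
  x = a + b -> y = c + d -> x - y * e = (a - c * e) + (b - d * e) by move=> -> ->; ring.
have TM (B : comNzRingType) (x a b y c d e s t : B) : x = a * t + s * b ->
  y = c * t + s * d -> x - y * e = (a - c * e) * t + s * (b - d * e) by move=> -> ->; ring.
have ltk v : v = w \/ lt v w -> lt v (dshift k w).
  by case=> [->|h]; [exact: sh | exact: tr h (sh _ _)].
suff [] : supp_in (lt^~ (dshift k w)) (T p) /\ supp_in (lt^~ (dshift k w)) p by [].
refine (@cpoly_ind_on K X _ (fun q => supp_in (lt^~ (dshift k w)) (T q) /\
  supp_in (lt^~ (dshift k w)) q) _ _ _ _ p sp) => [c|v lv|q r [sq Wq] [sr Wr]|q r [sq Wq] [sr Wr]].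
- rewrite /T dpderC separantC mul0r subr0; split; exact: supp_inC.
- split; last by apply: supp_in_var; apply: ltk.
  rewrite /T dpder_var separant_var; case: eqP => [->|vw].
    by rewrite mul1r subrr; apply: supp_in0.
  rewrite mul0r subr0; apply: supp_in_var; case: lv => // lv.
  exact: mono.
- split; last exact: supp_inD.
  have -> : T (q + r) = T q + T r.
    exact: (TD _ _ _ _ _ _ _ _ (dpderD k q r) (separantD w q r)).
  exact: supp_inD sq sr.
- split; last exact: supp_inM.
  have -> : T (q * r) = T q * r + q * T r.
    exact: (TM _ _ _ _ _ _ _ _ _ _ (dpderM k q r) (separantM w q r)).
  exact: supp_inD (supp_inM sq Wr) (supp_inM Wq sr).
Qed.

End DiffPoly.

Lemma drename_hom (m : nat) (K : comNzRingType) (I J : choiceType) (h : I -> J) :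
  exists R : {rmorphism cpoly K (derivative m I) -> cpoly K (derivative m J)},
  [/\ (forall p, R p = drename h p), (forall c, R c%:MP = c%:MP) &
      (forall tau i, R (dvar K tau i) = dvar K tau (h i))].
Proof.
pose cst : {rmorphism K -> cpoly K (derivative m J)} := @malgC _ K.
exists (peval cst (fun v : derivative m I => dvar K v.1 (h v.2))); split=> //.
- exact: (pevalC cst).
- by move=> tau i; apply: (peval_var cst).
Qed.

(** * Polynomials as univariate polynomials in a leading variable *)

Section Monomials.
Variables (K : comNzRingType) (X : choiceType).
Implicit Types (p q : cpoly K X) (M N : {cmonom X}) (v w : X).

Lemma expcmnE M k w : (expcmn M k) w = (k * M w)%N.
Proof.
case: k => [|k]; first by rewrite mul0n; exact: onecmE.
rewrite /expcmn iteropS; elim: k => [|k IHk] /=; first by rewrite mul1n.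
by rewrite mulcmE IHk -mulSn.
Qed.

Definition strip v M := divcm M (expcmn (ucm v) (M v)).

Lemma stripE v M w : strip v M w = if w == v then 0%N else M w.
Proof.
rewrite /strip divcmE expcmnE cmU eq_sym; case: eqP => [->|_].
  by rewrite muln1 subnn.
by rewrite muln0 subn0.
Qed.

Lemma strip_mul v M : M = mmul (strip v M) (expcmn (ucm v) (M v)).
Proof.
apply/eqP/cmP => w; rewrite cmM stripE expcmnE cmU eq_sym.
by case: eqP => [->|_]; rewrite ?muln1 // muln0 addn0.
Qed.

Lemma strip_inj v M N : M v = N v -> strip v M = strip v N -> M = N.
Proof. by move=> e1 e2; rewrite (strip_mul v M) (strip_mul v N) e1 e2. Qed.

Lemma cvarX v k : cvar K v ^+ k = << expcmn (ucm v) k >>.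
Proof.
elim: k => [|k IHk]; first by rewrite expr0.
rewrite exprS IHk /cvar mkmalgUM mulr1; congr (<< _ >>).
apply/eqP/cmP => w; rewrite cmM !expcmnE cmU mulSn; exact: erefl.
Qed.

Lemma coefvE v e p :
  coefv v e p = \sum_(M <- msupp p | M v == e) << p@_M *g strip v M >>.
Proof. by apply: eq_bigr => M /eqP <-. Qed.

Lemma supp_in_coefv (W : X -> Prop) v e p :
  (forall w, w != v -> occurs w p -> W w) -> supp_in W (coefv v e p).
Proof.
move=> sp; rewrite coefvE big_seq_cond; apply: supp_in_sum => M /andP[Mp _].
apply: supp_inU => w; rewrite -cmE_neq0 stripE; have [//|wv] := eqVneq w v; rewrite cmE_neq0 => wM.
by apply: (sp w wv); exists M.
Qed.

(** Monomials with the same exponent of [v] stay distinct when that exponent is removed. *)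
Lemma coefv_neq0 v p M : M \in msupp p -> coefv v (M v) p <> 0.
Proof.
move=> Mp e0; have := congr1 (@mcoeff _ K (strip v M)) e0.
rewrite coefvE (raddf_sum (@mcoeff _ K (strip v M))) mcoeff0 big_mkcond (big_fsetD1 M) //= eqxx.
rewrite big_seq_cond big1 => [|N].
  by rewrite addr0 mcoeffUU => /eqP; rewrite mcoeff_eq0 Mp.
rewrite in_fsetD1 andbT => /andP[NM _]; case: eqP => [e|//].
rewrite mcoeffU; case: eqP => [eN|_]; last exact: mulr0n.
by case/eqP: NM; apply: strip_inj e eN.
Qed.

Lemma initial_neq0 v p : p != 0 -> initial v p <> 0.
Proof.
move=> p0; rewrite /initial.
suff [M Mp ->] : exists2 M, M \in msupp p & degv v p = M v by apply: coefv_neq0.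
have /fset0Pn[M0 M0p] : msupp p != fset0 by rewrite msupp_eq0.
have H (s : seq {cmonom X}) N0 : N0 \in s ->
    exists2 M, M \in s & \max_(N <- s) N v = M v.
  elim: s N0 => // N s IHs _ _; rewrite big_cons; case: s IHs => [|N' s] IHs.
    by rewrite big_nil maxn0; exists N; rewrite ?inE.
  have [M Ms ->] := IHs N' (mem_head _ _).
  case: (leqP (N v) (M v)) => _; [exists M | exists N] => //; rewrite inE ?eqxx //.
  by rewrite Ms orbT.
exact: H M0p.
Qed.
End Monomials.

Section LeadingVariable.
Variables (F : fieldType) (X : choiceType) (W : X -> Prop) (v0 : X) (L : fieldType).
Variables (alpha : {rmorphism cpoly F X -> L}) (U : {rmorphism cpoly F X -> {poly L}}).
Implicit Types (p q r s a b c d : cpoly F X).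
Hypothesis Wv0 : ~ W v0.
Hypothesis alpha_inj : forall p, supp_in W p -> alpha p = 0 -> p = 0.
Hypothesis alpha_frac : forall x, exists p q,
  [/\ supp_in W p, supp_in W q, alpha q != 0 & x = alpha p / alpha q].
Hypothesis UC : forall c : F, U c%:MP = (alpha c%:MP)%:P.
Hypothesis UV : forall v, U (cvar F v) = if v == v0 then 'X else (alpha (cvar F v))%:P.
Local Notation R := (fun v => v = v0 \/ W v).

Lemma univ_base p : supp_in W p -> U p = (alpha p)%:P.
Proof.
move=> sp; pose h : {rmorphism cpoly F X -> {poly L}} := polyC \o alpha.
apply: (@rmorph_cpoly_eq F X _ U h) => [c|v /sp Wv]; first exact: UC.
by rewrite UV; case: eqP => // vv0; case: Wv0; rewrite -vv0.
Qed.

Lemma univ_v0 : U (cvar F v0) = 'X. Proof. by rewrite UV eqxx. Qed.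

Lemma univ_mulX p k : supp_in W p -> U (p * cvar F v0 ^+ k) = (alpha p)%:P * 'X^k.
Proof. by move=> sp; rewrite rmorphM rmorphXn (univ_base sp) univ_v0. Qed.

Lemma coef_univ p e : supp_in R p -> (U p)`_e = alpha (coefv v0 e p).
Proof.
move=> sp; rewrite {1}[p]monalgE coefvE !raddf_sum coef_sum big_mkcond /=.
rewrite [RHS]big_mkcond /= !big_seq; apply: eq_bigr => M Mp.
have -> : << p@_M *g M >> = << p@_M *g strip v0 M >> * cvar F v0 ^+ M v0.
  by rewrite cvarX mkmalgUM mulr1 -strip_mul.
rewrite univ_mulX => [|v].
  rewrite coefCM coefXn eq_sym; case: eqP => _; first by rewrite mulr1.
  by rewrite mulr0.
move=> [N /(fsubsetP msuppU_le)]; rewrite in_fset1 => /eqP ->.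
rewrite -cmE_neq0 stripE; have [//|vv0] := eqVneq v v0; rewrite cmE_neq0 => vM.
have [e1|//] : R v by apply: sp; exists M.
by rewrite e1 eqxx in vv0.
Qed.

Lemma supp_in_base_coefv p e : supp_in R p -> supp_in W (coefv v0 e p).
Proof. by move=> sp; apply: supp_in_coefv => w /eqP wv /sp[]. Qed.

Lemma univ_inj p : supp_in R p -> U p = 0 -> p = 0.
Proof.
move=> sp U0; apply/eqP; apply: contraT => /(initial_neq0 (v := v0))[].
by apply: alpha_inj; [exact: supp_in_base_coefv | rewrite -coef_univ // U0 coef0].
Qed.

Lemma univ_separant p : U (separant v0 p) = (U p)^`().
Proof.
apply: (@der_along_ext F {poly L} X (fun _ => True) U (U \o separant v0) (fun q => (U q)^`())).
- split=> q r /=; first by rewrite separantD; exact: rmorphD.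
  rewrite separantM; apply: etrans (rmorphD _ _ _) _.
  by congr (_ + _); exact: rmorphM.
- split=> q r; first by rewrite -derivD; congr (_^`()); exact: rmorphD.
  by rewrite -derivM; congr (_^`()); exact: rmorphM.
- by move=> c /=; rewrite separantC rmorph0 UC derivC.
- move=> v _ /=; rewrite separant_var UV; case: eqP => _.
    by rewrite rmorph1 derivX.
  by rewrite rmorph0 derivC.
- by [].
Qed.
End LeadingVariable.

Section CommonRoot.
Variables (B : comNzRingType) (L : fieldType) (SW SR : B -> Prop) (x : B).
Variables (alpha : {rmorphism B -> L}) (U : {rmorphism B -> {poly L}}).
Hypotheses (SW1 : SW 1) (SWM : forall a b, SW a -> SW b -> SW (a * b)).
Hypotheses (SR0 : SR 0) (SRW : forall a, SW a -> SR a) (SRx : SR x).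
Hypotheses (SRD : forall a b, SR a -> SR b -> SR (a + b)).
Hypotheses (SRN : forall a, SR a -> SR (- a)).
Hypotheses (SRM : forall a b, SR a -> SR b -> SR (a * b)).
Hypothesis alpha_frac : forall y, exists p q,
  [/\ SW p, SW q, alpha q != 0 & y = alpha p / alpha q].
Hypothesis univ_base : forall p, SW p -> U p = (alpha p)%:P.
Hypothesis univ_x : U x = 'X.
Hypothesis univ_inj : forall p, SR p -> U p = 0 -> p = 0.

Lemma univ_clear_denominators (h : {poly L}) : exists c p,
  [/\ SW c, alpha c != 0, SR p & U p = alpha c *: h].
Proof.
elim/poly_ind: h => [|h y [c [p [sc c0 sp eU]]]].
  by exists 1, 0; split; rewrite ?rmorph1 ?oner_eq0 // rmorph0 scaler0.
have [a [b [sa sb b0 ->]]] := alpha_frac y.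
exists (c * b), (b * (p * x) + a * c); split.
- exact: SWM.
- by rewrite rmorphM mulf_neq0.
- by apply: SRD; [apply: SRM; [exact: SRW | exact: SRM] | apply: SRM; exact: SRW].
rewrite rmorphD !rmorphM /= univ_x eU !univ_base // -!mul_polyC !polyCM mulrDr.
congr (_ + _); first by ring.
by rewrite -!polyCM; congr (_%:P); field.
Qed.

Variables (Omega : fieldType) (j : {rmorphism L -> Omega}) (gamma : Omega).
Variable G : B.
Hypotheses (G_prime : prime_elt G) (sG : SR G).
Hypothesis G_root : root (map_poly j (U G)) gamma.

Let UG0 : U G != 0.
Proof. by apply/eqP => /(univ_inj sG) G0; case: G_prime. Qed.

(** A nontrivial common divisor of the two polynomials over [L] is, up to a factor, all of [G]:
    otherwise clearing denominators in a factorization of [G] contradicts that [G] is prime, as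
    the factors have smaller degree. *)
Lemma common_root_multiple r : SR r -> root (map_poly j (U r)) gamma ->
  exists c q, [/\ SW c, alpha c != 0 & c * r = G * q].
Proof.
move=> sr r_root; pose h := gcdp (U G) (U r).
have h1 : size h != 1%N.
  rewrite -coprimep_def -(coprimep_map j); apply/negP => /coprimep_root/(_ G_root).
  by case/negP.
have hG : h %| U G by exact: dvdp_gcdl.
have h0 : h != 0 by rewrite gcdp_eq0 (negPf UG0).
have [hUG|hUG] := boolP (h %= U G).
  have : U G %| U r by rewrite -(eqp_dvdl _ hUG) dvdp_gcdr.
  case/dvdpP => t et; have [c [q [sc c0 sq equ]]] := univ_clear_denominators t.
  exists c, q; split=> //; apply/eqP; rewrite -subr_eq0; apply/eqP; apply: univ_inj.
    by apply: SRD; [|apply: SRN]; apply: SRM => //; apply: SRW.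
  by rewrite rmorphB !rmorphM /= equ et [U c]univ_base // -mul_polyC; ring.
have lt_h : (size h < size (U G))%N.
  by rewrite ltn_neqAle dvdp_leq // andbT dvdp_size_eqp.
have [k ek] := dvdpP _ _ hG.
have k0 : k != 0 by apply: contraNneq UG0 => k0; rewrite ek k0 mul0r.
have lt_k : (size k < size (U G))%N.
  rewrite ek size_mul //; move: h1; rewrite -[size h]prednK ?lt0n ?size_poly_eq0 //.
  by case: (size h).-1 => // e _; rewrite addnS /= addnS ltnS leq_addr.
have [c [a [sc c0 sa ea]]] := univ_clear_denominators h.
have [d [b [sd d0 sb eb]]] := univ_clear_denominators k.
have e : a * b = G * (c * d).
  apply/eqP; rewrite -subr_eq0; apply/eqP; apply: univ_inj.
    apply: SRD; first exact: SRM.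
    by apply/SRN/SRM => //; apply: SRM; apply: SRW.
  rewrite rmorphB !rmorphM ea eb /= [U c]univ_base // [U d]univ_base // ek -!mul_polyC.
  by ring.
have H s (t : {poly L}) y : alpha y != 0 -> t != 0 -> (size t < size (U G))%N ->
    U s = alpha y *: t -> ~ divides G s.
  move=> y0 t0 lt_t es [q eq]; move: (es); rewrite eq rmorphM => e'.
  have xt0 : alpha y *: t != 0 by rewrite scaler_eq0 negb_or y0.
  have : U G %| alpha y *: t by rewrite -e' dvdp_mulr.
  by move/(dvdp_leq xt0); rewrite size_scale // leqNgt lt_t.
have [_ _ prG] := G_prime.
have [//|/(H _ _ _ c0 h0 lt_h ea)//|/(H _ _ _ d0 k0 lt_k eb)//] := prG a b.
by exists (c * d).
Qed.

(** In characteristic 0 the derivative is nonzero and of smaller degree, so no multiple of it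
    by a constant is a multiple of [G]. *)
Lemma derivative_not_root S : [pchar L] =i pred0 -> SR S -> U S = (U G)^`() ->
  ~~ root (map_poly j (U S)) gamma.
Proof.
move=> ch sS eS; apply/negP => /(common_root_multiple sS)[c [q [sc c0 e]]].
have eU : alpha c *: (U G)^`() = U G * U q.
  by rewrite -eS -mul_polyC -(univ_base sc) -!rmorphM e.
have sz : (1 < size (U G))%N.
  rewrite ltnNge; apply/negP => /size1_polyC eG; move: G_root UG0; rewrite eG.
  by rewrite map_polyC rootC polyC_eq0 fmorph_eq0 => ->.
have d0 : (U G)^`() != 0.
  apply/eqP => /(congr1 (fun p : {poly L} => p`_(size (U G)).-2)).
  have e2 : (size (U G)).-2.+1 = (size (U G)).-1 by case: (size _) sz => [|[]].
  rewrite coef0 coef_deriv e2 -mulr_natr => /eqP.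
  rewrite mulf_eq0 -/(lead_coef _) lead_coef_eq0 (negPf UG0) /=.
  have /pcharf0P -> := ch.
  by case: (size _) sz => [|[]].
have : U G %| alpha c *: (U G)^`() by rewrite eU dvdp_mulr.
move/dvdp_leq; rewrite scaler_eq0 negb_or c0 d0 => /(_ isT).
by rewrite size_scale // leqNgt lt_size_deriv.
Qed.

End CommonRoot.

(** * Passing derivations to the field generated by a point *)

Section QuotientDerivations.
Variables (m : nat) (B : comNzRingType) (d : 'I_m -> B -> B) (Omega : fieldType).
Variable ev : {rmorphism B -> Omega}.
Hypothesis cd : commuting_derivations d.
Hypothesis ev_stable : forall k p, ev p = 0 -> ev (d k p) = 0.

Definition ev_fraction (x : Omega) : Prop := exists a b, ev b != 0 /\ x = ev a / ev b.

Lemma ev_fraction_ev a : ev_fraction (ev a).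
Proof. by exists a, 1; rewrite rmorph1 oner_eq0 divr1. Qed.

Lemma ev_fraction_subfield : is_subfield ev_fraction.
Proof.
split; first by rewrite -[1](rmorph1 ev); exact: ev_fraction_ev.
- move=> _ _ [a [b [b0 ->]]] [c [e [e0 ->]]]; exists (a * e - c * b), (b * e).
  by rewrite rmorphM mulf_neq0 // rmorphB !rmorphM; split=> //; field; rewrite ?b0 ?e0.
move=> _ _ [a [b [b0 ->]]] [c [e [e0 ->]]].
have [c0|c0] := eqVneq (ev c) 0.
  by rewrite c0 mul0r invr0 mulr0 -[0](rmorph0 ev); exact: ev_fraction_ev.
exists (a * e), (b * c); rewrite !rmorphM mulf_neq0 //; split=> //.
by field; rewrite ?b0 ?c0 ?e0.
Qed.

Let quot k a b := (ev (d k a) * ev b - ev a * ev (d k b)) / ev b ^+ 2.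

Let quot_wd k a b a' b' : ev b != 0 -> ev b' != 0 -> ev a / ev b = ev a' / ev b' ->
  quot k a b = quot k a' b'.
Proof.
move=> b0 b'0 /eqP; rewrite eqr_div // => /eqP e.
have : ev (a * b' - a' * b) = 0 by rewrite rmorphB !rmorphM e subrr.
move/(ev_stable k); rewrite (cd.1 k).1 (derN (cd.1 k)) !(cd.1 k).2.
rewrite !(rmorphD, rmorphN, rmorphM) /= => e'.
apply/eqP; rewrite /quot eqr_div ?expf_neq0 //; apply/eqP.
have e2 : ev (d k a) * ev b' =
    ev (d k a') * ev b + ev a' * ev (d k b) - ev a * ev (d k b').
  by apply/eqP; rewrite -subr_eq0; apply/eqP; rewrite -e'; ring.
transitivity ((ev (d k a) * ev b') * (ev b * ev b') - (ev a * ev b') * (ev (d k b) * ev b')).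
  by ring.
by rewrite e2 mulrBl mulrDl; ring: e.
Qed.

(** The quotient rule is well defined on the field of fractions of the image because the
    kernel is stable. *)
Lemma quotient_derivations : exists D : 'I_m -> Omega -> Omega,
  [/\ (forall k a b, ev b != 0 ->
         D k (ev a / ev b) = (ev (d k a) * ev b - ev a * ev (d k b)) / ev b ^+ 2) /\
      (forall k p, D k (ev p) = ev (d k p)),
      (forall k x, ev_fraction x -> ev_fraction (D k x)),
      (forall k x y, ev_fraction x -> ev_fraction y -> D k (x + y) = D k x + D k y),
      (forall k x y, ev_fraction x -> ev_fraction y -> D k (x * y) = D k x * y + x * D k y) &
      (forall k l x, ev_fraction x -> D k (D l x) = D l (D k x))].
Proof.
(* Outside the field of fractions the value is arbitrary. *)
pose D k x := epsilon (inhabits (0 : Omega)) (fun y =>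
  exists a b, [/\ ev b != 0, x = ev a / ev b & y = quot k a b]).
have DE k a b : ev b != 0 -> D k (ev a / ev b) = quot k a b.
  move=> b0; have ex : exists y, exists a' b',
      [/\ ev b' != 0, ev a / ev b = ev a' / ev b' & y = quot k a' b'].
    by exists (quot k a b), a, b.
  rewrite /D; have [a' [b' [b'0 e ->]]] := epsilon_spec (inhabits (0 : Omega)) _ ex.
  exact: quot_wd (esym e).
have Dev k p : D k (ev p) = ev (d k p).
  have := DE k p 1; rewrite rmorph1 divr1 => -> //; last exact: oner_neq0.
  by rewrite /quot rmorph1 (der1 (cd.1 k)) rmorph0 mulr0 subr0 expr1n divr1 mulr1.
have Dst k x : ev_fraction x -> ev_fraction (D k x).
  move=> [a [b [b0 ->]]]; rewrite DE //; exists (d k a * b - a * d k b), (b ^+ 2).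
  by rewrite rmorphXn expf_neq0 // rmorphB !rmorphM.
have DD k x y : ev_fraction x -> ev_fraction y -> D k (x + y) = D k x + D k y.
  move=> [a [b [b0 ->]]] [c [e [e0 ->]]].
  have -> : ev a / ev b + ev c / ev e = ev (a * e + c * b) / ev (b * e).
    by rewrite rmorphD !rmorphM; field; rewrite ?b0 ?e0.
  rewrite !DE ?rmorphM ?mulf_neq0 // /quot (cd.1 k).1 !(cd.1 k).2 !(rmorphD, rmorphM) /=.
  by field; rewrite ?b0 ?e0.
have DM k x y : ev_fraction x -> ev_fraction y -> D k (x * y) = D k x * y + x * D k y.
  move=> [a [b [b0 ->]]] [c [e [e0 ->]]].
  have -> : (ev a / ev b) * (ev c / ev e) = ev (a * c) / ev (b * e).
    by rewrite !rmorphM; field; rewrite ?b0 ?e0.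
  rewrite !DE ?rmorphM ?mulf_neq0 // /quot !(cd.1 k).2 !(rmorphD, rmorphM) /=.
  by field; rewrite ?b0 ?e0.
exists D; split=> // k l x fx; have [a [b [b0 ex]]] := fx.
have fb := ev_fraction_ev b; have eab : x * ev b = ev a by rewrite ex divfK.
have C k' l' : D k' (D l' (x * ev b)) = D k' (D l' x) * ev b + D l' x * D k' (ev b)
    + D k' x * D l' (ev b) + x * D k' (D l' (ev b)).
  have fl : ev_fraction (D l' (ev b)) by apply: Dst.
  have M u v : ev_fraction u -> ev_fraction v -> ev_fraction (u * v).
    move=> [a1 [b1 [b10 ->]]] [a2 [b2 [b20 ->]]]; exists (a1 * a2), (b1 * b2).
    by rewrite !rmorphM mulf_neq0 //; split=> //; field; rewrite ?b10 ?b20.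
  by rewrite DM // DD; [rewrite !DM //; [ring | exact: Dst] | apply: M => //; exact: Dst
    | exact: M].
have comm_ev p : D k (D l (ev p)) = D l (D k (ev p)) by rewrite !Dev cd.2.
have e : D l (D k (x * ev b)) = D k (D l (x * ev b)) by rewrite eab comm_ev.
apply: (mulIf b0); apply/eqP; rewrite -subr_eq0; apply/eqP.
move: e; rewrite (C l k) (C k l) (comm_ev b) => /eqP; rewrite eq_sym -subr_eq0 => /eqP <-.
by ring.
Qed.
End QuotientDerivations.

Section KernelStable.
Variables (m : nat) (B : comNzRingType) (d : 'I_m -> B -> B) (Omega : fieldType).
Variable ev : {rmorphism B -> Omega}.
Variables (SR : B -> Prop) (S G : B).
Hypothesis cd : commuting_derivations d.
Local Notation J := (dideal_gen d (eq^~ G)).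
Hypothesis J_ev : forall p, J p -> ev p = 0.
Hypothesis S_ev : ev S != 0.
Hypothesis J_red : forall p, exists k r, SR r /\ J (S ^+ k * p - r).
Hypothesis SR_ev : forall r, SR r -> ev r = 0 -> exists c q, ev c != 0 /\ c * r = G * q.

(** Some [c * S ^+ e] outside the kernel multiplies [p] into the ideal [J], which is stable and
    killed; the product rule then isolates the derivative of [p]. *)
Lemma kernel_stable k p : ev p = 0 -> ev (d k p) = 0.
Proof.
move=> p0; have [e [r [sr Jr]]] := J_red p.
have r0 : ev r = 0.
  by move: (J_ev Jr); rewrite rmorphB rmorphM p0 mulr0 sub0r => /eqP; rewrite oppr_eq0 => /eqP.
have [c [q [c0 cr]]] := SR_ev sr r0.
have JcSp : J (c * S ^+ e * p).
  have -> : c * S ^+ e * p = c * (S ^+ e * p - r) + q * G by rewrite mulrBr cr; ring.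
  by apply: dideal_genD; apply: dideal_genM => //; apply: dideal_gen_gen.
have := J_ev (dideal_gen_der k JcSp); rewrite (cd.1 k).2 rmorphD !rmorphM p0 mulr0 add0r.
by rewrite rmorphXn => /eqP; rewrite !mulf_eq0 (negPf c0) expf_eq0 (negPf S_ev) andbF => /eqP.
Qed.
End KernelStable.

Section ReductionClosure.
Variables (B : comNzRingType) (SR J : B -> Prop) (S : B).
Hypotheses (SRS : SR S) (SR1 : SR 1) (SRD : forall a b, SR a -> SR b -> SR (a + b)).
Hypotheses (SRM : forall a b, SR a -> SR b -> SR (a * b)) (SRN : forall a, SR a -> SR (- a)).
Hypotheses (J0 : J 0) (JD : forall a b, J a -> J b -> J (a + b)).
Hypothesis JM : forall a b, J b -> J (a * b).

Definition reducible p := exists k r, SR r /\ J (S ^+ k * p - r).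

Let SRX k : SR (S ^+ k).
Proof. by elim: k => [|k IHk]; rewrite ?expr0 // exprS; apply: SRM. Qed.

Lemma reducible_reduced p : SR p -> reducible p.
Proof. by move=> sp; exists 0%N, p; rewrite expr0 mul1r subrr. Qed.

Lemma reducibleD p q : reducible p -> reducible q -> reducible (p + q).
Proof.
move=> [k [r [sr Jr]]] [l [t [st Jt]]]; exists (k + l)%N, (S ^+ l * r + S ^+ k * t).
split; first by apply: SRD; apply: SRM.
have -> : S ^+ (k + l) * (p + q) - (S ^+ l * r + S ^+ k * t) =
    S ^+ l * (S ^+ k * p - r) + S ^+ k * (S ^+ l * q - t) by rewrite exprD; ring.
by apply: JD; apply: JM.
Qed.

Lemma reducibleM p q : reducible p -> reducible q -> reducible (p * q).
Proof.
move=> [k [r [sr Jr]]] [l [t [st Jt]]]; exists (k + l)%N, (r * t).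
split; first exact: SRM.
have -> : S ^+ (k + l) * (p * q) - r * t =
    (S ^+ l * q) * (S ^+ k * p - r) + r * (S ^+ l * q - t) by rewrite exprD; ring.
by apply: JD; apply: JM.
Qed.

Lemma reducible_solve x y : J (S * x + y) -> reducible y -> reducible x.
Proof.
move=> Jxy [k [r [sr Jr]]]; exists k.+1, (- r); split; first exact: SRN.
have -> : S ^+ k.+1 * x - - r = S ^+ k * (S * x + y) + (-1) * (S ^+ k * y - r).
  by rewrite exprS; ring.
by apply: JD; apply: JM.
Qed.
End ReductionClosure.

(** * Orderly rankings and the derivatives of the leader *)

Section OrderlyRanking.
Variables (m : nat) (I : choiceType) (lt : rel (derivative m I)) (i0 : I).
Hypothesis lt_orderly : orderly_ranking lt.
Implicit Types sigma tau pi : {cmonom 'I_m}.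

Definition theta_lt sigma tau : Prop := lt (sigma, i0) (tau, i0).

Lemma ranking_deg v w : lt v w -> (mdeg v.1 <= mdeg w.1)%N.
Proof.
have [[irr tr _ _ _] ord] := lt_orderly => vw; rewrite leqNgt; apply/negP => /ord wv.
by have := irr v; rewrite (tr _ _ _ vw wv).
Qed.

Lemma bounded_cmonoms N : exists s : seq {cmonom 'I_m}, forall tau, (mdeg tau <= N)%N -> tau \in s.
Proof.
elim: N => [|N [s IHs]].
  by exists [:: mone] => tau; rewrite leqn0 mdeg_eq0 inE.
exists (mone :: [seq mmul (ucm k) tau | k <- enum 'I_m, tau <- s]); elim/cmonom_ind.
  by rewrite inE eqxx.
move=> k tau _; rewrite mdegM mdegU ltnS => /IHs taus; rewrite inE; apply/orP; right.
by apply: (allpairs_f (fun k tau => mmul (ucm k) tau)) => //; rewrite mem_enum.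
Qed.

(** Orderliness bounds the degree of everything below a given derivative, so only finitely many
    derivatives are below it. *)
Lemma theta_lt_wf : well_founded theta_lt.
Proof.
have [[irr tr _ _ _] _] := lt_orderly => tau.
have [s Hs] := bounded_cmonoms (mdeg tau).
pose c sigma := count (fun rho => lt (rho, i0) (sigma, i0)) s.
suff H n sigma : (c sigma < n)%N -> (mdeg sigma <= mdeg tau)%N -> Acc theta_lt sigma.
  exact: (H (c tau).+1).
elim: n sigma => [|n IHn] sigma; first by rewrite ltn0.
rewrite ltnS => le_n le_sigma.
constructor => rho lt_rho; have le_rho := leq_trans (ranking_deg lt_rho) le_sigma.
apply: IHn => //; apply: leq_trans le_n; rewrite /c.
have /Hs rs := le_rho.
elim: s rs {Hs c} => // x s IHs; rewrite inE /= => /orP[/eqP <-|/IHs lt_c].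
  rewrite irr lt_rho add0n add1n ltnS.
  by apply: sub_count => y /tr; apply.
rewrite -addnS leq_add //; case: (boolP (lt (x, i0) (rho, i0))) => // /tr -> //.
Qed.

Lemma lt_dshift_mul v pi : pi != mone -> lt v (mmul pi v.1, v.2).
Proof.
have [[irr tr _ sh _] _] := lt_orderly; elim/cmonom_ind: pi => [|k pi IH _]; first by rewrite eqxx.
rewrite -mulmA; have [->|/IH lt_pi] := eqVneq pi mone.
  by rewrite mul1m; case: v {IH} => tau i; apply: sh.
by apply: tr lt_pi _; apply: (sh k (mmul pi v.1, v.2)).
Qed.

End OrderlyRanking.

Section LeaderTail.
Variables (m : nat) (K : dfield m) (I : choiceType) (lt : rel (derivative m I)).
Hypothesis lt_orderly : orderly_ranking lt.
Variables (G : cpoly K (derivative m I)) (theta : {cmonom 'I_m}) (i0 : I).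
Hypothesis G_leader : is_leader lt (theta, i0) G.
Implicit Types pi : {cmonom 'I_m}.

Lemma leader_supp : supp_in (fun v => v = (theta, i0) \/ lt v (theta, i0)) G.
Proof.
by move=> v Gv; have [->|/(G_leader.2 v Gv)] := eqVneq v (theta, i0); [left | right].
Qed.

Lemma leader_supp_reduced :
  supp_in (fun v => v = (theta, i0) \/ ~~ ((v.2 == i0) && tdvd theta v.1)) G.
Proof.
have [[irr tr _ _ _] _] := lt_orderly => -[tau i] /leader_supp[->|lv]; [by left|right].
apply/negP => /andP[/= /eqP ei /tdvdP[pi e]]; rewrite ei e in lv.
have [pi1|pi1] := eqVneq pi mone; first by move: lv; rewrite pi1 mul1m irr.
have := tr _ _ _ (lt_dshift_mul lt_orderly (theta, i0) pi1) lv.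
by rewrite irr.
Qed.

(** The polynomial [T_tau] that determines the value at [tau = pi theta]. *)
Definition leader_tail pi : cpoly K (derivative m I) :=
  dop (@dpder m K I) pi G - separant (theta, i0) G * dvar K (mmul pi theta) i0.

Lemma supp_in_leader_tail pi : pi != mone ->
  supp_in (lt^~ (mmul pi theta, i0)) (leader_tail pi).
Proof.
have [rk _] := lt_orderly; have [irr tr tot sh mono] := rk.
elim/cmonom_ind: pi => [|k pi IH _]; first by rewrite eqxx.
have [pi1|pi1] := eqVneq pi mone.
  have := supp_in_dpder_tail (k := k) rk leader_supp.
  rewrite /leader_tail pi1 (dop_mulS (dpder_commuting K I)) dop1 -mulmA mul1m.
  by apply.
have lt1 : lt (theta, i0) (mmul pi theta, i0) := lt_dshift_mul lt_orderly (theta, i0) pi1.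
have {IH} := IH pi1; set T := leader_tail pi => sT.
have eT : leader_tail (mmul (ucm k) pi) =
    dpder k T + dpder k (separant (theta, i0) G) * dvar K (mmul pi theta) i0.
  have rg (B : comNzRingType) (x a b y c e z : B) :
      x = a -> y = a - (b * c + e * z) -> x - e * z = y + b * c by move=> -> ->; ring.
  apply: rg; first exact: (dop_mulS (dpder_commuting K I)).
  rewrite /T /leader_tail; apply: etrans (dpderB _ _ _) _; congr (_ - _).
  apply: etrans (dpderM _ _ _) _; congr (_ + _ * _).
  by rewrite /dvar dpder_var /dshift /= mulmA.
rewrite eT; apply: supp_inD; last apply: supp_inM.
- apply: (supp_in_dpder _ sT) => v lv; split; last by rewrite -mulmA; apply: mono k _ _ lv.
  by rewrite -mulmA; apply: tr lv _; apply: (sh k (mmul pi theta, i0)).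
- apply: (supp_in_dpder _ (supp_in_separant leader_supp)) => v lv.
  have lv' : lt v (mmul pi theta, i0) by case: lv => [->|/tr]; [|apply].
  rewrite -mulmA; split; last exact: (mono k _ _ lv').
  by apply: tr lv' _; apply: (sh k (mmul pi theta, i0)).
- by apply: supp_in_var; rewrite -mulmA; apply: (sh k (mmul pi theta, i0)).
Qed.

(** The proper derivatives of the leader occur linearly in the derivatives of [G], with
    coefficient the separant, so they can be removed one by one, down along the ranking. *)
Lemma partial_reduction p : exists k r,
  supp_in (fun v => v = (theta, i0) \/ ~~ ((v.2 == i0) && tdvd theta v.1)) r /\
  dideal_gen (@dpder m K I) (eq^~ G) (separant (theta, i0) G ^+ k * p - r).
Proof.
set SR := supp_in _; set J := dideal_gen _ _; set S := separant _ G.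
have [rk _] := lt_orderly; have [irr tr tot sh mono] := rk.
have SRv v : v = (theta, i0) \/ ~~ ((v.2 == i0) && tdvd theta v.1) -> SR (cvar K v).
  exact: supp_in_var.
have SRS : SR S by apply: supp_in_separant; exact: leader_supp_reduced.
have red0 q : SR q -> reducible SR J S q by apply: reducible_reduced; apply: dideal_gen0.
have JD q r : J q -> J r -> J (q + r) by apply: dideal_genD.
have JM q r : J r -> J (q * r) by apply: dideal_genM.
have SR1 : SR 1 by exact: supp_in1.
have SRD q r : SR q -> SR r -> SR (q + r) by exact: supp_inD.
have SRM q r : SR q -> SR r -> SR (q * r) by exact: supp_inM.
have redD q r : reducible SR J S q -> reducible SR J S r -> reducible SR J S (q + r).
  exact: (reducibleD SRS SR1 SRD SRM JD JM).
have redM q r : reducible SR J S q -> reducible SR J S r -> reducible SR J S (q * r).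
  exact: (reducibleM SRM JD JM).
have red_on W : (forall v, W v -> reducible SR J S (cvar K v)) ->
    forall q, supp_in W q -> reducible SR J S q.
  move=> WR q; apply: (cpoly_ind_on _ WR redD redM) => c.
  by apply: red0; exact: supp_inC.
apply: (red_on (fun _ => True)) => // -[tau i] _.
have [->|ii0] := eqVneq i i0; last by apply: red0; apply: SRv; right; rewrite /= (negPf ii0).
have wf := theta_lt_wf i0 lt_orderly; elim/(well_founded_ind wf): tau => tau IH.
have [/tdvdP[pi e]|nt] := boolP (tdvd theta tau); last first.
  by apply: red0; apply: SRv; right; rewrite /= (negPf nt) andbF.
have [pi1|pi1] := eqVneq pi mone.
  by apply: red0; apply: SRv; left; rewrite e pi1 mul1m.
have SRN q : SR q -> SR (- q) by exact: supp_inN.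
have JG : J (S * cvar K (tau, i0) + leader_tail pi).
  have rg (B : comNzRingType) (x a y : B) : x = a - y -> y + x = a.
    by move=> ->; rewrite addrC subrK.
  rewrite [X in J X](rg _ _ (dop (@dpder m K I) pi G)); last by rewrite /leader_tail -e.
  by apply: dideal_gen_dop; apply: dideal_gen_gen.
apply: (reducible_solve SRN JD JM JG).
apply: (red_on (lt^~ (tau, i0))); last by rewrite e; apply: supp_in_leader_tail.
move=> -[sigma j] lv; have [ej|ji0] := eqVneq j i0.
  by rewrite ej in lv *; apply: IH.
by apply: red0; apply: SRv; right; rewrite /= (negPf ji0).
Qed.

End LeaderTail.

Lemma eq_peval (K S : comNzRingType) (X : choiceType) (f : {rmorphism K -> S}) (x y : X -> S)
    (p : cpoly K X) : (forall v, occurs v p -> x v = y v) -> peval f x p = peval f y p.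
Proof.
move=> xy; pose hx : {rmorphism cpoly K X -> S} := peval f x.
pose hy : {rmorphism cpoly K X -> S} := peval f y.
apply: (@rmorph_cpoly_eq K X S hx hy) => [c|v vp].
  exact: etrans (pevalC f x c) (esym (pevalC f y c)).
exact: etrans (peval_var f x v) (etrans (xy v vp) (esym (peval_var f y v))).
Qed.

Lemma subfield_opp_add_mul (K : fieldType) (Q : K -> Prop) : is_subfield Q ->
  [/\ Q 0, (forall x, Q x -> Q (- x)), (forall x y, Q x -> Q y -> Q (x + y)),
      (forall x y, Q x -> Q y -> Q (x * y)) & (forall x y, Q x -> Q y -> Q (x / y))].
Proof.
move=> [Q1 QB QV]; have Q0 : Q 0 by rewrite -(subrr 1); apply: QB.
have QN x : Q x -> Q (- x) by rewrite -sub0r; apply: QB.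
split=> // [x y Qx Qy|x y Qx Qy]; first by rewrite -[y]opprK; apply/QB/QN.
by rewrite -[y]invrK; apply: (QV _ _ Qx); rewrite -div1r; apply: QV.
Qed.

Lemma hom_in_subfield (K : comNzRingType) (X : choiceType) (S : fieldType) (Q : S -> Prop)
    (h : {rmorphism cpoly K X -> S}) (p : cpoly K X) : is_subfield Q ->
  (forall c, Q (h c%:MP)) -> (forall v, occurs v p -> Q (h (cvar K v))) -> Q (h p).
Proof.
move=> /subfield_opp_add_mul[_ _ QD QM _] QC QV.
refine (@cpoly_ind_on K X (fun v => occurs v p) (fun q => Q (h q)) QC QV _ _ p _) => //.
  by move=> q r Qq Qr; rewrite rmorphD; apply: QD.
by move=> q r Qq Qr; rewrite rmorphM; apply: QM.
Qed.

Section LeaderAssignment.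
Variables (m : nat) (K : dfield m) (I : choiceType) (lt : rel (derivative m I)).
Hypothesis lt_orderly : orderly_ranking lt.
Variables (G : cpoly K (derivative m I)) (theta : {cmonom 'I_m}) (i0 : I).
Hypothesis G_leader : is_leader lt (theta, i0) G.
Variables (Omega : fieldType) (c0 : {rmorphism K -> Omega}) (b : derivative m I -> Omega).
Variable gamma : Omega.
Local Notation above v := ((v.2 == i0) && tdvd theta v.1).
Local Notation S := (separant (theta, i0) G).

Definition root_assignment (a : derivative m I -> Omega) : Prop :=
  a (theta, i0) = gamma /\ forall v, ~~ above v -> a v = b v.

Hypothesis S_neq0 : forall a, root_assignment a -> peval c0 a S != 0.

Let ltS v pi : pi != mone -> occurs v S -> lt v (mmul pi theta, i0).
Proof.
have [[irr tr _ _ _] _] := lt_orderly => pi1 /(supp_in_separant (leader_supp G_leader)).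
have lt1 := lt_dshift_mul lt_orderly (theta, i0) pi1.
by case=> [->|lv]; [exact: lt1 | exact: tr lv lt1].
Qed.

Lemma peval_dop_leader a pi : peval c0 a (dop (@dpder m K I) pi G) =
  peval c0 a (leader_tail G theta i0 pi) + peval c0 a S * a (mmul pi theta, i0).
Proof.
have [h [hC hV]] : exists h : {rmorphism cpoly K (derivative m I) -> Omega},
    (forall p, h p = peval c0 a p) /\ (forall v, h (cvar K v) = a v).
  by exists (peval c0 a); split=> // v; exact: peval_var.
rewrite -!hC -hV -rmorphM -rmorphD; congr (h _).
have rg (B : comNzRingType) (x y : B) : x = x - y + y by rewrite subrK.
exact: rg.
Qed.

(** The values at the proper derivatives of the leader are forced, one after the other along
    the ranking, by the vanishing of the derivatives of [G]. *)
Lemma root_assignment_exists : exists a, root_assignment a /\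
  forall pi, pi != mone -> peval c0 a (dop (@dpder m K I) pi G) = 0.
Proof.
have [[irr tr _ _ _] _] := lt_orderly.
have wf := theta_lt_wf i0 lt_orderly.
pose ext (f : {cmonom 'I_m} -> Omega) (v : derivative m I) :=
  if above v then (if v.1 == theta then gamma else f v.1) else b v.
have ext_root f : root_assignment (ext f).
  split=> [|v /negPf nv]; rewrite /ext /= ?nv //.
  by rewrite !eqxx (_ : tdvd _ _ = true) //; apply/forallP => k; exact: leqnn.
(* The recursion at [tau] only has the values below [tau]; the default value 0 above is harmless,
   as neither the tail nor the separant involves these derivatives. *)
pose cut tau (f : forall sigma, theta_lt lt i0 sigma tau -> Omega) sigma : Omega :=
  if @idP (lt (sigma, i0) (tau, i0)) is ReflectT h then f sigma h else 0.
pose step tau (f : forall sigma, theta_lt lt i0 sigma tau -> Omega) :=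
  - peval c0 (ext (cut tau f)) (leader_tail G theta i0 (divcm tau theta))
    / peval c0 (ext (cut tau f)) S.
pose val := Fix wf (fun _ => Omega) step.
have valE tau : val tau = step tau (fun sigma _ => val sigma).
  rewrite /val Fix_eq // => sigma f g fg.
  have e v : ext (cut sigma f) v = ext (cut sigma g) v.
    by rewrite /ext /cut; case: ifP => // _; case: ifP => // _; case: {-}_ / idP => // h.
  by rewrite /step !(eq_peval (x := ext (cut sigma f)) c0 (fun v _ => e v)).
exists (ext val); split=> // pi pi1; rewrite peval_dop_leader.
have ne : mmul pi theta != theta.
  apply: contraTneq (lt_dshift_mul lt_orderly (theta, i0) pi1) => /= ->.
  by rewrite irr.
have -> : ext val (mmul pi theta, i0) = val (mmul pi theta).
  by rewrite /ext /= eqxx (negPf ne) (_ : tdvd _ _ = true) //; apply/tdvdP; exists pi.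
set tau := mmul pi theta; have eq_below v : lt v (tau, i0) ->
    ext val v = ext (cut tau (fun sigma _ => val sigma)) v.
  case: v => sigma i lv; rewrite /ext /cut /=; case: ifP => // /andP[/eqP ei _].
  case: ifP => // _; case: {-}_ / idP => // h.
  by case: h; rewrite ei in lv.
have epi : divcm tau theta = pi by apply/eqP/cmP => k; rewrite divcmE cmM addnK.
rewrite valE /step epi.
rewrite (eq_peval (y := ext (cut tau (fun sigma _ => val sigma))) c0
  (p := leader_tail G theta i0 pi)).
  rewrite (eq_peval (y := ext (cut tau (fun sigma _ => val sigma))) c0 (p := S)).
    by rewrite mulrC divfK ?subrr // S_neq0.
  by move=> v vS; apply: eq_below; apply: ltS.
by move=> v /(supp_in_leader_tail lt_orderly G_leader pi1); apply: eq_below.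
Qed.

(** The recursion only divides by the separant, so it never leaves the field of its data. *)
Lemma root_assignment_in a (Q : Omega -> Prop) : root_assignment a ->
  (forall pi, pi != mone -> peval c0 a (dop (@dpder m K I) pi G) = 0) ->
  is_subfield Q -> (forall c, Q (c0 c)) -> (forall v, Q (b v)) -> Q gamma ->
  forall v, Q (a v).
Proof.
move=> [ag ab] aG QF Qc Qb Qg.
have [h [hE [hC hV]]] : exists h : {rmorphism cpoly K (derivative m I) -> Omega},
    (forall p, h p = peval c0 a p) /\
    (forall c, h c%:MP = c0 c) /\ (forall v, h (cvar K v) = a v).
  by exists (peval c0 a); split; [|split=> [c|v]; [exact: pevalC | exact: peval_var]].
have Qh p : (forall v, occurs v p -> Q (a v)) -> Q (h p).
  move=> Qv; apply: (hom_in_subfield QF) => [c|v /Qv Qa]; first by rewrite hC.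
  by rewrite hV.
suff Qtau tau : Q (a (tau, i0)).
  move=> -[tau i]; have [->|ni] := eqVneq i i0; first exact: Qtau.
  by rewrite ab //= (negPf ni).
have wf := theta_lt_wf i0 lt_orderly; elim/(well_founded_ind wf): tau => tau IH.
have [/tdvdP[pi e]|nt] := boolP (tdvd theta tau); last by rewrite ab //= (negPf nt) andbF.
have [pi1|pi1] := eqVneq pi mone; first by rewrite e pi1 mul1m ag.
have IHv v : lt v (tau, i0) -> Q (a v).
  case: v => sigma i lv; have [ei|ni] := eqVneq i i0; last by rewrite ab //= (negPf ni).
  by rewrite ei in lv *; apply: IH.
have [Q0 QN QD QM QV] := subfield_opp_add_mul QF.
have S0 : h S != 0 by rewrite hE S_neq0.
have := aG pi pi1; rewrite peval_dop_leader -!hE -e => /eqP.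
rewrite addr_eq0 => /eqP e2.
have -> : a (tau, i0) = - h (leader_tail G theta i0 pi) / h S.
  by rewrite e2 opprK mulrC mulKf.
apply: QV; first apply: QN; apply: Qh => v vp; apply: IHv; rewrite e.
  exact: supp_in_leader_tail vp.
exact: ltS.
Qed.
End LeaderAssignment.

(** * The base field of the roots *)

Section MapCoefficients.
Variables (K K' : comNzRingType) (X : choiceType) (f : {rmorphism K -> K'}).
Variable h : {rmorphism cpoly K X -> cpoly K' X}.
Hypothesis hC : forall c, h c%:MP = (f c)%:MP.
Hypothesis hV : forall v, h (cvar K v) = cvar K' v.

Lemma map_coefficient_mon (M : {cmonom X}) : h << M >> = << M >>.
Proof.
elim/cmonom_ind: M => [|v M IH]; first exact: (rmorph1 h).
have e (L : comNzRingType) : << mmul (ucm v) M >> = cvar L v * << M >> :> cpoly L X.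
  apply: esym; apply: (etrans (mkmalgUM _ _ _ _)); congr (<< _ *g _ >>); exact: mulr1.
apply: (etrans (congr1 h (e K))); apply: (etrans (rmorphM h _ _)).
apply: esym; apply: (etrans (e K')); congr (_ * _); apply: esym; [exact: hV | exact: IH].
Qed.

Lemma map_coefficients_inj : injective f -> forall p, h p = 0 -> p = 0.
Proof.
move=> f_inj p hp; apply/eqP; rewrite -msupp_eq0; apply/fset0Pn => -[M Mp].
have hU c N : h << c *g N >> = << f c *g N >>.
  apply: (etrans (congr1 h (mkmalgUE c N))); apply: (etrans (rmorphM h _ _)).
  apply: esym; apply: (etrans (mkmalgUE _ _)).
  by congr (_ * _); apply: esym; [exact: hC | exact: map_coefficient_mon].
have hp2 : \sum_(N <- msupp p) << f p@_N *g N >> = 0 :> cpoly K' X.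
  apply: (etrans _ hp); rewrite [X in _ = h X]monalgE (raddf_sum h); apply: eq_bigr => N _.
  exact: esym (hU _ _).
have := congr1 (@mcoeff _ K' M) hp2; rewrite mcoeff0.
have -> : (\sum_(N <- msupp p) << f p@_N *g N >>)@_M =
    \sum_(N <- msupp p) << f p@_N *g N >>@_M by exact: raddf_sum.
rewrite (big_fsetD1 M Mp) big_seq big1 => [|N].
  rewrite /= addr0 => e; have e2 : p@_M = 0.
    by apply: f_inj; apply: etrans (esym (mcoeffUU M (f p@_M))) (etrans e (esym (rmorph0 f))).
  by move/eqP: e2; rewrite mcoeff_eq0 Mp.
rewrite in_fsetD1 => /andP[/negPf NM _]; apply: (etrans (mcoeffU _ _ _)).
by rewrite NM; exact: mulr0n.
Qed.
End MapCoefficients.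

Lemma supp_in_drename (m : nat) (K : comNzRingType) (I J : choiceType) (h : I -> J)
    (W : derivative m J -> Prop) (p : cpoly K (derivative m I)) :
  (forall tau i, W (tau, h i)) -> supp_in W (drename h p).
Proof.
have [R [RE RC RV]] := drename_hom m K h => Wh; rewrite -RE.
refine (@cpoly_ind_on K _ (fun _ => True) (fun q => supp_in W (R q)) _ _ _ _ p _) => //.
- by move=> c; rewrite RC; apply: supp_inC.
- by move=> [tau i] _; rewrite [cvar _ _]/(dvar K tau i) RV; apply: supp_in_var.
- by move=> q r sq sr; rewrite rmorphD; apply: supp_inD.
- by move=> q r sq sr; rewrite rmorphM; apply: supp_inM.
Qed.

Section Fractions.
Variables (B : comNzRingType) (L : fieldType) (alpha : {rmorphism B -> L}) (SW : B -> Prop).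
Hypotheses (SW1 : SW 1) (SWD : forall a b, SW a -> SW b -> SW (a + b)).
Hypothesis SWM : forall a b, SW a -> SW b -> SW (a * b).

Definition is_fraction (x : L) : Prop := exists p q,
  [/\ SW p, SW q, alpha q != 0 & x = alpha p / alpha q].

Lemma is_fractionD x y : is_fraction x -> is_fraction y -> is_fraction (x + y).
Proof.
move=> [p [q [sp sq q0 ->]]] [r [s [sr ss s0 ->]]]; exists (p * s + r * q), (q * s).
rewrite rmorphD !rmorphM mulf_neq0 // addf_div //; split=> //; last exact: SWM.
by apply: SWD; apply: SWM.
Qed.

Lemma is_fractionM x y : is_fraction x -> is_fraction y -> is_fraction (x * y).
Proof.
move=> [p [q [sp sq q0 ->]]] [r [s [sr ss s0 ->]]]; exists (p * r), (q * s).
by rewrite !rmorphM mulf_neq0 // mulf_div; split=> //; apply: SWM.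
Qed.

Lemma is_fractionV x : is_fraction x -> is_fraction x^-1.
Proof.
move=> [p [q [sp sq q0 ->]]]; have [p0|p0] := eqVneq (alpha p) 0.
  by exists p, q; rewrite p0 mul0r invr0.
by exists q, p; rewrite invf_div.
Qed.

Lemma is_fraction_base p : SW p -> is_fraction (alpha p).
Proof. by move=> sp; exists p, 1; rewrite rmorph1 oner_eq0 divr1. Qed.
End Fractions.

Section Field0.
Variables (m n d : nat) (F : dfield m) (theta : {cmonom 'I_m}).
Local Notation X := (derivative m (uidx n d)).
Local Notation Iw := ({w : uidx n d | w != u00}).
Local Notation T := ({tau : {cmonom 'I_m} | ~~ tdvd theta tau}).
Local Notation F0 := (field_0 n d F theta).
Local Notation Fu := (field_u n d F).
Local Notation free v := (~~ ((v.2 == u00) && tdvd theta v.1)).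

(** [F_0] is built as a twofold fraction field; this hom presents it through polynomials in all the
    derivatives instead, where those above the leader are sent to the default value 0. *)
Record field_0_hom (alpha : {rmorphism cpoly F X -> F0}) : Prop := Field0Hom {
  field_0_homC : forall c : F, alpha c%:MP = u_to_0 theta (F_to_u n d c);
  field_0_homV : forall v, alpha (cvar F v) = deriv_0 v;
  field_0_homI : forall p, supp_in (fun v => free v) p -> alpha p = 0 -> p = 0;
  field_0_homU : forall p : cpoly F (derivative m Iw),
    alpha (drename val p) = u_to_0 theta (FracField.tofrac p)
}.

(** Injectivity: up to the embedding of coefficients into their fraction field, the hom is a mere
    regrouping of the variables, which has a left inverse. *)
Lemma field_0_hom_exists : exists alpha, field_0_hom alpha.
Proof.
pose fu : {rmorphism F -> Fu} := (@FracField.tofrac _) \o (@malgC {cmonom (derivative m Iw)} F).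
pose cu : {rmorphism Fu -> cpoly Fu T} := @malgC {cmonom T} Fu.
pose cd : {rmorphism cpoly F (derivative m Iw) -> cpoly (cpoly F (derivative m Iw)) T} :=
  @malgC {cmonom T} (cpoly F (derivative m Iw)).
pose cf : {rmorphism F -> cpoly F (derivative m Iw)} := @malgC {cmonom (derivative m Iw)} F.
pose tofr : {rmorphism cpoly F (derivative m Iw) -> Fu} := @FracField.tofrac _.
pose tof : {rmorphism cpoly Fu T -> F0} := @FracField.tofrac _.
have [b [bC bV]] := cpoly_hom (cu \o fu) (fun v : X => match insub v.2, insub v.1 with
  | Some w, _ => cu (tofr (dvar F v.1 w)) | None, Some tau => cvar Fu tau | None, None => 0 end).
have [b' [b'C b'V]] := cpoly_hom (cd \o cf) (fun v : X => match insub v.2, insub v.1 with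
  | Some w, _ => cd (dvar F v.1 w) | None, Some tau => cvar _ tau | None, None => 0 end).
have [io [ioC ioV]] := cpoly_hom (cu \o tofr) (fun tau : T => cvar Fu tau).
have [R [RE RC RV]] := drename_hom m F (val : Iw -> uidx n d).
have [g [gC gV]] := cpoly_hom R (fun tau : T => dvar F (val tau) u00).
have b_io p : b p = io (b' p).
  apply: (@rmorph_cpoly_eq F X _ b (io \o b' : {rmorphism _ -> _})) => [c|v _].
    by rewrite bC /= b'C; apply: esym; exact: ioC.
  rewrite bV /= b'V; case: (insub v.2) => [w|]; first by apply: esym; exact: ioC.
  by case: (insub v.1) => [tau|]; [rewrite ioV | rewrite rmorph0].
exists (tof \o b : {rmorphism _ -> _}); split.
- move=> c; exact: (congr1 tof (bC c)).
- move=> v; apply: (etrans (congr1 tof (bV v))); rewrite /deriv_0.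
  case: (insub v.2) => [w|] //; case: (insub v.1) => [tau|] //; exact: (rmorph0 tof).
- move=> p sp /eqP; rewrite [_ p]/(FracField.tofrac (b p)) tofrac_eq0 => /eqP b0.
  have b'0 : b' p = 0.
    apply: (map_coefficients_inj ioC ioV) => [x y /eqP|]; last by rewrite -b_io.
    by rewrite [_ == _]tofrac_eq => /eqP.
  have : g (b' p) = p; last by rewrite b'0 rmorph0.
  apply: (cpoly_retract _ _ sp) => [c|[tau i] fv].
    by apply: (etrans (congr1 g (b'C c))); apply: (etrans (gC _)); exact: RC.
  rewrite b'V /=; case: insubP => [w _ <-|].
    by apply: (etrans (gC _)); exact: RV.
  rewrite negbK => /eqP i0; move: fv; rewrite i0 /= => nt.
  by rewrite insubT gV.
- move=> p; rewrite -RE.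
  apply: (@rmorph_cpoly_eq F _ _ (tof \o b \o R : {rmorphism _ -> _})
    (tof \o cu \o tofr : {rmorphism _ -> _})).
    by move=> c /=; rewrite RC bC.
  move=> [tau w] _ /=; rewrite [cvar _ _]/(dvar F tau w) RV bV /= insubT; first exact: (valP w).
  by move=> wu /=; congr (tof (cu (tofr (dvar F tau _)))); apply: val_inj.
Qed.

Lemma field_0_frac alpha : field_0_hom alpha -> forall x,
  is_fraction alpha (supp_in (fun v => free v)) x.
Proof.
move=> [aC aV aI aU]; set fr := is_fraction alpha _.
have frD x y : fr x -> fr y -> fr (x + y).
  by apply: is_fractionD => p q; [exact: supp_inD | exact: supp_inM].
have frM x y : fr x -> fr y -> fr (x * y) by apply: is_fractionM => p q; exact: supp_inM.
have frV x : fr x -> fr x^-1 by exact: is_fractionV.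
have fr_alpha p : supp_in (fun v => free v) p -> fr (alpha p).
  by apply: is_fraction_base; exact: supp_in1.
have fr_u (a : Fu) : fr (u_to_0 theta a).
  have free_ren (r : cpoly F (derivative m Iw)) : fr (u_to_0 theta (FracField.tofrac r)).
    rewrite -aU; apply: fr_alpha; apply: supp_in_drename => tau w /=.
    by rewrite (negPf (valP w)).
  elim/frac_ind: a => p q q0.
  have -> : u_to_0 theta (FracField.tofrac p / FracField.tofrac q) =
      u_to_0 theta (FracField.tofrac p) / u_to_0 theta (FracField.tofrac q).
    pose h : {rmorphism Fu -> F0} := (@FracField.tofrac _) \o (@malgC {cmonom T} Fu).
    exact: (fmorph_div h).
  by apply: frM; [|apply: frV].
elim/frac_ind => p q _; have fr_t : forall p : cpoly Fu T, fr (FracField.tofrac p).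
  apply: cpoly_ind => [|tau|p' q' fp fq|p' q' fp fq].
  - exact: fr_u.
  - have -> : FracField.tofrac (cvar Fu tau) = alpha (cvar F ((val tau, u00) : X)).
      rewrite aV /deriv_0 /= insubF; last by rewrite eqxx.
      by rewrite valK; exact: erefl.
    apply: fr_alpha; apply: supp_in_var; exact: (valP tau).
  - by rewrite tofracD; apply: frD.
  - by rewrite tofracM; apply: frM.
by apply: frM; [|apply: frV]; apply: fr_t.
Qed.
End Field0.

(** * The ideal of the Chow form *)

Section EvalDer.
Variables (m : nat) (K : dfield m) (I : choiceType) (S : comNzRingType).
Variables (h : {rmorphism cpoly K (derivative m I) -> S}) (k : 'I_m) (Dk : S -> S).
Hypothesis DkD : forall p q, Dk (h p + h q) = Dk (h p) + Dk (h q).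
Hypothesis DkM : forall p q, Dk (h p * h q) = Dk (h p) * h q + h p * Dk (h q).
Hypothesis DkC : forall c, h (dder k c)%:MP = Dk (h c%:MP).
Hypothesis DkV : forall v, h (cvar K (dshift k v)) = Dk (h (cvar K v)).

(** [Dk] need only be a derivation on the image of [h]: the derivations of [F_l] are arbitrary
    functions outside it. *)
Lemma hom_dpder p : h (dpder k p) = Dk (h p).
Proof.
apply: (@der_along_ext K S _ (fun _ => True) h (fun q => h (dpder k q)) (fun q => Dk (h q))).
- split=> q r; first by rewrite dpderD; exact: rmorphD.
  rewrite dpderM; apply: (etrans (rmorphD h _ _)).
  by congr (_ + _); exact: rmorphM.
- split=> q r; first by rewrite -DkD; congr Dk; exact: rmorphD.
  by rewrite -DkM; congr Dk; exact: rmorphM.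
- by move=> c; rewrite dpderC; exact: DkC.
- by move=> v _; rewrite dpder_var; exact: DkV.
- by [].
Qed.
End EvalDer.

Lemma drename_der (m : nat) (K : dfield m) (I J : choiceType) (f : I -> J) k
    (p : cpoly K (derivative m I)) : drename f (dpder k p) = dpder k (drename f p).
Proof.
have [R [RE RC RV]] := drename_hom m K f; rewrite -!RE.
apply: (hom_dpder (Dk := @dpder m K J k)) => [q r|q r|c|[tau j]].
- exact: dpderD.
- exact: dpderM.
- exact: etrans (RC _) (etrans (esym (@dpderC m K J k c)) (congr1 _ (esym (RC c)))).
apply: (etrans (RV _ _)); apply: (etrans _ (congr1 (@dpder m K J k) (esym (RV tau j)))).
by apply: esym; exact: (@dpder_var m K J k (tau, f j)).
Qed.

(** In every other term of the Leibniz rule the first factor is differentiated to lower order. *)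
Lemma dop_mul_tail (m : nat) (K : dfield m) (I : choiceType) (i i' : I) (tau : {cmonom 'I_m}) :
  exists r : cpoly K (derivative m I),
    dop (@dpder m K I) tau (dvar K mone i * dvar K mone i') =
      dvar K tau i * dvar K mone i' + r /\
    supp_in (fun v => v.2 = i' \/ (mdeg v.1 < mdeg tau)%N) r.
Proof.
elim/cmonom_ind: tau => [|k tau [r [e sr]]].
  exists 0; split; last exact: supp_in0.
  by rewrite dop1 addr0.
exists (dvar K tau i * dvar K (ucm k) i' + dpder k r); split.
  have rg (B : comNzRingType) (x a b c : B) : x = a + b -> x + c = a + (b + c).
    by move=> ->; rewrite addrA.
  apply: (etrans (dop_mulS (dpder_commuting K I) k tau _)).
  apply: (etrans (congr1 (dpder k) e)); apply: (etrans (dpderD _ _ _)).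
  have e1 : dpder k (dvar K tau i) = dvar K (mmul (ucm k) tau) i by exact: dpder_var.
  have e2 : dpder k (dvar K mone i') = dvar K (ucm k) i'.
    by rewrite -[in RHS](mulm1 (ucm k)); exact: (@dpder_var m K I k (mone, i')).
  by apply: rg; rewrite -e1 -e2; exact: dpderM.
have lt_tau : (mdeg tau < mdeg (mmul (ucm k) tau))%N by rewrite mdegM mdegU.
apply: supp_inD; first by apply: supp_inM; apply: supp_in_var; [right | left].
apply: (supp_in_dpder _ sr) => v [vi|lt_v]; first by split; left.
by split; right; rewrite /= ?mdegM ?mdegU ?ltnS // ltnW.
Qed.

Section Congruence.
Variables (B : comNzRingType) (J : B -> Prop) (psi : {rmorphism B -> B}).
Hypotheses (J0 : J 0) (JD : forall a b, J a -> J b -> J (a + b)).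
Hypothesis JM : forall a b, J b -> J (a * b).

Lemma congrD p q : J (p - psi p) -> J (q - psi q) -> J (p + q - psi (p + q)).
Proof.
move=> Jp Jq; have -> : p + q - psi (p + q) = (p - psi p) + (q - psi q).
  by rewrite rmorphD; ring.
exact: JD.
Qed.

Lemma congrM p q : J (p - psi p) -> J (q - psi q) -> J (p * q - psi (p * q)).
Proof.
move=> Jp Jq; have -> : p * q - psi (p * q) = q * (p - psi p) + psi p * (q - psi q).
  by rewrite rmorphM; ring.
by apply: JD; apply: JM.
Qed.

Lemma congr_trans p : J (p - psi p) -> J (psi p) -> J p.
Proof. by move=> Jp Jpsi; rewrite -(subrK (psi p) p); apply: JD. Qed.

Lemma ideal_comb (n : nat) (u a y : 'I_n -> B) (s u0 : B) :
  (forall r, J (a r - y r * s)) -> J (u0 + \sum_(r < n) u r * y r) ->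
  J (s * u0 + \sum_(r < n) u r * a r).
Proof.
move=> Ja Ju; have -> : s * u0 + \sum_(r < n) u r * a r =
    s * (u0 + \sum_(r < n) u r * y r) + \sum_(r < n) u r * (a r - y r * s).
  rewrite mulrDr mulr_sumr -addrA -big_split /=; congr (_ + _).
  by apply: eq_bigr => r _; ring.
apply: JD; first exact: JM.
by apply: (big_ind J) => // r _; apply: JM.
Qed.
End Congruence.

Section Vanishing.
Variables (m n : nat) (F E : dfield m) (iE : dhom F E) (V : ('I_n -> E) -> Prop).

Lemma deval_hom (a : 'I_n -> E) : exists h : {rmorphism cpoly F (derivative m 'I_n) -> E},
  [/\ (forall p, h p = deval iE (@dder m E) a p), (forall c, h c%:MP = iE c) &
      (forall v, h (cvar F v) = dop (@dder m E) v.1 (a v.2))].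
Proof.
exists (peval iE (fun v : derivative m 'I_n => dop (@dder m E) v.1 (a v.2))); split=> //.
  exact: (pevalC iE).
by move=> v; apply: (peval_var iE).
Qed.

Lemma vanishing_der k p : vanishing iE V p -> vanishing iE V (dpder k p).
Proof.
move=> Vp a Va; have {Va} := Vp a Va; rewrite /dzero.
have [h [hE hC hV]] := deval_hom a; rewrite -!hE => hp.
have [cE dE] := dder_commuting E.
rewrite (hom_dpder (Dk := dder k)) ?hp ?(der0 (cE k)) //.
- by move=> q r; rewrite (cE k).1.
- by move=> q r; rewrite (cE k).2.
- by move=> c; exact: etrans (hC _) (etrans (dhom_der iE k c) (congr1 (dder k) (esym (hC c)))).
- move=> v; apply: (etrans (hV _)); apply: (etrans _ (congr1 (dder k) (esym (hV v)))).
  exact: (dop_mulS (dder_commuting E)).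
Qed.
End Vanishing.

Section ChowRelation.
Variables (m n d : nat) (F E : dfield m) (iE : dhom F E) (V : ('I_n -> E) -> Prop).
Local Notation uidx := (uidx n d).
Local Notation X := (derivative m uidx).
Local Notation yuidx := ('I_n + uidx)%type.
Local Notation Fu := (cpoly F X).
Local Notation Fyu := (cpoly F (derivative m yuidx)).
Local Notation dY := (@dpder m F yuidx).
Local Notation CI := (@chow_ideal m n d F E iE V).
Variables (theta : {cmonom 'I_m}).

Definition linear_part (l : 'I_d.+1) : Fyu :=
  \sum_(j < n) dvar F mone (inr (l, lift ord0 j)) * dvar F mone (inl j).

(** Values on the variables of the hom that eliminates the [u_l0] through the linear forms, so
    that modulo the Chow ideal only the relations of [V] are left. *)
Definition elim_val (v : derivative m yuidx) : Fyu :=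
  match v.2 with
  | inl j => cvar F v
  | inr (l, j) => if j == ord0 then dop dY v.1 (- linear_part l) else cvar F v
  end.

Section Elim.
Variable psi : {rmorphism Fyu -> Fyu}.
Hypotheses (psiC : forall c, psi c%:MP = c%:MP) (psiV : forall v, psi (cvar F v) = elim_val v).
Variables (iy : {rmorphism cpoly F (derivative m 'I_n) -> Fyu}) (iu : {rmorphism Fu -> Fyu}).
Hypotheses (iyE : forall p, iy p = drename inl p) (iyC : forall c, iy c%:MP = c%:MP).
Hypothesis iyV : forall tau j, iy (dvar F tau j) = dvar F tau (inl j).
Hypotheses (iuE : forall p, iu p = drename inr p) (iuC : forall c, iu c%:MP = c%:MP).
Hypothesis iuV : forall tau w, iu (dvar F tau w) = dvar F tau (inr w).

Let IV := ideal_span (fun q : Fyu => exists p, vanishing iE V p /\ q = iy p).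

Lemma psi_der k p : psi (dY k p) = dY k (psi p).
Proof.
apply: (hom_dpder (Dk := dY k)) => [q r|q r|c|v].
- exact: dpderD.
- exact: dpderM.
- exact: etrans (psiC _) (etrans (esym (@dpderC m F yuidx k c)) (congr1 (dY k) (esym (psiC c)))).
apply: (etrans (psiV _)); apply: (etrans _ (congr1 (dY k) (esym (psiV v)))).
rewrite /elim_val; case: v => tau [j|[l j]] /=; first by apply: esym; exact: dpder_var.
case: eqP => _; last by apply: esym; exact: dpder_var.
exact: (dop_mulS (dpder_commuting F yuidx)).
Qed.

Lemma psi_iy p : psi (iy p) = iy p.
Proof.
apply: (@rmorph_cpoly_eq F _ _ (psi \o iy : {rmorphism _ -> _}) iy) => [c|[tau j] _].
  by apply: (etrans (congr1 psi (iyC c))); apply: (etrans (psiC c)); exact: esym (iyC c).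
by apply: (etrans (congr1 psi (iyV tau j))); apply: (etrans (psiV _)); exact: esym (iyV tau j).
Qed.

Lemma iy_der k p : iy (dpder k p) = dY k (iy p).
Proof. by rewrite !iyE; exact: drename_der. Qed.

Lemma psi_u tau l (j : 'I_n) :
  psi (dvar F tau (inr (l, lift ord0 j))) = dvar F tau (inr (l, lift ord0 j)).
Proof. exact: psiV. Qed.

Lemma psi_y tau j : psi (dvar F tau (inl j)) = dvar F tau (inl j).
Proof. exact: psiV. Qed.

Lemma psi_linear_part l : psi (linear_part l) = linear_part l.
Proof.
apply: (etrans (rmorph_sum psi _ _ _)); apply: eq_bigr => j _.
by apply: (etrans (rmorphM psi _ _)); congr (_ * _); [exact: psi_u | exact: psi_y].
Qed.

Lemma psi_linear l : psi (chow_linear n F l) = 0.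
Proof.
have rg (B : comNzRingType) (x y : B) : x = - y -> x + y = 0 by move=> ->; rewrite addNr.
apply: (etrans (rmorphD psi _ (linear_part l))); rewrite psi_linear_part; apply: rg.
by apply: (etrans (psiV _)); rewrite /elim_val /=; exact: dop1.
Qed.

Lemma CI_linear l : CI (chow_linear n F l).
Proof. by apply: dideal_gen_gen; right; exists l. Qed.

Lemma CI_congr p : CI (p - psi p).
Proof.
have CI0 : CI 0 by exact: dideal_gen0.
have CID q r : CI q -> CI r -> CI (q + r) by exact: dideal_genD.
have CIM q r : CI r -> CI (q * r) by exact: dideal_genM.
apply: (@cpoly_ind F _ (fun q => CI (q - psi q))) => [c|v|q r|q r].
- by rewrite psiC (subrr (c%:MP : Fyu)).
- rewrite psiV /elim_val; case: v => tau [j|[l j]] /=; first by rewrite (subrr (cvar F _ : Fyu)).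
  case: eqP => [->|_]; last by rewrite (subrr (cvar F _ : Fyu)).
  have cY := dpder_commuting F yuidx.
  rewrite (dopN cY) opprK -[cvar F _](dop_dpder_dvar F tau (inr (l, ord0) : yuidx)) -(dopD cY).
  by apply: dideal_gen_dop; exact: CI_linear.
- exact: congrD.
- exact: congrM.
Qed.

Lemma IV_CI p : IV p -> CI p.
Proof.
elim=> [|a s q [r [Vr ->]] _ IH]; first exact: dideal_gen0.
apply: dideal_genD => //; apply: dideal_genM; apply: dideal_gen_gen; left.
by exists r; rewrite // iyE.
Qed.

Lemma CI_IV p : CI p -> IV (psi p).
Proof.
move=> /(_ (fun q => IV (psi q))); apply.
  split=> [|a b|a b|k a].
  - by rewrite rmorph0; exact: ideal_span0.
  - by rewrite rmorphD; exact: ideal_spanD.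
  - by rewrite rmorphM; exact: ideal_spanM.
  rewrite psi_der; apply: ideal_span_der; first exact: dpder_derivation.
  move=> _ [q [Vq ->]]; apply: ideal_span_gen; exists (dpder k q); split.
    exact: vanishing_der.
  exact: esym (iy_der k q).
move=> q [[r Vr ->]|[l ->]].
  by rewrite -iyE psi_iy; apply: ideal_span_gen; exists r.
by rewrite psi_linear; exact: ideal_span0.
Qed.

Lemma separant_dop_term (rho j : 'I_n) l tau : (mdeg tau <= mdeg theta)%N ->
  separant (theta, inr (ord0, lift ord0 rho))
      (dop dY tau (dvar F mone (inr (l, lift ord0 j)) * dvar F mone (inl j)) : Fyu) =
    ((tau == theta) && (l == ord0) && (j == rho))%:R * dvar F mone (inl rho).
Proof.
move=> le_tau; set w := (theta, _).
have [r [-> sr]] := dop_mul_tail F (inr (l, lift ord0 j) : yuidx) (inl j) tau.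
have wr : separant w r = 0.
  by apply: separant_notin => /sr[//|]; rewrite /= ltnNge le_tau.
have sv sigma (i : yuidx) : separant w (dvar F sigma i) = ((sigma, i) == w)%:R.
  exact: (@separant_var F (derivative m yuidx) w (sigma, i)).
have wy : separant w (dvar F mone (inl j) : Fyu) = 0.
  by rewrite sv /w xpair_eqE /= andbF.
have wu : separant w (dvar F tau (inr (l, lift ord0 j)) : Fyu) =
    ((tau == theta) && (l == ord0) && (j == rho))%:R.
  rewrite sv; congr (_%:R); congr (nat_of_bool _).
  by rewrite -andbA xpair_eqE; congr (_ && (_ && _)); exact: (inj_eq (@lift_inj _ ord0)).
have rg (B : comNzRingType) (x a b c e f z : B) :
    x = a + z -> z = 0 -> a = b * c + e * f -> f = 0 -> x = b * c.
  by move=> -> -> -> ->; rewrite mulr0 !addr0.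
apply: (etrans (rg _ _ _ _ _ _ _ _ (separantD _ _ _) wr (separantM _ _ _) wy)).
rewrite wu; case: (j =P rho) => [->|_]; first exact: erefl.
have rg0 (B : comNzRingType) (x y : B) b : (b && false)%:R * x = (b && false)%:R * y.
  by rewrite andbF !mul0r.
exact: rg0.
Qed.

(** What replaces [tau(u_00)] involves [theta(u_0rho)] only if [theta] divides [tau]; the bound
    on the order leaves [tau = theta], where the coefficient is [- y_rho]. *)
Lemma chain_rule (rho : 'I_n) p : supp_in (fun v => (mdeg v.1 <= mdeg theta)%N) p ->
  separant (theta, inr (ord0, lift ord0 rho)) (psi (iu p)) =
    psi (iu (separant (theta, (ord0, lift ord0 rho)) p))
    - dvar F mone (inl rho) * psi (iu (separant (theta, u00) p)).
Proof.
set w := (theta, inr _); set w0 := (theta, (ord0, _)); set y := dvar F mone (inl rho).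
have [h hE] : exists h : {rmorphism Fu -> Fyu}, forall q, h q = psi (iu q).
  by exists (psi \o iu).
move=> sp; apply: (etrans (congr1 (separant w) (esym (hE p)))).
apply: (etrans _ (congr2 (fun a b => a - y * b) (hE _) (hE _))); move: p sp.
have rgD (B : comNzRingType) (x a b z c e t : B) : x = a + b -> z = c + e ->
  x - t * z = (a - t * c) + (b - t * e) by move=> -> ->; ring.
have rgM (B : comNzRingType) (x a b z c e t p1 q1 : B) : x = a * q1 + p1 * b ->
  z = c * q1 + p1 * e -> x - t * z = (a - t * c) * q1 + p1 * (b - t * e) by move=> -> ->; ring.
have hsD v q r : h (separant v (q + r)) = h (separant v q) + h (separant v r).
  by rewrite separantD; exact: rmorphD.
have hsM v q r : h (separant v (q * r)) = h (separant v q) * h r + h q * h (separant v r).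
  rewrite separantM; apply: (etrans (rmorphD h _ _)).
  by congr (_ + _); exact: rmorphM.
apply: (@der_along_ext F Fyu X _ h (fun q => separant w (h q))
  (fun q => h (separant w0 q) - y * h (separant (theta, u00) q))).
- split=> q r; first by rewrite -separantD; congr (separant w _); exact: rmorphD.
  by rewrite -separantM; congr (separant w _); exact: rmorphM.
- by split=> q r; [exact: (rgD _ _ _ _ _ _ _ _ (hsD _ _ _) (hsD _ _ _))
    | exact: (rgM _ _ _ _ _ _ _ _ _ _ (hsM _ _ _) (hsM _ _ _))].
- move=> c; rewrite !separantC !rmorph0 mulr0 subr0.
  have -> : h c%:MP = c%:MP by exact: etrans (hE _) (etrans (congr1 psi (iuC c)) (psiC c)).
  exact: separantC.
move=> [tau [l j]] /= le_tau; rewrite !separant_var.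
have hb (b : bool) : h b%:R = b%:R by exact: rmorph_nat.
rewrite !hb.
have -> : h (cvar F (tau, (l, j))) = elim_val (tau, inr (l, j)).
  exact: etrans (hE _) (etrans (congr1 psi (iuV tau (l, j))) (psiV _)).
rewrite /elim_val /=; case: eqP => [->|/eqP j0].
  have cY := dpder_commuting F yuidx.
  have e1 : dop dY tau (- linear_part l) = - \sum_(j' < n) dop dY tau
      (dvar F mone (inr (l, lift ord0 j')) * dvar F mone (inl j')).
    by rewrite (dopN cY); congr (- _); exact: (dop_sum cY).
  have rgS (B : comNzRingType) (D : B -> B) (f : 'I_n -> B) : derivation D ->
      D (- \sum_(j' < n) f j') = - \sum_(j' < n) D (f j').
    by move=> dD; rewrite (derN dD) (der_sum dD).
  have rgT (B : comNzRingType) (b : bool) (z : B) (f : 'I_n -> B) :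
      (forall j', f j' = (b && (j' == rho))%:R * z) ->
      - \sum_(j' < n) f j' = false%:R - z * b%:R.
    move=> ef; rewrite (bigD1 rho) //= big1 => [|j' /negPf j'r].
      by rewrite ef eqxx andbT addr0 sub0r mulrC.
    by rewrite ef j'r andbF mul0r.
  rewrite e1; apply: (etrans (rgS _ _ _ (@separant_derivation F (derivative m yuidx) w))).
  have -> : ((tau, (l, ord0 : 'I_n.+1)) == w0) = false by rewrite /w0 !xpair_eqE /= !andbF.
  have -> : ((tau, (l, ord0 : 'I_n.+1)) == (theta, u00)) = (tau == theta) && (l == ord0).
    by apply/idP/idP => [/eqP[-> ->]|/andP[/eqP -> /eqP ->]]; rewrite ?eqxx.
  by apply: rgT => j'; exact: separant_dop_term.
have -> : ((tau, (l, j)) == (theta, u00)) = false.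
  by apply/eqP => -[_ _ j0']; rewrite j0' eqxx in j0.
have rg (B : comNzRingType) (x a z : B) : x = a -> x = a - z * false%:R.
  by move=> ->; rewrite mulr0 subr0.
have -> : ((tau, (l, j)) == w0) = ((tau, inr (l, j) : yuidx) == w).
  by apply/idP/idP => /eqP[-> -> ->]; exact: eqxx.
by apply: rg; exact: (@separant_var F (derivative m yuidx) w (tau, inr (l, j))).
Qed.

Lemma separant_iy (w : uidx) p : separant (theta, inr w) (iy p) = 0.
Proof.
have sp : supp_in (fun v : derivative m yuidx => v.2 != inr w) (drename inl p : Fyu).
  by apply: supp_in_drename.
by apply: separant_notin; rewrite iyE => /sp; rewrite eqxx.
Qed.

Lemma elim_relation G : supp_in (fun v => (mdeg v.1 <= mdeg theta)%N) G -> CI (iu G) ->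
  CI (iu (separant (theta, u00) G * dvar F mone u00 +
    \sum_(rho < n) dvar F mone (ord0, lift ord0 rho) *
      separant (theta, (ord0, lift ord0 rho)) G)).
Proof.
move=> sG CIG; set S := separant _ G.
pose S_ (rho : 'I_n) := separant (theta, (ord0, lift ord0 rho)) G.
have CID q r : CI q -> CI r -> CI (q + r) by exact: dideal_genD.
have CIM q r : CI r -> CI (q * r) by exact: dideal_genM.
have CI0 : CI 0 by exact: dideal_gen0.
have CI_S rho : CI (iu (S_ rho) - dvar F mone (inl rho) * iu S).
  apply: (congr_trans CID (CI_congr _)); apply: IV_CI.
  have -> : psi (iu (S_ rho) - dvar F mone (inl rho) * iu S) =
      separant (theta, inr (ord0, lift ord0 rho)) (psi (iu G)).
    have rg (B : comNzRingType) (h : {rmorphism B -> B}) (a y s : B) : h y = y ->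
      h (a - y * s) = h a - y * h s by move=> hy; rewrite rmorphB rmorphM hy.
    apply: esym; apply: (etrans (chain_rule rho sG)); apply: esym.
    by apply: rg; exact: psi_y.
  pose w := (theta, inr (ord0, lift ord0 rho)) : derivative m yuidx.
  apply: (@ideal_span_der Fyu _ _ (@separant_derivation F _ w)); last exact: CI_IV.
  by move=> _ [q [_ ->]]; rewrite separant_iy; exact: ideal_span0.
have := ideal_comb CI0 CID CIM CI_S (CI_linear ord0).
have rg (A B : comNzRingType) (h : {rmorphism A -> B}) (s u0 : A) (u a : 'I_n -> A)
    (hu0 : B) (hu : 'I_n -> B) : h u0 = hu0 -> (forall r, h (u r) = hu r) ->
    h (s * u0 + \sum_(r < n) u r * a r) = h s * hu0 + \sum_(r < n) hu r * h (a r).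
  move=> e0 eu; rewrite rmorphD rmorphM rmorph_sum e0; congr (_ + _).
  by apply: eq_bigr => r _; rewrite rmorphM eu.
have -> := rg _ _ iu S (dvar F mone u00) (fun rho => dvar F mone (ord0, lift ord0 rho)) S_ _ _
  (iuV _ _) (fun rho => iuV _ _).
exact.
Qed.
End Elim.

Lemma chow_relation (lt : rel X) (G : Fu) : orderly_ranking lt -> is_leader lt (theta, u00) G ->
  is_chow_form iE lt V G ->
  sat lt G (separant (theta, u00) G * dvar F mone u00 +
    \sum_(rho < n) dvar F mone (ord0, lift ord0 rho) *
      separant (theta, (ord0, lift ord0 rho)) G).
Proof.
move=> lt_orderly G_leader [_ G_sat].
have [psi [psiC psiV]] := cpoly_hom (@malgC _ F : {rmorphism F -> Fyu}) elim_val.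
have [iy [iyE iyC iyV]] := drename_hom m F (inl : 'I_n -> yuidx).
have [iu [iuE iuC iuV]] := drename_hom m F (inr : uidx -> yuidx).
apply/G_sat; rewrite -iuE; apply: (elim_relation psiC psiV iyE iyC iyV iuC iuV).
  move=> v /(leader_supp G_leader)[->|lv]; first exact: leqnn.
  exact: (ranking_deg lt_orderly lv).
rewrite iuE; apply/G_sat; exists (theta, u00) => //; exists 0%N.
by rewrite expr0 mul1r; apply: dideal_gen_gen.
Qed.
End ChowRelation.

(** * The fields of the roots *)

Section RootField.
Variables (m n d : nat) (F : dfield m) (theta : {cmonom 'I_m}).
Local Notation uidx := (uidx n d).
Local Notation X := (derivative m uidx).
Local Notation F0 := (field_0 n d F theta).
Local Notation Fu := (field_u n d F).
Local Notation v0 := ((theta, u00) : X).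
Local Notation free := (fun v : X => ~~ ((v.2 == u00) && tdvd theta v.1)).
Local Notation reduced := (fun v : X => v = v0 \/ free v).

Definition const_0 : {rmorphism F -> F0} :=
  (@FracField.tofrac _) \o (@malgC {cmonom {tau : {cmonom 'I_m} | ~~ tdvd theta tau}} Fu)
  \o (@FracField.tofrac _) \o (@malgC {cmonom (derivative m {w : uidx | w != u00})} F).

Lemma tdvd_refl : tdvd theta theta. Proof. by apply/forallP => k; exact: leqnn. Qed.

Lemma leader_not_free : ~ free v0.
Proof. by rewrite /= tdvd_refl. Qed.

Lemma univariate_hom (alpha : {rmorphism cpoly F X -> F0}) : field_0_hom alpha ->
  exists U : {rmorphism cpoly F X -> {poly F0}},
  [/\ (forall p, U p = univariate theta p), (forall c, U c%:MP = (alpha c%:MP)%:P) &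
      (forall v, U (cvar F v) = if v == v0 then 'X else (alpha (cvar F v))%:P)].
Proof.
move=> [aC aV _ _]; pose f : {rmorphism F -> {poly F0}} := polyC \o const_0.
pose x (v : X) : {poly F0} := if v == v0 then 'X else (deriv_0 v)%:P.
exists (peval f x); split=> [//|c|v]; first by rewrite aC; exact: (pevalC f).
by rewrite aV; exact: (peval_var f).
Qed.

Lemma univariate_inj (p : cpoly F X) : supp_in reduced p -> univariate theta p = 0 -> p = 0.
Proof.
have [alpha alphaP] := field_0_hom_exists n d F theta.
have [U [<- UC UV]] := univariate_hom alphaP.
exact: (univ_inj (W := free) (v0 := v0) leader_not_free (field_0_homI alphaP) UC UV).
Qed.

Section FixedRoot.
Variables (lt : rel X) (G : cpoly F X).
Hypotheses (lt_orderly : orderly_ranking lt) (G_leader : is_leader lt v0 G).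
Hypothesis G_irreducible : irreducible_elt G.
Hypothesis F_char0 : [pchar F] =i pred0.
Variables (Omega : fieldType) (j : {rmorphism F0 -> Omega}) (gamma : Omega).
Hypothesis gamma_root : root (map_poly j (univariate theta G)) gamma.
Variables (alpha : {rmorphism cpoly F X -> F0}) (alphaP : field_0_hom alpha).
Local Notation S := (separant v0 G).
Local Notation c0 := (j \o const_0 : {rmorphism F -> Omega}).
Local Notation b := (fun v : X => j (deriv_0 v)).

Variable a : X -> Omega.
Hypothesis a_root : root_assignment theta u00 b gamma a.
Variable ev : {rmorphism cpoly F X -> Omega}.
Hypotheses (evC : forall c, ev c%:MP = j (const_0 c)) (evV : forall v, ev (cvar F v) = a v).

Lemma ev_free p : supp_in free p -> ev p = j (alpha p).
Proof.
move=> sp; apply: (@rmorph_cpoly_eq F X _ ev (j \o alpha : {rmorphism _ -> _})) => [c|v /sp fv].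
  by apply: (etrans (evC c)); apply: esym; exact: (congr1 j (field_0_homC alphaP c)).
apply: (etrans (evV v)); apply: (etrans (a_root.2 v fv)); apply: esym.
exact: (congr1 j (field_0_homV alphaP v)).
Qed.

Lemma ev_reduced p : supp_in reduced p -> ev p = (map_poly j (univariate theta p)).[gamma].
Proof.
have [U [UE UC UV]] := univariate_hom alphaP; rewrite -UE => sp.
have [h [hE hC hX]] : exists h : {rmorphism {poly F0} -> Omega},
    [/\ forall q, h q = (map_poly j q).[gamma], forall x, h x%:P = j x & h 'X = gamma].
  exists (horner_eval gamma \o map_poly j); split=> [q|x|] //=.
    by rewrite map_polyC /horner_eval hornerC.
  by rewrite map_polyX /horner_eval hornerX.
rewrite -hE; apply: (@rmorph_cpoly_eq F X _ ev (h \o U : {rmorphism _ -> _})) => [c|v /sp rv].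
  apply: (etrans (evC c)); apply: esym; apply: (etrans (congr1 h (UC c))); apply: (etrans (hC _)).
  exact: (congr1 j (field_0_homC alphaP c)).
apply: (etrans (evV v)); apply: esym; apply: (etrans (congr1 h (UV v))).
case: eqP => [->|nv]; first by rewrite hX a_root.1.
by case: rv => // fv; rewrite hC a_root.2 // (field_0_homV alphaP).
Qed.

Lemma G_reduced : supp_in reduced G.
Proof. exact (leader_supp_reduced lt_orderly G_leader). Qed.

Lemma ev_G : ev G = 0.
Proof. by rewrite (ev_reduced G_reduced); apply/eqP. Qed.

(** The irreducibility of [G] enters here: vanishing at the root means divisibility by [G], up
    to a factor free of the leader. *)
Lemma ev_S_multiple : ev S != 0 /\
  forall r, supp_in reduced r -> ev r = 0 -> exists c q, ev c != 0 /\ c * r = G * q.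
Proof.
have [U [UE UC UV]] := univariate_hom alphaP.
have G_root : root (map_poly j (U G)) gamma by rewrite UE.
have SW1 : supp_in free (1 : cpoly F X) by exact: supp_in1.
have SWM (p q : cpoly F X) : supp_in free p -> supp_in free q -> supp_in free (p * q)
  by exact: supp_inM.
have SR0 : supp_in reduced (0 : cpoly F X) by exact: supp_in0.
have SRW (p : cpoly F X) : supp_in free p -> supp_in reduced p by apply: supp_inW => v; right.
have SRx : supp_in reduced (cvar F v0) by apply: supp_in_var; left.
have SRD (p q : cpoly F X) : supp_in reduced p -> supp_in reduced q -> supp_in reduced (p + q)
  by exact: supp_inD.
have SRN (p : cpoly F X) : supp_in reduced p -> supp_in reduced (- p) by exact: supp_inN.
have SRM (p q : cpoly F X) : supp_in reduced p -> supp_in reduced q -> supp_in reduced (p * q)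
  by exact: supp_inM.
have base := univ_base (W := free) (v0 := v0) leader_not_free UC UV.
have G_prime := irreducible_cpoly_prime G_irreducible.
have inj := univ_inj (W := free) (v0 := v0) leader_not_free (field_0_homI alphaP) UC UV.
have frac := field_0_frac alphaP.
have sS : supp_in reduced S by apply: supp_in_separant; exact: G_reduced.
split.
  rewrite (ev_reduced sS) -UE.
  apply: (derivative_not_root SW1 SWM SR0 SRW SRx SRD SRN SRM frac base (univ_v0 UV) inj
    G_prime G_reduced G_root _ sS (univ_separant UC UV G)).
  by move=> q; rewrite (fmorph_pchar const_0).
move=> r sr r0; have r_root : root (map_poly j (U r)) gamma.
  by rewrite UE /root -(ev_reduced sr) r0.
have [c [q [sc c_neq0 e]]] := common_root_multiple SW1 SWM SR0 SRW SRx SRD SRN SRM frac base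
  (univ_v0 UV) inj G_prime G_reduced G_root sr r_root.
exists c, q; split; last exact: e.
by rewrite (ev_free sc) fmorph_eq0.
Qed.

End FixedRoot.
End RootField.

Section RootDerivations.
Variables (m n d : nat) (F : dfield m) (theta : {cmonom 'I_m}).
Local Notation uidx := (uidx n d).
Local Notation X := (derivative m uidx).
Local Notation F0 := (field_0 n d F theta).
Local Notation Fu := (field_u n d F).
Local Notation v0 := ((theta, u00) : X).
Local Notation free := (fun v : X => ~~ ((v.2 == u00) && tdvd theta v.1)).
Local Notation Iw := ({w : uidx | w != u00}).
Variables (lt : rel X) (G : cpoly F X).
Hypotheses (lt_orderly : orderly_ranking lt) (G_leader : is_leader lt v0 G).
Hypothesis G_irreducible : irreducible_elt G.
Hypothesis F_char0 : [pchar F] =i pred0.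
Variables (Omega : fieldType) (j : {rmorphism F0 -> Omega}) (gamma : Omega).
Hypothesis gamma_root : root (map_poly j (univariate theta G)) gamma.
Local Notation S := (separant v0 G).
Local Notation b := (fun v : X => j (deriv_0 v)).
Local Notation cj := (j \o const_0 n d F theta : {rmorphism F -> Omega}).

Lemma adjoin_root_subfield : is_subfield (adjoin_root j gamma).
Proof.
split=> [Q [Q1 _ _] _ _ //|x y hx hy Q QF Qj Qg|x y hx hy Q QF Qj Qg].
  by case: (QF) => _ QB _; apply: QB; [apply: hx | apply: hy].
by case: (QF) => _ _ QV; apply: QV; [apply: hx | apply: hy].
Qed.

Lemma adjoin_root_base x : adjoin_root j gamma (j x).
Proof. by move=> Q _ Qj _; apply: Qj. Qed.

Lemma adjoin_root_root : adjoin_root j gamma gamma.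
Proof. by move=> Q. Qed.

Lemma u00_at_assignment a : root_assignment theta u00 b gamma a ->
  u00_at j gamma = a (mone, u00).
Proof.
move=> [ag ab]; rewrite /u00_at; have [t1|t1] := eqVneq theta mone.
  by rewrite -ag t1.
rewrite ab //=; apply: contra t1 => /forallP t0; apply/eqP/eqP/cmP => k.
by move: (t0 k); rewrite cm1 leqn0 => /eqP.
Qed.

Lemma S_neq0 a : root_assignment theta u00 b gamma a -> peval cj a S != 0.
Proof.
move=> a_root; have [alpha alphaP] := field_0_hom_exists n d F theta.
pose ev : {rmorphism cpoly F X -> Omega} := peval cj a.
have evC c : ev c%:MP = j (const_0 n d F theta c) := pevalC cj a c.
have evV v : ev (cvar F v) = a v := peval_var cj a v.
exact: (ev_S_multiple lt_orderly G_leader G_irreducible F_char0 gamma_root alphaP a_root evC evV).1.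
Qed.

(** The field of the root is the field of fractions of the image of the evaluation, so the
    derivations of the polynomial ring pass to it. *)
Lemma root_derivations_exist : exists D, root_derivations j G gamma D.
Proof.
have [alpha alphaP] := field_0_hom_exists n d F theta.
have [a [a_root aG]] := root_assignment_exists lt_orderly G_leader S_neq0.
have a_in := root_assignment_in lt_orderly G_leader S_neq0 a_root aG.
have tailE := peval_dop_leader G theta u00 cj a.
have [ev [evE evC evV]] : exists ev : {rmorphism cpoly F X -> Omega},
    [/\ forall p, ev p = peval cj a p, forall c, ev c%:MP = j (const_0 n d F theta c) &
        forall v, ev (cvar F v) = a v].
  by exists (peval cj a); split; [by []|exact: (pevalC cj a)|exact: (peval_var cj a)].
have evG := ev_G lt_orderly G_leader gamma_root alphaP a_root evC evV.
have [S0 mult] := ev_S_multiple lt_orderly G_leader G_irreducible F_char0 gamma_root alphaP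
  a_root evC evV.
have free_ev := ev_free alphaP a_root evC evV.
have cd := dpder_commuting F uidx.
have J_ev p : dideal_gen (@dpder m F uidx) (eq^~ G) p -> ev p = 0.
  move/(dideal_gen_span cd); apply: ideal_span_kernel => _ [pi [_ [-> ->]]].
  have [->|pi1] := eqVneq pi mone; first by rewrite dop1.
  by rewrite evE; exact: aG.
have stable := kernel_stable cd J_ev S0 (partial_reduction lt_orderly G_leader) mult.
have [D [[Dq Dev] Dst DD DM DC]] := quotient_derivations cd stable.
have fr_adj x : adjoin_root j gamma x -> ev_fraction ev x.
  move=> hx; apply: hx; first exact: ev_fraction_subfield.
    move=> y; have [p [q [sp sq q0 ->]]] := field_0_frac alphaP y.
    by exists p, q; rewrite !free_ev // fmorph_eq0 fmorph_div.
  by rewrite -(a_root.1) -evV; exact: ev_fraction_ev.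
have adjF := adjoin_root_subfield.
have [_ _ _ _ adjV] := subfield_opp_add_mul adjF.
have ev_adj p : adjoin_root j gamma (ev p).
  apply: (hom_in_subfield adjF) => [c|v _]; first by rewrite evC; exact: adjoin_root_base.
  rewrite evV; apply: a_in => //; first by move=> c; exact: adjoin_root_base.
    by move=> w; exact: adjoin_root_base.
have adj_fr x : ev_fraction ev x -> adjoin_root j gamma x.
  by move=> [p [q [_ ->]]]; apply: adjV.
have dop_ev tau p : dop D tau (ev p) = ev (dop (@dpder m F uidx) tau p).
  by apply: esym; apply: (@dop_morph _ _ _ _ _ (fun _ => True) ev) => // k x _.
have dop_a tau i : dop D tau (a (mone, i)) = a (tau, i).
  rewrite -[a (mone, i)]evV -[a (tau, i)]evV dop_ev.
  by congr (ev _); exact: dop_dpder_dvar.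
have u00E := u00_at_assignment a_root.
have eval_atE p : eval_at j gamma D p = ev p.
  rewrite evE; apply: (@eq_peval _ _ _ cj (fun v : X => dop D v.1
    (if v.2 == u00 then u00_at j gamma else j (deriv_0 (mone, v.2))))) => -[tau i] _ /=.
  rewrite -dop_a.
  congr (dop D tau _); case: eqP => [->|/eqP ni]; first exact: u00E.
  by rewrite a_root.2 //= (negPf ni).
exists D; split.
- by move=> k x /fr_adj hx; apply: adj_fr; apply: Dst.
- by move=> k x y /fr_adj hx /fr_adj hy; apply: DD.
- by move=> k x y /fr_adj hx /fr_adj hy; apply: DM.
- by move=> k l x /fr_adj hx; apply: DC.
- have rename_ev (p : cpoly F (derivative m Iw)) :
      j (u_to_0 theta (FracField.tofrac p)) = ev (drename val p).
    rewrite -(field_0_homU alphaP) free_ev //; apply: supp_in_drename => sigma w /=.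
    by rewrite (negPf (valP w)).
  have [h hj] : exists h : {rmorphism Fu -> Omega}, forall x, h x = j (u_to_0 theta x).
    by exists (j \o (@FracField.tofrac _) \o
      (@malgC {cmonom {tau : {cmonom 'I_m} | ~~ tdvd theta tau}} Fu)).
  have hE (r : cpoly F (derivative m Iw)) : h (FracField.tofrac r) = ev (drename val r).
    by rewrite hj; exact: rename_ev.
  have h_der k x : h (dder k x) = D k (h x).
    elim/frac_ind: x => p q q0.
    have q'0 : ev (drename val q) != 0 by rewrite -hE fmorph_eq0 tofrac_eq0.
    rewrite [dder k _](frac_derE (@dpder_derivation m F Iw k) p q0) !fmorph_div !hE Dq //.
    rewrite rmorphXn hE; congr (_ / _).
    have rg (A B : comNzRingType) (f : {rmorphism A -> B}) (f' : A -> B) x y z t x' t' :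
        (forall a, f a = f' a) -> f' x = x' -> f' t = t' ->
        f' (x * y - z * t) = x' * f' y - f' z * t'.
      by move=> ff' <- <-; rewrite -!ff' rmorphB !rmorphM.
    have [R [RE _ _]] := drename_hom m F (val : Iw -> uidx).
    by apply: (rg _ _ (ev \o R : {rmorphism _ -> _}) (fun r => ev (drename val r))
      _ _ _ _ _ _ (fun r => congr1 ev (RE r)) (congr1 ev (drename_der val k p))
      (congr1 ev (drename_der val k q))).
  move=> tau x; apply: esym; apply: (etrans (esym (hj _))).
  apply: (etrans _ (congr1 (dop D tau) (hj x))).
  exact: (@dop_morph _ _ _ _ D (fun _ => True) h tau x (fun _ _ _ => I) (fun k y _ => h_der k y) I).
- move=> tau nt; rewrite u00E dop_a a_root.2 //= (negPf nt) andbF //.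
- by rewrite u00E dop_a a_root.1.
move=> pi pi1 T; rewrite u00E dop_a !eval_atE.
have := aG pi pi1; rewrite tailE -!evE => /eqP; rewrite addr_eq0 => /eqP e.
apply: (etrans _ (congr1 (fun z => - z / ev S) (esym e))).
by rewrite opprK mulrC mulKf.
Qed.

Section GivenDerivations.
Variable D : 'I_m -> Omega -> Omega.
Hypothesis DP : root_derivations j G gamma D.
Local Notation Q := (adjoin_root j gamma).
Local Notation a := (fun v : X => dop D v.1
  (if v.2 == u00 then u00_at j gamma else j (deriv_0 (mone, v.2)))).

Lemma base_in_adjoin_root (w : uidx) :
  Q (if w == u00 then u00_at j gamma else j (deriv_0 (mone, w))).
Proof.
case: ifP => _; last exact: adjoin_root_base.
rewrite /u00_at; case: ifP => _; last exact: adjoin_root_base.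
exact adjoin_root_root.
Qed.

Lemma dop_in_adjoin_root tau x : Q x -> Q (dop D tau x).
Proof. exact: (@dop_stable _ _ _ _ (rd_stable DP)). Qed.

Lemma dop_ucm k x : Q x -> dop D (ucm k) x = D k x.
Proof.
by move=> Qx; rewrite -[ucm k]mulm1 (dopS (rd_stable DP) _ _ (rd_comm DP) Qx) dop1.
Qed.

(** [G], its initial and its separant only involve derivatives whose values are prescribed by
    [F_0] and the root, so any derivations attached to the root evaluate them in the same way. *)
Lemma given_root_assignment : root_assignment theta u00 b gamma a.
Proof.
split=> [|[tau w] /= fw]; first by rewrite eqxx; exact: (rd_leader DP).
have [ew|nw] := eqVneq w u00.
  by move: fw; rewrite ew eqxx /=; exact: (rd_free DP).
have d0 sigma : deriv_0 (sigma, w) =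
    u_to_0 theta (FracField.tofrac (dvar F sigma (Sub w nw : Iw))).
  by rewrite /deriv_0 /= insubT.
rewrite !d0 (rd_base DP); congr (j (u_to_0 theta _)).
rewrite -(dop_dpder_dvar F tau (Sub w nw : Iw)); apply: esym.
apply: (@dop_morph _ _ _ _ _ (fun _ => True) (@FracField.tofrac _)) => // k p _.
by apply: esym; apply: frac_der_tofrac; exact: dpder_derivation.
Qed.

(** The coordinates of the generic point of [V] are the quotients of the partial derivatives
    of [G] by its separant, and at the root they satisfy the linear relation. *)
Lemma root_coordinates :
  sat lt G (S * dvar F mone u00 + \sum_(rho < n) dvar F mone (ord0, lift ord0 rho) *
      separant (theta, (ord0, lift ord0 rho)) G) ->
  exists xi : 'I_n -> Omega, (forall rho, Q (xi rho)) /\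
    dop D theta (\sum_(rho < n) j (deriv_0 (mone, (ord0, lift ord0 rho))) * xi rho) = - gamma.
Proof.
have [[[irr tr _ _ _] _] adjF] := (lt_orderly, adjoin_root_subfield).
have [Q0 QN QD QM QV] := subfield_opp_add_mul adjF.
have [alpha alphaP] := field_0_hom_exists n d F theta.
have a_root := given_root_assignment.
have [ev [evC evV]] := cpoly_hom cj a.
have evG := ev_G lt_orderly G_leader gamma_root alphaP a_root evC evV.
have [S0 _] := ev_S_multiple lt_orderly G_leader G_irreducible F_char0 gamma_root alphaP
  a_root evC evV.
have evQ p : Q (ev p).
  apply: (hom_in_subfield adjF) => [c|v _]; first by rewrite evC; exact: adjoin_root_base.
  by rewrite evV; apply: dop_in_adjoin_root; exact: base_in_adjoin_root.
have Dev k p : ev (dpder k p) = D k (ev p).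
  apply: hom_dpder => [q r|q r|c|[tau w]].
  - exact: (rd_add DP).
  - exact: (rd_mul DP).
  - apply: (etrans (evC _)); apply: (etrans _ (congr1 (D k) (esym (evC c)))).
    have e1 := etrans (esym (dop_ucm k (adjoin_root_base (u_to_0 theta (F_to_u n d c)))))
      (rd_base DP (ucm k) (F_to_u n d c)).
    have e2 : dop (@dder m Fu) (ucm k) (F_to_u n d c) = F_to_u n d (dder k c).
      rewrite -[ucm k]mulm1 (dop_mulS (dder_commuting Fu)) dop1.
      apply: (etrans (frac_der_tofrac (@dpder_derivation m F Iw k) _)).
      congr (FracField.tofrac _); exact: dpderC.
    exact: esym (etrans e1 (congr1 (fun x => j (u_to_0 theta x)) e2)).
  - apply: (etrans (evV _)); apply: (etrans _ (congr1 (D k) (esym (evV _)))).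
    exact: (dopS (rd_stable DP) _ _ (rd_comm DP) (base_in_adjoin_root w)).
have D0 k : D k 0 = 0.
  by apply: (addrI (D k 0)); rewrite -(rd_add DP) ?addr0.
have J_ev p : dideal_gen (@dpder m F uidx) (eq^~ G) p -> ev p = 0.
  move=> /(_ (fun q => ev q = 0)); apply; last by move=> _ ->.
  split=> [|p1 q1 e1 e2|p1 q1 e|k p1 e]; first exact: rmorph0.
  - by rewrite rmorphD e1 e2 addr0.
  - by rewrite rmorphM e mulr0.
  - by rewrite Dev e D0.
have ev_initial : ev (initial v0 G) != 0.
  have sI := supp_in_base_coefv (W := free) (e := degv v0 G) (G_reduced lt_orderly G_leader).
  rewrite (ev_free alphaP a_root evC evV sI) fmorph_eq0.
  apply/eqP => /(field_0_homI alphaP sI); apply: initial_neq0; apply/eqP.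
  by case: G_irreducible.
set rel := (X in sat lt G X); move=> [v v_leader [e Je]].
have ev0 : v = v0.
  apply/eqP; apply: contraT => nv; have vv := G_leader.2 v v_leader.1 nv.
  have := v_leader.2 v0 G_leader.1; rewrite eq_sym => /(_ nv) /(tr _ _ _ vv).
  by rewrite irr.
have ev_rel : ev rel = 0.
  move: (J_ev _ Je); rewrite ev0 rmorphM rmorphXn rmorphM => /eqP.
  by rewrite mulf_eq0 expf_eq0 mulf_eq0 (negPf ev_initial) (negPf S0) andbF => /eqP.
exists (fun rho => ev (separant (theta, (ord0, lift ord0 rho)) G) / ev S).
split=> [rho|]; first exact: QV.
have u00Q : Q (u00_at j gamma) by have := base_in_adjoin_root u00; rewrite eqxx.
have -> : \sum_(rho < n) j (deriv_0 (mone, (ord0, lift ord0 rho))) *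
    (ev (separant (theta, (ord0, lift ord0 rho)) G) / ev S) = - u00_at j gamma.
  have rg (B : comNzRingType) (f : {rmorphism B -> Omega}) (s u0 : B) (u x : 'I_n -> B)
      (fu0 : Omega) (fu : 'I_n -> Omega) : f s != 0 -> f u0 = fu0 -> (forall r, f (u r) = fu r) ->
      f (s * u0 + \sum_(r < n) u r * x r) = 0 -> \sum_(r < n) fu r * (f (x r) / f s) = - fu0.
    move=> s0 e0 eu; rewrite rmorphD rmorphM rmorph_sum e0 => /eqP; rewrite addr_eq0 => /eqP es.
    apply: (mulfI s0); rewrite mulrN es opprK mulr_sumr; apply: eq_bigr => r _.
    by rewrite rmorphM eu; field.
  apply: (rg _ ev S (dvar F mone u00) (fun rho => dvar F mone (ord0, lift ord0 rho)) _ _ _ S0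
    _ _ ev_rel) => [|r]; apply: (etrans (evV _)); rewrite dop1 /=; exact: erefl.
apply: (etrans _ (congr1 -%R (rd_leader DP))); apply: esym.
apply: (@dop_morph _ _ _ D D Q -%R) => // [|k x Qx]; first exact: (rd_stable DP).
by apply: (addrI (D k x)); rewrite subrr -(rd_add DP) ?subrr ?D0 //; exact: QN.
Qed.

End GivenDerivations.
End RootDerivations.

(** * The product formula *)

Lemma leading_coefficient (m n d : nat) (F : dfield m) (theta : {cmonom 'I_m})
    (lt : rel (derivative m (uidx n d))) (G : cpoly F (derivative m (uidx n d))) :
  orderly_ranking lt -> is_leader lt (theta, u00) G ->
  size (univariate theta G) = (degv (theta, u00) G).+1 ->
  univariate theta (initial (theta, u00) G) = (lead_coef (univariate theta G))%:P.
Proof.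
move=> lt_orderly G_leader sz.
have [alpha alphaP] := field_0_hom_exists n d F theta.
have [U [UE UC UV]] := univariate_hom alphaP.
have nf := leader_not_free; have sG := G_reduced lt_orderly G_leader.
pose free (v : derivative m (uidx n d)) := ~~ ((v.2 == u00) && tdvd theta v.1).
rewrite -UE (univ_base (W := free) (v0 := (theta, u00)) (nf _ _ _ _) UC UV); last first.
  exact: (supp_in_base_coefv (W := free) sG).
by rewrite lead_coefE sz /= -UE (coef_univ (W := free) (nf _ _ _ _) UC UV _ sG).
Qed.

Theorem theorem5p8 (m n d s g : nat) (F E : dfield m) (iE : dhom F E)
    (V : ('I_n -> E) -> Prop) (lt : rel (derivative m (uidx n d)))
    (G : cpoly F (derivative m (uidx n d))) (theta : {cmonom 'I_m})
    (Omega : closedFieldType) (j : {rmorphism field_0 n d F theta -> Omega})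
    (gamma : 'I_g -> Omega)
    (m_ge2 : (2 <= m)%N)
    (F_char0 : [pchar F] =i pred0)
    (E_universal : universal_extension iE)
    (V_irreducible : irreducible_dvariety iE V)
    (V_kolchin : is_kolchin_poly iE V
       (d.+1%:R *: binom_poly ('X + m%:R) m - binom_poly ('X + m%:R - s%:R) m))
    (lt_orderly : orderly_ranking lt)
    (lt_u00 : forall w : uidx n d, w != u00 -> lt (mone, w) (mone, u00))
    (G_chow : is_chow_form iE lt V G)
    (G_leader : is_leader lt (theta, u00) G)
    (G_degree : g = degv (theta, u00) G)
    (Omega_algebraic : is_algebraic_extension j)
    (gamma_roots :
       map_poly j (univariate theta G) =
         j (lead_coef (univariate theta G)) *: \prod_(l < g) ('X - (gamma l)%:P)) :
  (exists D : 'I_g -> 'I_m -> Omega -> Omega,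
     forall l, root_derivations j G (gamma l) (D l)) /\
  forall D : 'I_g -> 'I_m -> Omega -> Omega,
    (forall l, root_derivations j G (gamma l) (D l)) ->
  exists xi : 'I_g -> 'I_n -> Omega,
    (forall l rho, adjoin_root j (gamma l) (xi l rho)) /\
    exists A : cpoly F (derivative m (uidx n d)),
      (forall pi, pi != mone -> ~ occurs (mmul pi theta, u00) A) /\
      map_poly j (univariate theta G) =
        map_poly j (univariate theta A) *
        \prod_(l < g)
          ('X + (dop (D l) theta
                   (\sum_(rho < n)
                      j (deriv_0 (mone, (ord0, lift ord0 rho))) * xi l rho))%:P).
Proof.
have [G_irr _] := G_chow.
have root_gamma l : root (map_poly j (univariate theta G)) (gamma l).
  rewrite gamma_roots /root hornerZ horner_prod (bigD1 l) //=.
  by rewrite hornerXsubC subrr mul0r mulr0.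
have rel := chow_relation lt_orderly G_leader G_chow.
split.
  have ex l := root_derivations_exist lt_orderly G_leader G_irr F_char0 (root_gamma l).
  exists (fun l => epsilon (inhabits (fun _ => id)) (root_derivations j G (gamma l))) => l.
  exact: epsilon_spec.
move=> D DP.
have ex l := root_coordinates lt_orderly G_leader G_irr F_char0 (root_gamma l) (DP l) rel.
pose P l xi := (forall rho, adjoin_root j (gamma l) (xi rho)) /\
  dop (D l) theta (\sum_(rho < n) j (deriv_0 (mone, (ord0, lift ord0 rho))) * xi rho) = - gamma l.
pose xi l := epsilon (inhabits (fun _ : 'I_n => 0 : Omega)) (P l).
have xiP l : P l (xi l) by apply: epsilon_spec; exact: ex.
exists xi; split; first by move=> l; case: (xiP l).
exists (initial (theta, u00) G); split.
  pose free (v : derivative m (uidx n d)) := ~~ ((v.2 == u00) && tdvd theta v.1).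
  move=> pi _ /(supp_in_base_coefv (W := free) (G_reduced lt_orderly G_leader)).
  by rewrite /free /= (_ : tdvd _ _ = true) //; apply/tdvdP; exists pi.
have l0 : j (lead_coef (univariate theta G)) != 0.
  rewrite fmorph_eq0 lead_coef_eq0; apply/eqP => G0; case: G_irr => + _ _; apply.
  exact: univariate_inj (G_reduced lt_orderly G_leader) G0.
have sz : size (univariate theta G) = (degv (theta, u00) G).+1.
  rewrite -(size_map_poly j) gamma_roots size_scale // -G_degree.
  by rewrite size_prod_XsubC -[index_enum _]enumT size_enum_ord.
rewrite (leading_coefficient lt_orderly G_leader sz) gamma_roots map_polyC /= mul_polyC.
by congr (_ *: _); apply: eq_bigr => l _; rewrite (xiP l).2 polyCN.
Qed.
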